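(* Assume that (1) $\beta$ and $\gamma$ are strictly positive; (2) the quadratic form $$F=a^{(33)}_{ji}E_jE_i+a^{(77)}_{jikl}V_{kl}V_{ji}$$ in the variables $(E_i,V_{ij})$, with $V_{ij}=V_{ji}$, is definite. If $S_4$ is nonempty, then the mixed initial-boundary value problem $\Pi$ has at most one solution.
   Context: Conventions: Latin subscripts range over $1,2,3$; repeated subscripts are summed; $_{,i}$ denotes $\partial/\partial x_i$; a superposed dot denotes $\partial/\partial t$; $I=[0,\infty)$; dependence on $x$ is suppressed. $B$ is a bounded region (connected open set) of three-dimensional Euclidean space with smooth boundary $\partial B$ and outward unit normal $n_i$. Constants (homogeneous, center-symmetric material): $\rho>0$, $T_0>0$, $\beta\neq0$, $c\neq0$, $\gamma$, $\beta'=\beta+\gamma/(c\beta)$, and coefficients with the symmetries $a^{(11)}_{ijkl}=a^{(11)}_{jikl}=a^{(11)}_{klij}$, $a^{(14)}_{ij}=a^{(14)}_{ji}$, $a^{(22)}_{ijklhm}=a^{(22)}_{jiklhm}=a^{(22)}_{lhmijk}$, $a^{(23)}_{ijkl}=a^{(23)}_{jikl}$, $a^{(33)}_{ij}=a^{(33)}_{ji}$, $k_{ij}=k_{ji}$, $a^{(17)}_{ijkl}=a^{(17)}_{jikl}$, $a^{(77)}_{ijkl}=a^{(77)}_{jikl}=a^{(77)}_{klij}$, $a^{(47)}_{ij}=a^{(47)}_{ji}$. It is assumed that $\gamma/\beta\ge0$ and $k_{ij}\eta_i\eta_j\ge0$ for all vectors $\eta_i$. An admissible process is an ordered array $\pi=(u_i,\theta,\varphi,e_{ij},\kappa_{ijk},\beta_i,E_i,V_{ij},\tau_{ij},\mu_{ijk},\sigma_i,Q_{ji},\eta,q_i)$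 of functions on $\bar B\times I$ with $u_i\in C^{4,2}$, $\varphi\in C^{4,0}$, $\theta\in C^{2,2}$, $e_{ij},V_{ij}\in C^{2,1}$, $\eta\in C^{0,1}$, $\kappa_{ijk},E_i,\mu_{ijk},Q_{ij}\in C^{2,0}$, $\beta_i,\tau_{ij},\sigma_i,q_i\in C^{1,0}$ (all on $\bar B\times I$), and $e_{ij}=e_{ji}$, $\kappa_{ijk}=\kappa_{jik}$, $V_{ij}=V_{ji}$, $\tau_{ij}=\tau_{ji}$, $\mu_{kji}=\mu_{jki}$, $Q_{ij}=Q_{ji}$. Here $C^{M,N}$ means continuous together with partial derivatives of order up to $M$ in $x$ and up to $N$ in $t$. Problem $\Pi$. The data $f_i,g,h,u_i^0,v_i^0,\theta^0,\eta^0,\hat u_i,\hat d_i,\hat\theta,\hat\varphi,\hat\omega,\hat P_i,\hat R_i,\hat q,\hat\Lambda,\hat H$ are prescribed continuous functions. A solution of $\Pi$ is an admissible process satisfying: (1) balance equations: $\tau_{ji,j}-\mu_{kji,kj}+\rho f_i=\rho\ddot u_i$, $\ \sigma_{i,i}-Q_{ji,ji}=g$, $\ \rho T_0\dot\eta+q_{j,j}-\rho h=0$; (2) geometric equations: $e_{ij}=\frac12(u_{i,j}+u_{j,i})$, $\kappa_{ijk}=u_{k,ij}$, $\beta_i=\theta_{,i}$, $E_i=-\varphi_{,i}$, $V_{ij}=-\varphi_{,ij}$; (3) constitutive equations: $\tau_{ij}=a^{(11)}_{ijkl}e_{kl}+a^{(17)}_{ijkl}V_{kl}+a^{(14)}_{ij}(\theta+\beta\dot\theta)$,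 $\ \mu_{ijk}=a^{(22)}_{ijklhm}\kappa_{lhm}+a^{(23)}_{ijkl}E_l$, $\ -\sigma_i=a^{(23)}_{jkli}\kappa_{jkl}+a^{(33)}_{ij}E_j$, $\ -Q_{ij}=a^{(17)}_{klij}e_{kl}+a^{(77)}_{ijkl}V_{kl}+a^{(47)}_{ij}(\theta+\beta\dot\theta)$, $\ -\rho\eta=a^{(14)}_{ij}e_{ij}+a^{(47)}_{ij}V_{ij}+c(\theta+\beta'\dot\theta)$, $\ -\frac1{T_0}q_i=k_{ij}\beta_j$; (4) initial conditions in $\bar B$: $u_i(0)=u_i^0$, $\dot u_i(0)=v_i^0$, $\theta(0)=\theta^0$, $\eta(0)=\eta^0$; (5) boundary conditions: $u_i=\hat u_i$ on $S_1\times I$, $P_i=\hat P_i$ on $\Sigma_1\times I$; $\mathcal Du_i=\hat d_i$ on $S_2\times I$, $R_i=\hat R_i$ on $\Sigma_2\times I$; $\theta=\hat\theta$ on $S_3\times I$, $q=\hat q$ on $\Sigma_3\times I$; $\varphi=\hat\varphi$ on $S_4\times I$, $\Lambda=\hat\Lambda$ on $\Sigma_4\times I$; $\mathcal D\varphi=\hat\omega$ on $S_5\times I$, $H=\hat H$ on $\Sigma_5\times I$. Here $S_i,\Sigma_i\subset\partial B$ with $\bar S_i\cup\Sigma_i=\partial B$ (closure relative to $\partial B$), $S_i\cap\Sigma_i=\varnothing$, $i=1,\dots,5$; $\mathcal D=n_i\partial/\partial x_i$, $\mathcal D_i=(\delta_{ij}-n_in_j)\partial/\partial x_j$; $q=q_in_i$;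 $P_i=(\tau_{ji}-\mu_{kji,k})n_j-\mathcal D_j(\mu_{kji}n_k)+(\mathcal D_ln_l)\mu_{kji}n_kn_j$; $\Lambda=(\sigma_j-Q_{kj,k})n_j-\mathcal D_j(Q_{kj}n_k)+(\mathcal D_ln_l)Q_{kj}n_kn_j$; $R_i=\mu_{kji}n_kn_j$; $H=Q_{kj}n_kn_j$. *)

(* Defs.v *)
From HB Require Import structures.
From mathcomp Require Import all_boot all_order all_algebra.
From mathcomp Require Import all_classical all_reals all_analysis.

Set Implicit Arguments.
Unset Strict Implicit.
Unset Printing Implicit Defensive.

Import Order.TTheory GRing.Theory Num.Theory.
Import numFieldNormedType.Exports.

Local Open Scope classical_set_scope.
Local Open Scope ring_scope.

(* The Latin indices 1, 2, 3 are the elements of 'I_3. *)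
Notation E3 R := 'rV[R]_3.

(* scalar functions of position and time *)
Notation tfield R := (E3 R -> R -> R).

Section Calculus.
Variable R : realType.
Implicit Types (B U : set (E3 R)) (f : tfield R) (g : E3 R -> R).

Definition bdry B : set (E3 R) := closure B `\` interior B.

Definition axis (j : 'I_3) : E3 R := delta_mx 0 j.

Definition kron (i j : 'I_3) : R := (i == j)%:R.

Definition timeI : set R := [set t | 0 <= t].

Definition cyl B : set (E3 R * R) := B `*` timeI.

(* On the boundary of B a partial derivative is the limit of its values inside
   B; for functions of class C^1 on the closure it is the continuous extension. *)
Definition pd B (j : 'I_3) g : E3 R -> R := fun x =>
  if x \in B then 'D_(axis j) g x
  else lim ('D_(axis j) g y @[y --> within B (nbhs x)]).

Definition dx B (j : 'I_3) f : tfield R := fun x t => pd B j (f^~ t) x.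

(* Derivatives relative to [0, +oo[, hence one-sided at t = 0. *)
Definition dt_quotient (a : R -> R) (t h : R) : R := h^-1 * (a (t + h) - a t).

Definition dt_filter (t : R) : set_system R :=
  within [set h | timeI (t + h)] (0 : R)^'.

Definition derivable_t (a : R -> R) (t : R) : Prop :=
  cvg (dt_quotient a t h @[h --> dt_filter t]).

Definition dt f : tfield R := fun x t =>
  lim (dt_quotient (f x) t h @[h --> dt_filter t]).

Definition dxs B (s : seq 'I_3) f : tfield R := foldr (dx B) f s.

(* C^{M,N} on (closure of B) x [0, +oo[ : all the derivatives, mixed ones
   included, of order at most M in x and at most N in t exist and are
   continuous up to the boundary. *)
Definition classC B (M N : nat) f : Prop :=
  [/\ forall (s : seq 'I_3) (k : nat), (size s <= M)%N -> (k <= N)%N ->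
        {within cyl (closure B),
          continuous (fun z : E3 R * R => dxs B s (iter k dt f) z.1 z.2)},
      forall (s : seq 'I_3) (k : nat), (size s < M)%N -> (k <= N)%N ->
        forall j x t, B x -> timeI t ->
        derivable ((dxs B s (iter k dt f))^~ t) x (axis j)
    & forall k : nat, (k < N)%N ->
        forall x t, closure B x -> timeI t -> derivable_t (iter k dt f x) t].

(* C^infinity on an open set U *)
Definition partials (s : seq 'I_3) g : E3 R -> R :=
  foldr (fun j g' => 'D_(axis j) g') g s.

Definition smooth_on U g : Prop :=
  forall (s : seq 'I_3) x, U x ->
    {for x, continuous (partials s g)} /\
    forall j, derivable (partials s g) x (axis j).

Definition grad_norm g (p : E3 R) : R :=
  Num.sqrt (\sum_j ('D_(axis j) g p) ^+ 2).

(* Near the boundary point p, B is the sublevel set { g < 0 }. *)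
Definition local_defining_function B (p : E3 R) g : Prop :=
  exists U : set (E3 R),
    [/\ open U, U p, smooth_on U g, grad_norm g p != 0
      & B `&` U = [set x | g x < 0] `&` U].

Definition smooth_bounded_region B : Prop :=
  [/\ open B, connected B, bounded_set B
    & forall p, bdry B p -> exists g, local_defining_function B p g].

(* The outward unit normal is given as a field on the whole space which is
   smooth on a neighbourhood of the boundary, so that the surface operators
   below can be applied to it; their values on the boundary do not depend on
   how the normal is extended off the boundary. *)
Definition outward_unit_normal B (n : E3 R -> E3 R) : Prop :=
  (exists U : set (E3 R),
     [/\ open U, bdry B `<=` U & forall j, smooth_on U (fun x => n x 0 j)]) /\
  (forall p, bdry B p -> exists2 g, local_defining_function B p g
     & forall j, n p 0 j = 'D_(axis j) g p / grad_norm g p).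

End Calculus.

Section Surface.
Variables (R : realType) (B : set (E3 R)) (n : E3 R -> E3 R).

Definition normal_deriv (f : tfield R) : tfield R := fun p t =>
  \sum_j n p 0 j * dx B j f p t.

Definition surf_deriv (i : 'I_3) (g : E3 R -> R) (p : E3 R) : R :=
  \sum_j (kron R i j - n p 0 i * n p 0 j) * pd B j g p.

Definition surf_div_normal (p : E3 R) : R :=
  \sum_l surf_deriv l (fun x => n x 0 l) p.

(* (s_j - m_kj,k) n_j - D_j (m_kj n_k) + (D_l n_l) m_kj n_k n_j *)
Definition normal_traction (s : 'I_3 -> tfield R) (m : 'I_3 -> 'I_3 -> tfield R) :
    tfield R := fun p t =>
  \sum_j (s j p t - \sum_k dx B k (m k j) p t) * n p 0 j
  - \sum_j surf_deriv j (fun x => \sum_k m k j x t * n x 0 k) p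
  + surf_div_normal p * \sum_k \sum_j m k j p t * n p 0 k * n p 0 j.

Definition double_normal (m : 'I_3 -> 'I_3 -> tfield R) : tfield R :=
  fun p t =>
  \sum_k \sum_j m k j p t * n p 0 k * n p 0 j.

End Surface.

Record material (R : realType) := Material {
  m_rho : R;
  m_T0 : R;
  m_beta : R;
  m_gamma : R;
  m_c : R;
  a11 : 'I_3 -> 'I_3 -> 'I_3 -> 'I_3 -> R;
  a14 : 'I_3 -> 'I_3 -> R;
  a17 : 'I_3 -> 'I_3 -> 'I_3 -> 'I_3 -> R;
  a22 : 'I_3 -> 'I_3 -> 'I_3 -> 'I_3 -> 'I_3 -> 'I_3 -> R;
  a23 : 'I_3 -> 'I_3 -> 'I_3 -> 'I_3 -> R;
  a33 : 'I_3 -> 'I_3 -> R;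
  a47 : 'I_3 -> 'I_3 -> R;
  a77 : 'I_3 -> 'I_3 -> 'I_3 -> 'I_3 -> R;
  m_k : 'I_3 -> 'I_3 -> R
}.

Definition m_beta' (R : realType) (m : material R) : R :=
  m_beta m + m_gamma m / (m_c m * m_beta m).

Record material_axioms (R : realType) (m : material R) : Prop := {
  rho_gt0 : 0 < m_rho m;
  T0_gt0 : 0 < m_T0 m;
  beta_neq0 : m_beta m != 0;
  c_neq0 : m_c m != 0;
  a11_sym1 : forall i j k l, a11 m i j k l = a11 m j i k l;
  a11_sym2 : forall i j k l, a11 m i j k l = a11 m k l i j;
  a14_sym : forall i j, a14 m i j = a14 m j i;
  a22_sym1 : forall i j k l h r, a22 m i j k l h r = a22 m j i k l h r;
  a22_sym2 : forall i j k l h r, a22 m i j k l h r = a22 m l h r i j k;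
  a23_sym : forall i j k l, a23 m i j k l = a23 m j i k l;
  a33_sym : forall i j, a33 m i j = a33 m j i;
  k_sym : forall i j, m_k m i j = m_k m j i;
  a17_sym : forall i j k l, a17 m i j k l = a17 m j i k l;
  a77_sym1 : forall i j k l, a77 m i j k l = a77 m j i k l;
  a77_sym2 : forall i j k l, a77 m i j k l = a77 m k l i j;
  a47_sym : forall i j, a47 m i j = a47 m j i;
  gamma_div_beta_ge0 : 0 <= m_gamma m / m_beta m;
  k_ge0 : forall xi : 'I_3 -> R, 0 <= \sum_i \sum_j m_k m i j * xi i * xi j
}.

Definition electric_form (R : realType) (m : material R)
    (E : 'rV[R]_3) (V : 'M[R]_3) : R :=
  \sum_j \sum_i a33 m j i * E 0 j * E 0 i
  + \sum_j \sum_i \sum_k \sum_l a77 m j i k l * V k l * V j i.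

(* positive definite or negative definite *)
Definition electric_form_definite (R : realType) (m : material R) : Prop :=
  (forall (E : 'rV[R]_3) (V : 'M[R]_3), V^T = V -> (E != 0) || (V != 0) ->
     0 < electric_form m E V) \/
  (forall (E : 'rV[R]_3) (V : 'M[R]_3), V^T = V -> (E != 0) || (V != 0) ->
     electric_form m E V < 0).

Record process_array (R : realType) := Process {
  p_u : 'I_3 -> tfield R;
  p_theta : tfield R;
  p_phi : tfield R;
  p_e : 'I_3 -> 'I_3 -> tfield R;
  p_kappa : 'I_3 -> 'I_3 -> 'I_3 -> tfield R;
  p_beta : 'I_3 -> tfield R;
  p_E : 'I_3 -> tfield R;
  p_V : 'I_3 -> 'I_3 -> tfield R;
  p_tau : 'I_3 -> 'I_3 -> tfield R;
  p_mu : 'I_3 -> 'I_3 -> 'I_3 -> tfield R;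
  p_sigma : 'I_3 -> tfield R;
  p_Q : 'I_3 -> 'I_3 -> tfield R;
  p_eta : tfield R;
  p_q : 'I_3 -> tfield R
}.

Definition eq_on_closure (R : realType) (B : set (E3 R)) (f g : tfield R) :
    Prop :=
  forall x t, closure B x -> timeI t -> f x t = g x t.

Definition process_eq (R : realType) (B : set (E3 R)) (p p' : process_array R) :
    Prop :=
  (forall i, eq_on_closure B (p_u p i) (p_u p' i)) /\
  eq_on_closure B (p_theta p) (p_theta p') /\
  eq_on_closure B (p_phi p) (p_phi p') /\
  (forall i j, eq_on_closure B (p_e p i j) (p_e p' i j)) /\
  (forall i j k, eq_on_closure B (p_kappa p i j k) (p_kappa p' i j k)) /\
  (forall i, eq_on_closure B (p_beta p i) (p_beta p' i)) /\
  (forall i, eq_on_closure B (p_E p i) (p_E p' i)) /\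
  (forall i j, eq_on_closure B (p_V p i j) (p_V p' i j)) /\
  (forall i j, eq_on_closure B (p_tau p i j) (p_tau p' i j)) /\
  (forall i j k, eq_on_closure B (p_mu p i j k) (p_mu p' i j k)) /\
  (forall i, eq_on_closure B (p_sigma p i) (p_sigma p' i)) /\
  (forall i j, eq_on_closure B (p_Q p i j) (p_Q p' i j)) /\
  eq_on_closure B (p_eta p) (p_eta p') /\
  (forall i, eq_on_closure B (p_q p i) (p_q p' i)).

Record admissible (R : realType) (B : set (E3 R)) (p : process_array R) : Prop := {
  u_reg : forall i, classC B 4 2 (p_u p i);
  phi_reg : classC B 4 0 (p_phi p);
  theta_reg : classC B 2 2 (p_theta p);
  e_reg : forall i j, classC B 2 1 (p_e p i j);
  V_reg : forall i j, classC B 2 1 (p_V p i j);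
  eta_reg : classC B 0 1 (p_eta p);
  kappa_reg : forall i j k, classC B 2 0 (p_kappa p i j k);
  E_reg : forall i, classC B 2 0 (p_E p i);
  mu_reg : forall i j k, classC B 2 0 (p_mu p i j k);
  Q_reg : forall i j, classC B 2 0 (p_Q p i j);
  beta_reg : forall i, classC B 1 0 (p_beta p i);
  tau_reg : forall i j, classC B 1 0 (p_tau p i j);
  sigma_reg : forall i, classC B 1 0 (p_sigma p i);
  q_reg : forall i, classC B 1 0 (p_q p i);
  e_sym : forall i j, eq_on_closure B (p_e p i j) (p_e p j i);
  kappa_sym : forall i j k, eq_on_closure B (p_kappa p i j k) (p_kappa p j i k);
  V_sym : forall i j, eq_on_closure B (p_V p i j) (p_V p j i);
  tau_sym : forall i j, eq_on_closure B (p_tau p i j) (p_tau p j i);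
  mu_sym : forall k j i, eq_on_closure B (p_mu p k j i) (p_mu p j k i);
  Q_sym : forall i j, eq_on_closure B (p_Q p i j) (p_Q p j i)
}.

Record prescribed_data (R : realType) := Data {
  d_f : 'I_3 -> tfield R;
  d_g : tfield R;
  d_h : tfield R;
  d_u0 : 'I_3 -> E3 R -> R;
  d_v0 : 'I_3 -> E3 R -> R;
  d_theta0 : E3 R -> R;
  d_eta0 : E3 R -> R;
  d_uhat : 'I_3 -> tfield R;
  d_dhat : 'I_3 -> tfield R;
  d_thetahat : tfield R;
  d_phihat : tfield R;
  d_omegahat : tfield R;
  d_Phat : 'I_3 -> tfield R;
  d_Rhat : 'I_3 -> tfield R;
  d_qhat : tfield R;
  d_Lambdahat : tfield R;
  d_Hhat : tfield R
}.

(* The pairs (S k, Sigma k) are used for k = 1, ..., 5 only. *)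
Definition boundary_partition (R : realType) (B : set (E3 R))
    (S Sigma : nat -> set (E3 R)) : Prop :=
  forall k : nat, (1 <= k <= 5)%N ->
    [/\ S k `<=` bdry B, Sigma k `<=` bdry B,
        closure (S k) `|` Sigma k = bdry B & S k `&` Sigma k = set0].

Definition continuous_field (R : realType) (A : set (E3 R)) (f : tfield R) :
    Prop :=
  {within cyl A, continuous (fun z : E3 R * R => f z.1 z.2)}.

Record continuous_data (R : realType) (B : set (E3 R))
    (S Sigma : nat -> set (E3 R)) (d : prescribed_data R) : Prop := {
  f_cont : forall i, continuous_field (closure B) (d_f d i);
  g_cont : continuous_field (closure B) (d_g d);
  h_cont : continuous_field (closure B) (d_h d);
  u0_cont : forall i, {within closure B, continuous (d_u0 d i)};
  v0_cont : forall i, {within closure B, continuous (d_v0 d i)};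
  theta0_cont : {within closure B, continuous (d_theta0 d)};
  eta0_cont : {within closure B, continuous (d_eta0 d)};
  uhat_cont : forall i, continuous_field (S 1%N) (d_uhat d i);
  dhat_cont : forall i, continuous_field (S 2%N) (d_dhat d i);
  thetahat_cont : continuous_field (S 3%N) (d_thetahat d);
  phihat_cont : continuous_field (S 4%N) (d_phihat d);
  omegahat_cont : continuous_field (S 5%N) (d_omegahat d);
  Phat_cont : forall i, continuous_field (Sigma 1%N) (d_Phat d i);
  Rhat_cont : forall i, continuous_field (Sigma 2%N) (d_Rhat d i);
  qhat_cont : continuous_field (Sigma 3%N) (d_qhat d);
  Lambdahat_cont : continuous_field (Sigma 4%N) (d_Lambdahat d);
  Hhat_cont : continuous_field (Sigma 5%N) (d_Hhat d)
}.

Section Problem.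
Variables (R : realType) (B : set (E3 R)) (n : E3 R -> E3 R).
Variables (m : material R) (S Sigma : nat -> set (E3 R)) (d : prescribed_data R).
Implicit Type p : process_array R.

Record balance p : Prop := {
  momentum : forall i x t, B x -> timeI t ->
    \sum_j dx B j (p_tau p j i) x t
    - \sum_j \sum_k dx B j (dx B k (p_mu p k j i)) x t
    + m_rho m * d_f d i x t = m_rho m * dt (dt (p_u p i)) x t;
  charge : forall x t, B x -> timeI t ->
    \sum_i dx B i (p_sigma p i) x t
    - \sum_i \sum_j dx B i (dx B j (p_Q p j i)) x t = d_g d x t;
  energy : forall x t, B x -> timeI t ->
    m_rho m * m_T0 m * dt (p_eta p) x t + \sum_j dx B j (p_q p j) x t
    - m_rho m * d_h d x t = 0
}.

Record geometry p : Prop := {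
  e_def : forall i j x t, B x -> timeI t ->
    p_e p i j x t = 2^-1 * (dx B j (p_u p i) x t + dx B i (p_u p j) x t);
  kappa_def : forall i j k x t, B x -> timeI t ->
    p_kappa p i j k x t = dx B j (dx B i (p_u p k)) x t;
  beta_def : forall i x t, B x -> timeI t ->
    p_beta p i x t = dx B i (p_theta p) x t;
  E_def : forall i x t, B x -> timeI t ->
    p_E p i x t = - dx B i (p_phi p) x t;
  V_def : forall i j x t, B x -> timeI t ->
    p_V p i j x t = - dx B j (dx B i (p_phi p)) x t
}.

Record constitutive p : Prop := {
  tau_law : forall i j x t, B x -> timeI t ->
    p_tau p i j x t =
      \sum_k \sum_l a11 m i j k l * p_e p k l x t
      + \sum_k \sum_l a17 m i j k l * p_V p k l x t
      + a14 m i j * (p_theta p x t + m_beta m * dt (p_theta p) x t);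
  mu_law : forall i j k x t, B x -> timeI t ->
    p_mu p i j k x t =
      \sum_l \sum_h \sum_r a22 m i j k l h r * p_kappa p l h r x t
      + \sum_l a23 m i j k l * p_E p l x t;
  sigma_law : forall i x t, B x -> timeI t ->
    - p_sigma p i x t =
      \sum_j \sum_k \sum_l a23 m j k l i * p_kappa p j k l x t
      + \sum_j a33 m i j * p_E p j x t;
  Q_law : forall i j x t, B x -> timeI t ->
    - p_Q p i j x t =
      \sum_k \sum_l a17 m k l i j * p_e p k l x t
      + \sum_k \sum_l a77 m i j k l * p_V p k l x t
      + a47 m i j * (p_theta p x t + m_beta m * dt (p_theta p) x t);
  eta_law : forall x t, B x -> timeI t ->
    - (m_rho m * p_eta p x t) =
      \sum_i \sum_j a14 m i j * p_e p i j x t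
      + \sum_i \sum_j a47 m i j * p_V p i j x t
      + m_c m * (p_theta p x t + m_beta' m * dt (p_theta p) x t);
  q_law : forall i x t, B x -> timeI t ->
    - ((m_T0 m)^-1 * p_q p i x t) = \sum_j m_k m i j * p_beta p j x t
}.

Record initial_conditions p : Prop := {
  u_init : forall i x, closure B x -> p_u p i x 0 = d_u0 d i x;
  v_init : forall i x, closure B x -> dt (p_u p i) x 0 = d_v0 d i x;
  theta_init : forall x, closure B x -> p_theta p x 0 = d_theta0 d x;
  eta_init : forall x, closure B x -> p_eta p x 0 = d_eta0 d x
}.

Definition P_traction p (i : 'I_3) : tfield R :=
  normal_traction B n (fun j => p_tau p j i) (fun k j => p_mu p k j i).

Definition Lambda_traction p : tfield R :=
  normal_traction B n (p_sigma p) (p_Q p).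

Definition R_traction p (i : 'I_3) : tfield R :=
  double_normal n (fun k j => p_mu p k j i).

Definition H_traction p : tfield R := double_normal n (p_Q p).

Definition heat_flux p : tfield R := fun x t => \sum_i p_q p i x t * n x 0 i.

Definition agree_on (A : set (E3 R)) (f g : tfield R) : Prop :=
  forall x t, A x -> timeI t -> f x t = g x t.

Record boundary_conditions p : Prop := {
  u_bc : forall i, agree_on (S 1%N) (p_u p i) (d_uhat d i);
  P_bc : forall i, agree_on (Sigma 1%N) (P_traction p i) (d_Phat d i);
  du_bc : forall i,
    agree_on (S 2%N) (normal_deriv B n (p_u p i)) (d_dhat d i);
  R_bc : forall i, agree_on (Sigma 2%N) (R_traction p i) (d_Rhat d i);
  theta_bc : agree_on (S 3%N) (p_theta p) (d_thetahat d);
  q_bc : agree_on (Sigma 3%N) (heat_flux p) (d_qhat d);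
  phi_bc : agree_on (S 4%N) (p_phi p) (d_phihat d);
  Lambda_bc : agree_on (Sigma 4%N) (Lambda_traction p) (d_Lambdahat d);
  dphi_bc : agree_on (S 5%N) (normal_deriv B n (p_phi p)) (d_omegahat d);
  H_bc : agree_on (Sigma 5%N) (H_traction p) (d_Hhat d)
}.

Definition solution_Pi p : Prop :=
  [/\ admissible B p /\ balance p, geometry p, constitutive p, initial_conditions p
    & boundary_conditions p].

End Problem.

(* Main.v *)
(* For the difference of two solutions all the data vanish. Pair the balance equations at a time r
   with the fields at a time s: the symmetry of the constitutive coefficients and the integrated
   energy equation, written with g_i = \int_0^t theta_,i, give a reciprocity relation between r
   and s. For r = t + z and s = t - z its integrand is a derivative with respect to z; integrating
   from z = 0 to z = t gives
     d/dt \int_B (rho u_i u_i + beta k_ij g_i g_j)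
       = - \int_B (k_ij g_i g_j + gamma / beta theta^2) <= 0,
   whence u = 0 and theta = 0. The charge equation paired with phi then says that the integral of
   the definite form F is zero, so that phi is constant, and phi = 0 because S_4 is not empty.

   Of the divergence theorem only one case is needed, and it involves no surface measure: the
   divergence of a C^1 field which is tangential to the boundary has integral zero. Locally the
   field is multiplied by a cutoff function of g / eps, where g defines the boundary, and the
   error is o(1) because grad g . Y = 0 for g = 0. The surface operators enter through the
   divergence-free field d_i (n_i G_j - n_j G_i), where G_j = m_kj n_k v: added to the flux of the
   second-order balance equation tested with v, it turns its normal component into
   P v + R Dv. *)
From HB Require Import structures.
Require Import Defs.
From mathcomp Require Import all_boot all_order all_algebra.
From mathcomp Require Import all_classical all_reals all_analysis.
From mathcomp Require Import measurable_realfun.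
From mathcomp Require Import ring lra.

Set Implicit Arguments.
Unset Strict Implicit.
Unset Printing Implicit Defensive.

Import Order.TTheory GRing.Theory Num.Theory.
Import numFieldNormedType.Exports.

Local Open Scope classical_set_scope.
Local Open Scope ring_scope.

(** * Integration over a region *)

Section Volume.
Variable R : realType.
Notation leb := (@lebesgue_measure R).
Notation mR := (measurableTypeR R).
Implicit Types (B U : set (E3 R)) (f : E3 R -> R).

(** No sign is assumed for the elastic coefficients or for [m_c], so there is no positive energy to
    estimate, and [p_phi] has no time derivatives with which to differentiate one. Pairing two
    different times meets both difficulties: in the difference of the pairings the elastic and
    electric terms cancel by symmetry, and the temperature terms leave the factor c (beta' - beta) =
    gamma / beta, from which c has disappeared. What remains contains only u, theta and g_i, through
    quadratic forms that are nonnegative at equal times. The heat equation is integrated in time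
    because it contains the rate of eta, whereas the constitutive equation contains eta itself. The
    classical form of the tractions comes from integrating tangential derivatives of the test
    function by parts over the boundary. The divergence-free field does the same work inside B,
    where exchanging second derivatives is enough. Derivatives on the boundary are limits from
    inside, additive only where the limits exist; hence the class [Ck], in which they are continuous
    extensions. The normal is controlled only near the boundary, so it is first extended by a
    cutoff. *)

Definition point (z : (mR * mR) * mR) : E3 R :=
  \row_(j < 3) (if j == 0 :> nat then z.1.1 else if j == 1%N :> nat then z.1.2 else z.2).

Definition area : set (mR * mR)%type -> \bar R := (leb \x leb)%E.

HB.instance Definition _ := Measure.on area.

Let area_sigma_finite : sigma_finite setT area.
Proof.
exists (fun n => ball (0 : mR) n.+1%:R `*` ball (0 : mR) n.+1%:R).
  rewrite predeqE => -[x y]; split => // _.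
  exists (Num.truncn (Num.max `|x| `|y|)) => //=.
  rewrite /ball/= !sub0r !normrN.
  have h : Num.max `|x| `|y| < (Num.truncn (Num.max `|x| `|y|)).+1%:R by rewrite truncnS_gt.
  by move: h; rewrite gt_max => /andP[].
move=> k; split; first by apply: measurableX; exact: measurable_ball.
rewrite /area product_measure1E; try exact: measurable_ball.
have Lb : leb (ball 0 k.+1%:R) = (k.+1%:R *+ 2)%:E by exact: lebesgue_measure_ball.
by rewrite /= Lb -EFinM ltry.
Qed.

HB.instance Definition _ := Measure_isSigmaFinite.Build _ _ _ area area_sigma_finite.

(** Lebesgue measure on triples; sets and functions on [E3 R] are pulled back along [point], so that
    Fubini's theorem applies one coordinate at a time. *)
Definition volume : {measure set ((mR * mR) * mR)%type -> \bar R} := (area \x leb)%E.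

Lemma ball_rV (x y : E3 R) (e : R) : 0 < e ->
  ball x e y <-> forall j, `|x 0 j - y 0 j| < e.
Proof.
move=> e0; split => [h j|h].
  by case: h => _ /(_ 0 j).
by split=> // i j; rewrite (ord1 i); exact: h.
Qed.

(** The norm of row vectors is the maximum norm, so balls are cubes: their preimages are products of
    intervals, with explicit volume. *)
Lemma point_ball_preimage (x : E3 R) (e : R) : 0 < e ->
  point @^-1` (ball x e) =
  (ball (x 0 (inord 0)) e `*` ball (x 0 (inord 1)) e) `*` ball (x 0 (inord 2)) e.
Proof.
move=> e0; apply/seteqP; split => [[[a b] c]|[[a b] c]] /=.
  move=> /(ball_rV _ _ e0) h.
  have := h (inord 0); have := h (inord 1); have := h (inord 2).
  by rewrite !mxE !inordK.
move=> [[h0 h1] h2]; apply/(ball_rV _ _ e0) => j; rewrite mxE.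
case: j => -[|[|[|//]]] hj /=.
- by rewrite (_ : Ordinal hj = inord 0)//; apply: val_inj; rewrite /= inordK.
- by rewrite (_ : Ordinal hj = inord 1)//; apply: val_inj; rewrite /= inordK.
- by rewrite (_ : Ordinal hj = inord 2)//; apply: val_inj; rewrite /= inordK.
Qed.

Lemma measurable_ballR (x e : R) : measurable (ball x e : set mR).
Proof. by exact: measurable_ball. Qed.

Lemma volume_box (A1 A2 A3 : set mR) :
  measurable A1 -> measurable A2 -> measurable A3 ->
  volume (A1 `*` A2 `*` A3) = (leb A1 * leb A2 * leb A3)%E.
Proof.
move=> h1 h2 h3.
transitivity (area (A1 `*` A2) * leb A3)%E.
  by apply: (product_measure1E area leb) => //; exact: measurableX.
by rewrite /area /= product_measure1E.
Qed.

Lemma measurable_point_ball (x : E3 R) (e : R) : 0 < e ->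
  measurable (point @^-1` (ball x e)).
Proof.
move=> e0; rewrite point_ball_preimage//.
by apply: measurableX; [apply: measurableX|]; exact: measurable_ballR.
Qed.

Lemma volume_ball (x : E3 R) (e : R) : 0 < e ->
  volume (point @^-1` (ball x e)) = ((e *+ 2) ^+ 3)%:E.
Proof.
move=> e0; rewrite point_ball_preimage//.
have e0' := ltW e0.
rewrite volume_box; try exact: measurable_ballR.
by rewrite !lebesgue_measure_ball// -!EFinM -expr2 -exprSr.
Qed.

Lemma rat_near (x e : R) : 0 < e -> exists q : rat, `|x - ratr q| < e.
Proof.
move=> e0; have /rat_in_itvoo[q] : x - e < x + e by lra.
rewrite in_itv/= => /andP[h1 h2]; exists q.
by rewrite ltr_norml; apply/andP; split; lra.
Qed.

(** Countably many cubes with rational centre and radius cover U from inside. A cube of radius below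
    e / 2 that contains a point stays in the ball of radius e around it. *)
Lemma open_measurable_point U : open U -> measurable (point @^-1` U).
Proof.
move=> oU.
pose box (q : (rat * rat * rat * rat)%type) : set (E3 R) :=
  ball (\row_(j < 3) (if j == 0 :> nat then ratr q.1.1.1 else if j == 1%N :> nat then ratr q.1.1.2 else ratr q.1.2) : E3 R) (ratr q.2).
pose F q := if `[< 0 < q.2 /\ box q `<=` U >] then point @^-1` (box q) else set0.
have -> : point @^-1` U = \bigcup_q F q.
  apply/seteqP; split => [z|z [q _]]; rewrite /F; last first.
    by case: asboolP => // -[_ bU]; exact: bU.
  move=> /= Uz.
  have /nbhs_ballP[e /= e0 eU] : nbhs (point z) U by apply: open_nbhs_nbhs; split.
  have /rat_in_itvoo[r] : 0 < e / 2 by rewrite divr_gt0.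
  rewrite in_itv/= => /andP[r0 re].
  have [q0 h0] := rat_near (point z 0 (inord 0)) r0.
  have [q1 h1] := rat_near (point z 0 (inord 1)) r0.
  have [q2 h2] := rat_near (point z 0 (inord 2)) r0.
  have Bz : box (q0, q1, q2, r) (point z).
    apply/ball_rV => //= j; rewrite distrC !mxE.
    move: h0 h1 h2; rewrite !mxE !inordK//=.
    by case: j => -[|[|[|//]]] hj /=.
  exists (q0, q1, q2, r) => //.
  case: asboolP => // -[]; split.
    by rewrite /= -(@ltr0q R).
  move=> y /= By; apply: eU.
  have e2 : e = e / 2 + e / 2 by rewrite -splitr.
  rewrite e2; apply: (ball_triangle (y := \row_(j < 3) (if j == 0 :> nat then ratr q0 else if j == 1%N :> nat then ratr q1 else ratr q2) : E3 R)).
    by apply/ball_sym; apply: le_ball Bz; exact: ltW.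
  by apply: le_ball By; exact: ltW.
apply: countable_bigcupT_measurable; first exact: countableP.
move=> q; rewrite /F; case: asboolP => // -[q0 _].
by apply: measurable_point_ball; rewrite ltr0q.
Qed.

Lemma bounded_ball B : bounded_set B -> exists2 M : R, 0 < M & B `<=` ball 0 M.
Proof.
move=> /ex_strict_bound_gt0[M M0 BM]; exists M => // x /BM.
rewrite /= => xM; apply/ball_rV => // j; rewrite mxE sub0r normrN.
apply: le_lt_trans xM; rewrite [leRHS]/Num.Def.normr/= mx_normrE.
by apply/bigmax_geP; right => /=; exists (0, j).
Qed.

Lemma volume_bounded B : open B -> bounded_set B -> (volume (point @^-1` B) < +oo)%E.
Proof.
move=> oB /bounded_ball[M M0 BM].
apply: le_lt_trans (_ : (volume (point @^-1` (ball 0%R M)) < _)%E).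
  apply: le_measure; rewrite ?inE//.
  - exact: open_measurable_point.
  - exact: measurable_point_ball.
  - by move=> z /=; exact: BM.
by rewrite volume_ball// ltry.
Qed.

End Volume.

Lemma continuous_near_eq (T U : topologicalType) (f g : T -> U) (x : T) :
  (\forall y \near x, f y = g y) -> {for x, continuous f} -> {for x, continuous g}.
Proof.
move=> E; rewrite /prop_for /continuous_at -(nbhs_singleton E) => h.
apply: cvg_trans h; apply: near_eq_cvg.
by apply: filterS E => y ->.
Qed.

Lemma within_continuousP (T U : topologicalType) (A : set T) (f : T -> U) :
  {within A, continuous f} <->
  forall x, A x -> f y @[y --> within A (nbhs x)] --> f x.
Proof.
split=> [cf x Ax|h]; first by have := cf x; rewrite /continuous_at nbhs_subspace_in.
move=> x; case: (pselect (A x)) => Ax.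
  by rewrite /continuous_at /nbhs/= -nbhs_subspace_in//; exact: h.
rewrite /continuous_at /nbhs/= -nbhs_subspace_out// => P /nbhs_singleton fP.
by move=> y ->.
Qed.

Section WithinContinuity.
Variables (T U V : topologicalType).

Lemma continuousP_within (A : set T) (f : T -> U) :
  continuous f -> {within A, continuous f}.
Proof. by move=> cf; apply/within_continuousP => x _; apply: cvg_within_filter; exact: cf. Qed.

Lemma within_comp (A : set T) (D : set U) (g : T -> U) (f : U -> V) :
  {within A, continuous g} -> (forall x, A x -> D (g x)) ->
  {within D, continuous f} -> {within A, continuous (f \o g)}.
Proof.
move=> /within_continuousP cg gAD /within_continuousP cf.
apply/within_continuousP => x Ax; apply: cvg_trans (cf _ (gAD _ Ax)) => P.
rewrite /within/= => fP; have := cg _ Ax _ fP; rewrite /= /within/=.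
by rewrite /nbhs/= => h; apply: filterS h => y h Ay; apply: h => //; exact: gAD.
Qed.

Lemma withinT_cvg (f : T -> U) : {within setT, continuous f} -> continuous f.
Proof.
move=> /within_continuousP h x P fP; have := h x I P fP.
by rewrite /= /within/= /nbhs/=; apply: filterS => y; apply.
Qed.

End WithinContinuity.

(** * Integrals of bounded continuous functions over a bounded open set *)

Section BodyIntegral.
Variables (R : realType) (B : set (E3 R)).
Hypotheses (oB : open B) (bB : bounded_set B).
Implicit Types (f g : E3 R -> R).

(** Continuity is asked at the points of B only, without any limit at the boundary: products with
    cutoffs, which are known inside B only, are of this kind. As B has finite volume, such functions
    are integrable. *)
Definition bounded_continuous f : Prop :=
  (forall x, B x -> {for x, continuous f}) /\
  exists C : R, forall x, B x -> `|f x| <= C.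

Definition vint f : R := \int[volume R]_(z in @point R @^-1` B) f (point z).

Lemma bc_cst c : bounded_continuous (fun=> c).
Proof. by split; [move=> x _; exact: cst_continuous|exists `|c|]. Qed.

Lemma bc_add f g : bounded_continuous f -> bounded_continuous g ->
  bounded_continuous (fun x => f x + g x).
Proof.
move=> [cf [C fC]] [cg [D gD]]; split.
  by move=> x Bx; apply: continuousD; [exact: cf|exact: cg].
exists (C + D) => x Bx; apply: le_trans (ler_normD _ _) _.
by apply: lerD; [exact: fC|exact: gD].
Qed.

Lemma bc_mul f g : bounded_continuous f -> bounded_continuous g ->
  bounded_continuous (fun x => f x * g x).
Proof.
move=> [cf [C fC]] [cg [D gD]]; split.
  by move=> x Bx; apply: continuousM; [exact: cf|exact: cg].
exists (C * D) => x Bx; rewrite normrM.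
by apply: ler_pM => //; [exact: fC|exact: gD].
Qed.

Lemma bc_ext f g : (forall x, B x -> f x = g x) ->
  bounded_continuous f -> bounded_continuous g.
Proof.
move=> fg [cf [C fC]]; split; last by exists C => x Bx; rewrite -fg// fC.
move=> x Bx; apply: continuous_near_eq (cf _ Bx).
by apply: (@filterS _ _ _ B) (open_nbhs_nbhs _) => // y /fg.
Qed.

Lemma bc_opp f : bounded_continuous f -> bounded_continuous (fun x => - f x).
Proof.
move=> /(bc_mul (bc_cst (-1))); apply: bc_ext => x _; by rewrite mulN1r.
Qed.

Lemma bc_sub f g : bounded_continuous f -> bounded_continuous g ->
  bounded_continuous (fun x => f x - g x).
Proof. by move=> bf /bc_opp; exact: bc_add. Qed.

Lemma bc_sum (I : finType) (F : I -> E3 R -> R) :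
  (forall i, bounded_continuous (F i)) ->
  bounded_continuous (fun x => \sum_i F i x).
Proof.
move=> bF; elim: (index_enum I) => [|i s IH].
  by apply: bc_ext (bc_cst 0) => x _; rewrite big_nil.
by apply: bc_ext (bc_add (bF i) IH) => x _; rewrite big_cons.
Qed.

Lemma bc_norm f : bounded_continuous f -> bounded_continuous (fun x => `|f x|).
Proof.
move=> [cf [C fC]]; split; last by exists C => x Bx; rewrite normr_id fC.
by move=> x Bx; apply: (@continuous_comp _ _ _ f (@Num.norm _ _)); [exact: cf|exact: norm_continuous].
Qed.

Lemma measurable_point_body : measurable (@point R @^-1` B).
Proof. exact: open_measurable_point. Qed.

Lemma bc_measurable f : bounded_continuous f ->
  measurable_fun (@point R @^-1` B) (f \o @point R).
Proof.
move=> [cf _]; apply: (measurability _ (RGenOpens.measurableE R)).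
move=> _ [_ [a [b ->] <-]].
have -> : @point R @^-1` B `&` (f \o @point R) @^-1` `]a, b[%classic =
  @point R @^-1` (B `&` f @^-1` `]a, b[%classic) by [].
apply: open_measurable_point; rewrite openE => x [Bx fx]; apply: filterI.
  exact: open_nbhs_nbhs.
by apply: (cf _ Bx); apply: open_nbhs_nbhs; split => //; exact: interval_open.
Qed.

Lemma bc_integrable f : bounded_continuous f ->
  (volume R).-integrable (@point R @^-1` B) (EFin \o (f \o @point R)).
Proof.
move=> bf; apply: measurable_bounded_integrable.
- exact: measurable_point_body.
- exact: volume_bounded.
- exact: bc_measurable.
case: bf => _ [C fC]; exists C; split; first exact: num_real.
by move=> M CM z Bz /=; apply: le_trans (ltW CM); exact: fC.
Qed.

Lemma vint_ext f g : (forall x, B x -> f x = g x) -> vint f = vint g.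
Proof. by move=> fg; apply: eq_Rintegral => z; rewrite inE; exact: fg. Qed.

Lemma vintD f g : bounded_continuous f -> bounded_continuous g ->
  vint (fun x => f x + g x) = vint f + vint g.
Proof.
by move=> bf bg; apply: RintegralD;
  [exact: measurable_point_body|exact: bc_integrable..].
Qed.

Lemma vintZ c f : bounded_continuous f -> vint (fun x => c * f x) = c * vint f.
Proof.
by move=> bf; apply: RintegralZl;
  [exact: measurable_point_body|exact: bc_integrable].
Qed.

Lemma vint_opp f : bounded_continuous f -> vint (fun x => - f x) = - vint f.
Proof. by move=> bf; rewrite -mulN1r -vintZ//; apply: vint_ext => x _; rewrite mulN1r. Qed.

Lemma vint_sub f g : bounded_continuous f -> bounded_continuous g ->
  vint (fun x => f x - g x) = vint f - vint g.
Proof. by move=> bf bg; rewrite vintD ?vint_opp//; exact: bc_opp. Qed.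

Lemma vint0 : vint (fun=> 0) = 0.
Proof. by rewrite -{1}(mul0r 0) vintZ ?mul0r//; exact: bc_cst. Qed.

Lemma vint_sum (I : finType) (F : I -> E3 R -> R) :
  (forall i, bounded_continuous (F i)) ->
  vint (fun x => \sum_i F i x) = \sum_i vint (F i).
Proof.
move=> bF.
suff H s : bounded_continuous (fun x => \sum_(i <- s) F i x) /\
    vint (fun x => \sum_(i <- s) F i x) = \sum_(i <- s) vint (F i).
  by case: (H (index_enum I)).
elim: s => [|i s [IH1 IH2]].
  split; first by apply: bc_ext (bc_cst 0) => x _; rewrite big_nil.
  by rewrite big_nil -{2}vint0; apply: vint_ext => x _; rewrite big_nil.
split; first by apply: bc_ext (bc_add (bF i) IH1) => x _; rewrite big_cons.
by rewrite big_cons -IH2 -vintD//; apply: vint_ext => x _; rewrite big_cons.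
Qed.

Lemma vint_ge0 f : (forall x, B x -> 0 <= f x) -> 0 <= vint f.
Proof. by move=> f0; apply: Rintegral_ge0 => z; exact: f0. Qed.

Lemma vint_le f g : bounded_continuous f -> bounded_continuous g ->
  (forall x, B x -> f x <= g x) -> vint f <= vint g.
Proof.
move=> bf bg fg; rewrite -subr_ge0 -vint_sub//; apply: vint_ge0 => x Bx.
by rewrite subr_ge0 fg.
Qed.

Lemma vint_norm f : bounded_continuous f -> `|vint f| <= vint (fun x => `|f x|).
Proof.
by move=> bf; apply: le_normr_Rintegral;
  [exact: measurable_point_body|exact: bc_integrable].
Qed.

(** A positive value persists, up to the factor 1 / 2, on a small cube, and the cube has positive
    volume. *)
Lemma vint_eq0 f : bounded_continuous f -> (forall x, B x -> 0 <= f x) ->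
  vint f = 0 -> forall x, B x -> f x = 0.
Proof.
move=> bf f0 If x Bx; apply/eqP; apply: contraT => fx0.
have fx : 0 < f x by rewrite lt_neqAle eq_sym fx0 f0.
have : \forall y \near x, B y /\ f x / 2 < f y.
  near=> y; split; first by near: y; exact: open_nbhs_nbhs.
  near: y; have := bf.1 _ Bx; rewrite /prop_for /continuous_at => /cvgr_gt; apply.
  by rewrite ltr_pdivrMr// ltr_pMr// ltr1n.
move=> /nbhs_ballP[e /= e0 eB].
have mB := measurable_point_body.
have mE : measurable (@point R @^-1` (ball x e)) by exact: measurable_point_ball.
have subE : @point R @^-1` (ball x e) `<=` @point R @^-1` B by move=> z /= /eB[].
have := vint_ge0 f0; rewrite If => _.
have ib := bc_integrable bf.
have fin : (\int[volume R]_(z in @point R @^-1` B) (f (point z))%:E)%E = 0%E.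
  by rewrite -(fineK (integrable_fin_num mB ib)) -/(vint f) -[fine _]/(vint f) If.
have : ((f x / 2 * (e *+ 2) ^+ 3)%:E <= 0)%E.
  rewrite -[leRHS]fin.
  apply: (@le_trans _ _ (\int[volume R]_(z in @point R @^-1` (ball x e)) (f (point z))%:E)%E).
    rewrite EFinM -(volume_ball x)// -integral_cst//.
    apply: ge0_le_integral => //.
    - by move=> z _; rewrite lee_fin divr_ge0// ltW.
    - apply/measurable_EFinP; apply: measurable_funS (bc_measurable bf) => //.
    - by move=> z /= /eB[_ /ltW].
  apply: ge0_subset_integral => //.
  - by apply/measurable_EFinP; exact: bc_measurable.
  - by move=> z Bz; rewrite lee_fin; exact: f0.
rewrite lee_fin leNgt => /negP[].
by rewrite mulr_gt0// ?divr_gt0// exprn_gt0// mulrn_wgt0.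
Unshelve. all: by end_near. Qed.

Lemma vint_cvg (F : nat -> E3 R -> R) f C :
  (forall n, bounded_continuous (F n)) -> bounded_continuous f ->
  (forall n x, B x -> `|F n x| <= C) ->
  (forall x, B x -> F n x @[n --> \oo] --> f x) ->
  vint (F n) @[n --> \oo] --> vint f.
Proof.
move=> bF bf FC Ff.
have mB := measurable_point_body.
have := @dominated_convergence _ _ _ (volume R) (@point R @^-1` B) mB
  (fun n z => (F n (point z))%:E) (fun z => (f (point z))%:E) (fun=> C%:E).
move=> /(_ _ _ _ _ _)[].
- by move=> n; apply/measurable_EFinP; exact: bc_measurable.
- by apply/measurable_EFinP; exact: bc_measurable.
- apply: aeW => z Bz; apply: cvg_EFin; first exact: nearW.
  exact: Ff.
- exact: (bc_integrable (bc_cst C)).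
- by apply: aeW => z Bz n; rewrite lee_fin FC.
move=> _ _.
rewrite -(fineK (integrable_fin_num mB (bc_integrable bf))).
exact: fine_cvg.
Qed.

End BodyIntegral.

(** * Integrals depending on a parameter *)

Section TimeFamilies.
Variables (R : realType) (B : set (E3 R)).
Hypotheses (oB : open B) (bB : bounded_set B).
Implicit Types (F G : R -> E3 R -> R).

Lemma vint_derive F dF (a b C z : R) : a < z < b ->
  (forall s, a < s < b -> bounded_continuous B (F s)) ->
  (forall s x, a < s < b -> B x -> is_derive s 1 (F^~ x) (dF s x)) ->
  (forall s x, a < s < b -> B x -> `|dF s x| <= C) ->
  is_derive z 1 (fun s => vint B (F s)) (vint B (dF z)).
Proof.
move=> azb bF dFF dFC.
have mB := measurable_point_body oB.
have Iz : `]a, b[%classic z by rewrite /= in_itv/=.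
have intF s : `]a, b[%classic s -> (volume R).-integrable (@point R @^-1` B)
    (EFin \o (fun w => F s (point w))).
  by rewrite /= in_itv/= => h; apply: bc_integrable => //; exact: bF.
have derF s w : `]a, b[%classic s -> (@point R @^-1` B) w ->
    derivable ((fun s w => F s (point w))^~ w) s 1.
  by rewrite /= in_itv/= => h Bw; have [] := dFF _ _ h Bw.
have E s w : `]a, b[%classic s -> (@point R @^-1` B) w ->
    partial1of2 (fun s w => F s (point w)) s w = dF s (point w).
  by rewrite /= in_itv/= partial1of2E => h Bw; have [] := dFF _ _ h Bw.
have C0 (y : ((measurableTypeR R * measurableTypeR R) * measurableTypeR R)%type) : 0 <= `|C| by [].
have Cub s w : `]a, b[%classic s -> (@point R @^-1` B) w ->
    `|partial1of2 (fun s w => F s (point w)) s w| <= `|C|.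
  move=> h Bw; rewrite E//; apply: le_trans (ler_norm _).
  by move: h; rewrite /= in_itv/= => h; exact: dFC.
have iC : (volume R).-integrable (@point R @^-1` B) (EFin \o (fun=> `|C|)).
  exact: (bc_integrable oB bB (bc_cst B `|C|)).
split.
  exact: (derivable_under_integral mB Iz intF derF C0 iC Cub).
rewrite -derive1E (differentiation_under_integral mB Iz intF derF C0 iC Cub).
by apply: eq_Rintegral => w; rewrite inE => Bw; rewrite E.
Qed.

(** Projection onto [a, b]. It extends a family given on the closed interval to a larger open one,
    as continuity under the integral sign requires. *)
Definition clamp (a b z : R) : R := Num.max a (Num.min b z).

Lemma clamp_itv a b z : a <= b -> a <= clamp a b z <= b.
Proof.
by move=> ab; rewrite /clamp le_max lexx/= ge_max ab/= ge_min lexx.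
Qed.

Lemma clamp_id a b z : a <= z <= b -> clamp a b z = z.
Proof. by move=> /andP[az zb]; rewrite /clamp min_r// max_r. Qed.

Lemma continuous_clamp a b : continuous (clamp a b).
Proof.
move=> z; apply: (@continuous_max _ _ (cst a) (Num.min b)); first exact: cst_continuous.
by apply: (@continuous_min _ _ (cst b) id); [exact: cst_continuous|].
Qed.

Lemma vint_within_continuous F (a b C : R) : a <= b ->
  (forall s, a <= s <= b -> bounded_continuous B (F s)) ->
  (forall x, B x -> {within `[a, b], continuous (F^~ x)}) ->
  (forall s x, a <= s <= b -> B x -> `|F s x| <= C) ->
  {within `[a, b], continuous (fun s => vint B (F s))}.
Proof.
move=> ab bF cF FC.
have mB := measurable_point_body oB.
pose f s (w : ((measurableTypeR R * measurableTypeR R) * measurableTypeR R)%type) := F (clamp a b s) (point w).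
have cl s : a <= clamp a b s <= b by exact: clamp_itv.
have intf s : `]a - 1, b + 1[%classic s -> (volume R).-integrable (@point R @^-1` B)
    (EFin \o f s).
  by move=> _; apply: bc_integrable => //; exact: bF.
have cf : {ae (volume R), forall w, (@point R @^-1` B) w ->
    {in `]a - 1, b + 1[%classic, continuous (f ^~ w)}}.
  apply: aeW => w Bw s _.
  have cc : {within setT, continuous (clamp a b)}.
    by apply: continuousP_within; exact: continuous_clamp.
  apply: (withinT_cvg (within_comp cc _ (cF _ Bw))) => r _.
  by rewrite /= in_itv/=; exact: cl.
have iC : (volume R).-integrable (@point R @^-1` B) (EFin \o (fun=> C)).
  exact: (bc_integrable oB bB (bc_cst B C)).
have fC s : `]a - 1, b + 1[%classic s -> {ae (volume R), forall w, (@point R @^-1` B) w -> `|f s w| <= C}.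
  by move=> _; apply: aeW => w Bw; exact: FC.
have := continuity_under_integral mB intf cf iC fC.
move=> h; apply/within_continuousP => z; rewrite /= in_itv/= => zab.
have : {for z, continuous (fun l => \int[volume R]_(x in (@point R @^-1` B)) f l x)}.
  by apply: h; rewrite inE/= in_itv/=; move/andP: zab => [? ?]; apply/andP; split; lra.
rewrite /prop_for /continuous_at /f clamp_id// => h2.
apply: cvg_trans (cvg_within_filter _ h2).
apply: near_eq_cvg; apply: filterS (withinT _ _) => s; rewrite /= in_itv/= => sab.
by rewrite clamp_id.
Qed.

(** Serves instead of integrating spatial integrals over time: one intermediate value of the
    derivative is enough to see that a spatial integral is constant or does not increase. *)
Lemma vint_MVT F dF (a b C : R) : a < b ->
  (forall s, a <= s <= b -> bounded_continuous B (F s)) ->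
  (forall s x, a < s < b -> B x -> is_derive s 1 (F^~ x) (dF s x)) ->
  (forall x, B x -> {within `[a, b], continuous (F^~ x)}) ->
  (forall s x, a <= s <= b -> B x -> `|F s x| <= C) ->
  (forall s x, a <= s <= b -> B x -> `|dF s x| <= C) ->
  exists2 c, a < c < b & vint B (F b) - vint B (F a) = vint B (dF c) * (b - a).
Proof.
move=> ab bF dFF cF FC dFC.
have oc s : a < s < b -> a <= s <= b by move=> /andP[h1 h2]; rewrite !ltW.
have D z : z \in `]a, b[ -> is_derive z 1 (fun s => vint B (F s)) (vint B (dF z)).
  rewrite in_itv/= => h; apply: (@vint_derive F dF a b C) => //.
  - by move=> s /oc; exact: bF.
  - by move=> s x /oc; exact: dFC.
have [c + ->] := MVT ab D (vint_within_continuous (ltW ab) bF cF FC).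
by rewrite in_itv/= => h; exists c.
Qed.

End TimeFamilies.

(** * Iterated integrals and derivatives along the coordinate axes *)

Section IteratedIntegral.
Local Open Scope ereal_scope.
Context d1 d2 (T1 : measurableType d1) (T2 : measurableType d2) (R : realType).
Variables (m1 : {sigma_finite_measure set T1 -> \bar R})
  (m2 : {sigma_finite_measure set T2 -> \bar R}) (f : T1 * T2 -> \bar R).
Hypothesis intf : (m1 \x m2).-integrable setT f.

Lemma prod_integral0r : (forall x, \int[m2]_y f (x, y) = 0) ->
  \int[m1 \x m2]_z f z = 0.
Proof.
move=> h; rewrite -(integral12_prod_meas1 intf).
by rewrite (eq_integral (cst 0)) ?integral0// => x _; exact: h.
Qed.

Lemma prod_integral0l : (forall y, \int[m1]_x f (x, y) = 0) ->
  \int[m1 \x m2]_z f z = 0.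
Proof.
move=> h; rewrite -(integral21_prod_meas1 intf).
by rewrite (eq_integral (cst 0)) ?integral0// => x _; exact: h.
Qed.

End IteratedIntegral.

Section Lines.
Variable R : realType.
Notation leb := (@lebesgue_measure R).
Implicit Types (f : E3 R -> R).

Lemma is_derive_line f (x v : E3 R) (s d : R) :
  is_derive (x + s *: v) v f d <->
  is_derive s (1 : R) (fun s => f (x + s *: v)) d.
Proof.
have E : (fun h : R => h^-1 *: ((f \o shift (x + s *: v)) (h *: v) - f (x + s *: v))) =
    (fun h : R => h^-1 *: (((fun s => f (x + s *: v)) \o shift s) (h *: (1 : R)) - f (x + s *: v))).
  by apply/funext => h /=; rewrite addrCA -scalerDl [h *: 1]mulr1.
split => -[]; rewrite /derivable /derive => h1 h2.
  by split; rewrite /derivable /derive -E.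
by split; rewrite /derivable /derive E.
Qed.

Lemma is_derive_at_line f (x v : E3 R) (d : R) :
  is_derive x v f d <-> is_derive (0:R) (1 : R) (fun s => f (x + s *: v)) d.
Proof. by rewrite -is_derive_line scale0r addr0. Qed.

Lemma is_derive_comp1 (h : R -> R) f (x v : E3 R) (dh df : R) :
  is_derive (f x) (1 : R) h dh -> is_derive x v f df ->
  is_derive x v (h \o f) (dh * df).
Proof.
move=> hh /is_derive_at_line hf; apply/is_derive_at_line.
have hh' : is_derive (f (x + 0 *: v)) (1:R) h dh by rewrite scale0r addr0.
exact: (@is_derive1_comp _ h (fun s => f (x + s *: v)) _ _ _ hh' hf).
Qed.

Lemma is_derive_near_eq f g (x v : E3 R) (d : R) :
  (\forall y \near x, f y = g y) -> is_derive x v f d -> is_derive x v g d.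
Proof. by move=> fg; apply: near_eq_is_derive. Qed.

Lemma I3_cases (P : 'I_3 -> Prop) : P (inord 0) -> P (inord 1) -> P (inord 2) -> forall j, P j.
Proof.
by move=> h0 h1 h2 [[|[|[|//]]] hk]; [move: h0|move: h1|move: h2];
  congr P; apply/val_inj; rewrite /= inordK.
Qed.

Lemma point_addl (a b c s : R) : point (a + s, b, c) = point (a, b, c) + s *: axis R (inord 0).
Proof.
by apply/rowP; apply: I3_cases; rewrite !mxE -!val_eqE/= !inordK//= ?mulr1 ?mulr0 ?addr0.
Qed.

Lemma point_addm (a b c s : R) : point (a, b + s, c) = point (a, b, c) + s *: axis R (inord 1).
Proof.
by apply/rowP; apply: I3_cases; rewrite !mxE -!val_eqE/= !inordK//= ?mulr1 ?mulr0 ?addr0.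
Qed.

Lemma point_addr (a b c s : R) : point (a, b, c + s) = point (a, b, c) + s *: axis R (inord 2).
Proof.
by apply/rowP; apply: I3_cases; rewrite !mxE -!val_eqE/= !inordK//= ?mulr1 ?mulr0 ?addr0.
Qed.

Lemma continuous_line (x v : E3 R) : continuous (fun s : R => x + s *: v).
Proof.
move=> s; apply: cvgD; first exact: cvg_cst.
exact: scalel_continuous.
Qed.

Lemma integral_line0 (F d : E3 R -> R) (M : R) (j : 'I_3) (p : E3 R) : 0 < M ->
  (forall x, is_derive x (axis R j) F (d x)) -> continuous d ->
  (forall x : E3 R, M <= `|x 0 j| -> F x = 0 /\ d x = 0) ->
  (\int[@lebesgue_measure R]_s (d (p + s *: axis R j))%:E = 0)%E.
Proof.
move=> M0 Fd cd F0.
(* From this parameter on, the j-th coordinate of the point on the line is at least M in modulus, so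
   F vanishes at both ends. *)
pose N := M + `|p 0 j|.
have N0 : 0 < N by rewrite ltr_pwDl.
have far s : N <= `|s| -> M <= `|(p + s *: axis R j) 0 j|.
  move=> Ns; rewrite !mxE !eqxx /= mulr1.
  have := ler_normD (p 0 j + s) (- p 0 j); rewrite addrAC subrr add0r normrN.
  by move: Ns; rewrite /N; lra.
transitivity (\int[@lebesgue_measure R]_(s in `[(- N)%R, N%R]) (d (p + s *: axis R j))%:E)%E.
  rewrite [RHS]integral_mkcond; apply: eq_integral => s _; rewrite patchE.
  case: ifPn => //; rewrite notin_setE/= in_itv/= => /negP.
  rewrite -ler_norml -ltNge => /ltW /far /F0[_ ->//].
have NN : - N < N by lra.
have cl : continuous (fun s : R => d (p + s *: axis R j)).
  by move=> s; apply: continuous_comp; [exact: continuous_line|exact: cd].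
have dl (s : R) : is_derive s (1:R) (fun s => F (p + s *: axis R j)) (d (p + s *: axis R j)).
  exact/is_derive_line.
have cF : continuous (fun s : R => F (p + s *: axis R j)).
  move=> s; apply: differentiable_continuous.
  by apply/derivable1_diffP; have [] := dl s.
rewrite (continuous_FTC2 (F := fun s => F (p + s *: axis R j)) NN).
- rewrite (F0 _ (far _ _)).1 ?(F0 _ (far _ _)).1 ?subee//.
    by rewrite normrN gtr0_norm.
  by rewrite gtr0_norm.
- exact: continuousP_within.
- split.
  + by move=> s _; have [] := dl s.
  + by apply: cvg_at_right_filter; exact: cF.
  + by apply: cvg_at_left_filter; exact: cF.
- by move=> s _; rewrite derive1E; have [_ ->] := dl s.
Qed.

(** Fubini's theorem with the coordinate j integrated innermost. Vanishing outside a cube gives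
    integrability on the whole space and, where it is needed, on the planes with third coordinate
    fixed. *)
Lemma integral_volume_axis0 (F d : E3 R -> R) (M C : R) (j : 'I_3) : 0 < M ->
  (forall x, is_derive x (axis R j) F (d x)) -> continuous d ->
  (forall x, `|d x| <= C) ->
  (forall x, ~ ball 0 M x -> F x = 0 /\ d x = 0) ->
  (\int[volume R]_z (d (point z))%:E = 0)%E.
Proof.
move=> M0 Fd cd dC F0.
have far k (x : E3 R) : M <= `|x 0 k| -> F x = 0 /\ d x = 0.
  move=> Mx; apply: F0 => /(ball_rV _ _ M0)/(_ k).
  by rewrite mxE sub0r normrN ltNge Mx.
have md : measurable_fun setT (d \o @point R).
  have : measurable_fun (@point R @^-1` setT) (d \o @point R).
    by apply: bc_measurable => //; [exact: openT|split; [move=> x _; exact: cd|exists C]].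
  by rewrite preimage_setT.
have id : (volume R).-integrable setT (EFin \o (d \o @point R)).
  have mB : measurable (@point R @^-1` (ball 0 M)) by exact: measurable_point_ball.
  have -> : EFin \o (d \o @point R) = (EFin \o (d \o @point R)) \_ (@point R @^-1` (ball 0 M)).
    apply/funext => z; rewrite patchE; case: ifPn => //.
    by rewrite notin_setE => /F0[_ /= ->].
  apply/(integrable_mkcond _ mB); apply: measurable_bounded_integrable => //.
  - by rewrite /= volume_ball// ltry.
  - exact: measurable_funS md.
  - by exists C; split; [exact: num_real|move=> N CN z _; apply: le_trans (ltW CN); exact: dC].
have id2 c : ((@lebesgue_measure R) \x (@lebesgue_measure R))%E.-integrable setT
    (fun ab => (d (point (ab, c)))%:E).
  pose D : set (measurableTypeR R * measurableTypeR R) := ball 0 M `*` ball 0 M.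
  have mD : measurable D by apply: measurableX; exact: measurable_ball.
  have -> : (fun ab => (d (point (ab, c)))%:E) = (fun ab => (d (point (ab, c)))%:E) \_ D.
    apply/funext => -[a b]; rewrite patchE; case: ifPn => //.
    rewrite notin_setE => nD; rewrite (F0 _ _).2// => /(ball_rV _ _ M0) h; apply: nD.
    by have := h (inord 0); have := h (inord 1); rewrite !mxE !inordK//=; split.
  apply/(integrable_mkcond _ mD); apply: measurable_bounded_integrable => //.
  - rewrite /= product_measure1E; try exact: measurable_ball.
    have Lb : @lebesgue_measure R (ball 0 M) = (M *+ 2)%:E by apply: lebesgue_measure_ball; exact: ltW.
    by rewrite [X in (X * _)%E]Lb [X in (_ * X)%E]Lb -EFinM ltry.
  - apply: measurable_funS (measurable_fun_pair1 c md) => //.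
  - by exists C; split; [exact: num_real|move=> N CN z _; apply: le_trans (ltW CN); exact: dC].
have L p : (\int[@lebesgue_measure R]_s (d (p + s *: axis R j))%:E = 0)%E.
  by apply: integral_line0 M0 Fd cd _ => x; exact: far.
move: (j) L; apply: I3_cases => L.
- apply: (prod_integral0l (m1 := @area R) (m2 := leb) id) => c.
  apply: (prod_integral0l (m1 := leb) (m2 := leb) (id2 c)) => b /=.
  rewrite -[RHS](L (point (0, b, c))).
  by apply: eq_integral => a _; rewrite -point_addl add0r.
- apply: (prod_integral0l (m1 := @area R) (m2 := leb) id) => c.
  apply: (prod_integral0r (m1 := leb) (m2 := leb) (id2 c)) => a /=.
  rewrite -[RHS](L (point (a, 0, c))).
  by apply: eq_integral => b _; rewrite -point_addm add0r.
- apply: (prod_integral0r (m1 := @area R) (m2 := leb) id) => -[a b] /=.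
  rewrite -[RHS](L (point (a, b, 0))).
  by apply: eq_integral => c _; rewrite -point_addr add0r.
Qed.

(** The open sets B and the complement of K cover the space, and f is zero on their overlap. Hence
    the extension of f by zero is differentiable along the axis everywhere, with a continuous
    derivative that vanishes far away. *)
Lemma vint_derive_compact (B K : set (E3 R)) (j : 'I_3) f :
  open B -> bounded_set B -> closed K -> K `<=` B ->
  (forall x, B x -> derivable f x (axis R j)) ->
  bounded_continuous B (fun x => 'D_(axis R j) f x) ->
  (forall x, B x -> ~ K x -> f x = 0) ->
  vint B (fun x => 'D_(axis R j) f x) = 0.
Proof.
move=> oB bB cK KB df [cd [C dC]] f0.
have [M M0 BM] := bounded_ball bB.
pose F := f \_ B; pose d := (fun x => 'D_(axis R j) f x) \_ B.
have oK : open (~` K) by exact: closed_openC.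
have D0 x : B x -> ~ K x -> 'D_(axis R j) f x = 0.
  move=> Bx Kx.
  suff [_ ->] : is_derive x (axis R j) f 0 by [].
  apply: (@is_derive_near_eq (cst 0)).
  apply: (@filterS _ _ _ (B `&` ~` K)) => [y [By Ky]|]; first by rewrite f0.
  by apply: open_nbhs_nbhs; split => //; exact: openI.
have Fd x : is_derive x (axis R j) F (d x).
  have [Bx|Bx] := pselect (B x).
    rewrite /d patchE mem_set//; apply: (@is_derive_near_eq f); last exact/derivableP/df.
    by apply: filterS (open_nbhs_nbhs (conj oB Bx)) => y By; rewrite /F patchE mem_set.
  rewrite /d patchE memNset//; apply: (@is_derive_near_eq (cst 0)).
  have Kx : ~ K x by move=> /KB.
  apply: filterS (open_nbhs_nbhs (conj oK Kx)) => y Ky; rewrite /F patchE.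
  by case: ifPn => //; rewrite inE => By; rewrite f0.
have cdT : continuous d.
  move=> x; have [Bx|Bx] := pselect (B x).
    apply: continuous_near_eq (cd _ Bx).
    by apply: filterS (open_nbhs_nbhs (conj oB Bx)) => y By; rewrite /d patchE mem_set.
  have Kx : ~ K x by move=> /KB.
  apply: (@continuous_near_eq _ _ (cst 0)); last exact: cst_continuous.
  apply: filterS (open_nbhs_nbhs (conj oK Kx)) => y Ky; rewrite /d patchE.
  by case: ifPn => //; rewrite inE => By; rewrite D0.
have dCT x : `|d x| <= `|C|.
  rewrite /d patchE; case: ifPn => [|_]; last by rewrite normr0.
  by rewrite inE => /dC h; apply: le_trans h (ler_norm _).
have F0 x : ~ ball 0 M x -> F x = 0 /\ d x = 0.
  by move=> nx; rewrite /F /d !patchE !memNset//; move=> /BM.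
suff -> : vint B ('D_(axis R j) f) = fine (\int[volume R]_z (d (point z))%:E)%E.
  by rewrite (integral_volume_axis0 M0 Fd cdT dCT F0).
rewrite /vint /Rintegral integral_mkcond; congr fine.
apply: eq_integral => z _; rewrite /d !patchE.
by case: ifPn => h; case: ifPn => //; rewrite ?inE ?notin_setE /=; move: h; rewrite ?inE ?notin_setE /=.
Qed.

End Lines.

(** * Mean value inequalities and splines *)

Section OneVariable.
Variable R : realType.
Implicit Types (g dg : R -> R).

Lemma is_derive0P g (L : R) :
  (forall e, 0 < e -> exists2 d, 0 < d & forall k, `|k| < d -> `|g k - g 0 - k * L| <= e * `|k|) ->
  is_derive (0 : R) (1 : R) g L.
Proof.
move=> H.
suff C : (fun h : R => h^-1 *: ((g \o shift 0) (h *: (1:R)) - g 0)) @ 0^' --> L.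
  by split; [apply/cvg_ex; exists L|apply: cvg_lim].
apply/cvgrPdist_le => e e0; have [d d0 Hd] := H _ e0.
rewrite near_withinE; apply/nbhs_ballP; exists d => // h.
rewrite /ball/= sub0r normrN => hd h0.
have := Hd _ hd; rewrite addr0 [h *: 1]mulr1 => {}Hd.
have hn : 0 < `|h| by rewrite normr_gt0.
rewrite -(ler_pM2r hn) -normrM; apply: le_trans Hd.
rewrite le_eqVlt; apply/orP; left; apply/eqP; rewrite -normrN; congr (`|_|).
by rewrite /GRing.scale/=; field.
Qed.

Lemma is_derive0W g (L : R) : is_derive (0 : R) (1 : R) g L ->
  forall e, 0 < e -> exists2 d, 0 < d & forall k, `|k| < d -> `|g k - g 0 - k * L| <= e * `|k|.
Proof.
move=> [/cvg_ex[l gl] gL] e e0.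
have El : l = L by rewrite -gL; apply/esym/cvg_lim.
subst l; move/cvgrPdist_le : gl => /(_ _ e0).
rewrite near_withinE => /nbhs_ballP[d /= d0 Hd]; exists d => // k kd.
have [->|k0] := eqVneq k 0; first by rewrite mul0r !subrr normr0 mulr0.
have := Hd k; rewrite /ball/= sub0r normrN => /(_ kd k0).
rewrite addr0 [k *: 1]mulr1 => {}Hd.
have kn : 0 < `|k| by rewrite normr_gt0.
move: Hd; rewrite -(ler_pM2r kn) -normrM; apply: le_trans.
rewrite le_eqVlt; apply/orP; left; apply/eqP; rewrite -normrN; congr (`|_|).
by rewrite /GRing.scale/=; field.
Qed.

Lemma is_derive_shiftP g (s L : R) :
  is_derive s (1:R) g L <-> is_derive (0:R) (1:R) (fun h => g (s + h)) L.
Proof.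
have E : (fun h : R => h^-1 *: ((g \o shift s) (h *: (1 : R)) - g s)) =
    (fun h : R => h^-1 *: (((fun h => g (s + h)) \o shift 0) (h *: (1 : R)) - g (s + 0))).
  by apply/funext => h /=; rewrite !addr0 [s + _]addrC.
split => -[]; rewrite /derivable /derive => h1 h2.
  by split; rewrite /derivable /derive -E.
by split; rewrite /derivable /derive E.
Qed.

Lemma MVT_signed g dg (h : R) :
  (forall s, `|s| <= `|h| -> is_derive s (1:R) g (dg s)) ->
  exists2 s, `|s| <= `|h| & g h - g 0 = dg s * h.
Proof.
move=> gd.
have dc (a b : R) : (forall s, a <= s <= b -> `|s| <= `|h|) -> {within `[a, b], continuous g}.
  move=> ab; apply: derivable_within_continuous => s; rewrite in_itv/= => /ab/gd[h1 _].
  exact: h1.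
have [h0|h0] := leP 0 h.
  have hs s : 0 <= s <= h -> `|s| <= `|h|.
    by move=> /andP[s0 sh]; rewrite !ger0_norm.
  have [|c] := @MVT_segment _ g dg 0 h h0 _ (dc _ _ hs).
    by move=> s; rewrite in_itv/= => /andP[s0 sh]; apply: gd; apply: hs; rewrite !ltW.
  by rewrite in_itv/= => /hs hc; rewrite subr0 => ->; exists c.
have hs s : h <= s <= 0 -> `|s| <= `|h|.
  by move=> /andP[s0 sh]; rewrite !ler0_norm ?lerN2// ltW.
have [|c] := @MVT_segment _ g dg h 0 (ltW h0) _ (dc _ _ hs).
  by move=> s; rewrite in_itv/= => /andP[s0 sh]; apply: gd; apply: hs; rewrite !ltW.
rewrite in_itv/= => /hs hc E; exists c => //.
by rewrite -opprB E sub0r mulrN opprK.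
Qed.

(** Schwarz's theorem in Peano's form: the existence of the derivative of [phi1] is part of the
    conclusion. The second difference over a rectangle of sides h and k is h k times a value of
    [phi21]; h is chosen after k, so small that difference quotients in h replace [phi1 k] and
    [phi1 0]. The two variables are later two space directions, or one space direction and time. *)
Lemma mixed_derivative (phi phi2 phi21 : R -> R -> R) (phi1 : R -> R) (r : R) : 0 < r ->
  (forall b, `|b| < r -> is_derive (0:R) (1:R) (phi^~ b) (phi1 b)) ->
  (forall a b, `|a| < r -> `|b| < r -> is_derive b (1:R) (phi a) (phi2 a b)) ->
  (forall a b, `|a| < r -> `|b| < r -> is_derive a (1:R) (phi2^~ b) (phi21 a b)) ->
  (forall e, 0 < e -> exists2 d, 0 < d & forall a b, `|a| < d -> `|b| < d ->
     `|phi21 a b - phi21 0 0| <= e) ->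
  is_derive (0:R) (1:R) phi1 (phi21 0 0).
Proof.
move=> r0 H1 H2 H3 H4; apply: is_derive0P => e e0.
have [d d0 Hd] := H4 _ e0.
exists (Num.min d r) => [|k]; first by rewrite lt_min d0.
rewrite lt_min => /andP[kd kr].
(* Tolerance for the two difference quotients in h, half for each. *)
apply/ler_addgt0Pl => eta eta0.
have eta20 : 0 < eta / 2 by rewrite divr_gt0.
have [d1 d10 Hd1] := is_derive0W (H1 _ kr) eta20.
have r00 : `|0 : R| < r by rewrite normr0.
have [d2 d20 Hd2] := is_derive0W (H1 _ r00) eta20.
pose h := Num.min (Num.min d r) (Num.min d1 d2) / 2.
have h0 : 0 < h by rewrite divr_gt0// !lt_min d0 r0 d10.
have hlt : h < Num.min (Num.min d r) (Num.min d1 d2).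
  by rewrite /h ltr_pdivrMr// ltr_pMr ?ltr1n// !lt_min d0 r0 d10.
move: hlt; rewrite !lt_min => /andP[/andP[hd hr] /andP[hd1 hd2]].
clearbody h.
have nh : `|h| = h by rewrite gtr0_norm.
have [k' k'k E1] : exists2 k', `|k'| <= `|k| &
    (phi h k - phi 0 k) - (phi h 0 - phi 0 0) = (phi2 h k' - phi2 0 k') * k.
  apply: (@MVT_signed (fun b => phi h b - phi 0 b) (fun b => phi2 h b - phi2 0 b)) => s sk.
  by apply: is_deriveB; apply: H2; rewrite ?nh ?normr0// (le_lt_trans sk).
have [h' h'h E2] : exists2 h', `|h'| <= `|h| & phi2 h k' - phi2 0 k' = phi21 h' k' * h.
  apply: (@MVT_signed (phi2^~ k') (phi21^~ k')) => s sh.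
  by apply: H3; [rewrite (le_lt_trans sh)// nh|exact: le_lt_trans k'k kr].
have B1 : `|phi21 h' k' - phi21 0 0| <= e.
  by apply: Hd; [rewrite (le_lt_trans h'h)// nh|exact: le_lt_trans k'k kd].
have := Hd1 h; rewrite nh => /(_ hd1) B2.
have := Hd2 h; rewrite nh => /(_ hd2) B3.
have E : h * (phi1 k - phi1 0 - k * phi21 0 0) =
  - (phi h k - phi 0 k - h * phi1 k) + (phi h 0 - phi 0 0 - h * phi1 0)
  + h * k * (phi21 h' k' - phi21 0 0).
  have -> : phi h k = phi21 h' k' * h * k + (phi h 0 - phi 0 0) + phi 0 k by rewrite -E2 -E1; ring.
  ring.
rewrite -(ler_pM2l h0) -{1}nh -normrM E.
apply: le_trans (ler_normD _ _) _.
have := ler_normD (- (phi h k - phi 0 k - h * phi1 k)) (phi h 0 - phi 0 0 - h * phi1 0).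
rewrite normrN => B4.
rewrite !normrM nh.
have B5 : h * `|k| * `|phi21 h' k' - phi21 0 0| <= h * `|k| * e.
  by rewrite ler_wpM2l// mulr_ge0// ltW.
by move: B2 B3 B4 B5; lra.
Qed.

Definition pos (x : R) : R := Num.max 0 x.

Lemma pos_ge0 x : 0 <= pos x. Proof. by rewrite /pos le_max lexx. Qed.

Lemma pos_r x : 0 <= x -> pos x = x. Proof. by move=> h; rewrite /pos max_r. Qed.

Lemma pos_l x : x <= 0 -> pos x = 0. Proof. by move=> h; rewrite /pos max_l. Qed.

Lemma continuous_pos : continuous pos.
Proof. by move=> x; apply: (@continuous_max _ _ (cst 0) id); [exact: cst_continuous|]. Qed.

Lemma is_derive_posX n x :
  is_derive x (1:R) (fun x => pos x ^+ n.+2) (n.+2%:R * pos x ^+ n.+1).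
Proof.
have [x0|x0|->] := ltgtP x 0.
- rewrite pos_l ?ltW// expr0n mulr0.
  apply: (near_eq_is_derive (f := cst 0)).
  near=> y; rewrite pos_l ?expr0n// ltW//; near: y; exact: lt_nbhsl.
- rewrite pos_r ?ltW//.
  apply: (near_eq_is_derive (f := fun y : R => y ^+ n.+2)); last first.
    by split; [exact: exprn_derivable|rewrite -derive1E exp_derive1].
  near=> y; rewrite pos_r// ltW//; near: y; exact: lt_nbhsr.
- rewrite pos_l// expr0n mulr0; apply: is_derive0P => e e0.
  exists (Num.min 1 e) => [|k]; first by rewrite lt_min ltr01.
  rewrite lt_min => /andP[k1 ke]; rewrite (pos_l (x := 0))// expr0n/= subr0 mulr0 subr0.
  rewrite normrX exprS mulrC exprS.
  have pk : `|pos k| <= `|k|.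
    have [k0|k0] := leP 0 k; first by rewrite pos_r.
    by rewrite pos_l ?normr0// ltW.
  apply: ler_pM => //.
  apply: le_trans (ltW ke); rewrite -[leRHS]mulr1; apply: ler_pM => //.
  by apply: exprn_ile1 => //; apply: le_trans pk (ltW k1).
Unshelve. all: by end_near. Qed.

(* The integrated quadratic B-spline with knots 0, 1, 2, 3. *)
Definition step (y : R) : R :=
  6^-1 * (pos y ^+ 3 - 3 * pos (y - 1) ^+ 3 + 3 * pos (y - 2) ^+ 3 - pos (y - 3) ^+ 3).
Definition step1 (y : R) : R :=
  2^-1 * (pos y ^+ 2 - 3 * pos (y - 1) ^+ 2 + 3 * pos (y - 2) ^+ 2 - pos (y - 3) ^+ 2).
Definition step2 (y : R) : R :=
  pos y - 3 * pos (y - 1) + 3 * pos (y - 2) - pos (y - 3).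

Lemma is_derive_pos_shift n (a x : R) :
  is_derive x (1:R) (fun x => pos (x - a) ^+ n.+2) (n.+2%:R * pos (x - a) ^+ n.+1).
Proof.
apply/is_derive_shiftP.
have h := (is_derive_shiftP _ _ _).1 (is_derive_posX n (x - a)).
rewrite (_ : (fun h => _) = (fun h => pos (x - a + h) ^+ n.+2))//.
by apply/funext => y; congr (pos _ ^+ _); ring.
Qed.

Lemma is_derive_step x : is_derive x (1:R) step (step1 x).
Proof.
have h0 := is_derive_posX 1 x; have h1 := is_derive_pos_shift 1 1 x.
have h2 := is_derive_pos_shift 1 2 x; have h3 := is_derive_pos_shift 1 3 x.
have := is_deriveZ 6^-1 (is_deriveB (is_deriveD (is_deriveB h0 (is_deriveZ 3 h1)) (is_deriveZ 3 h2)) h3).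
move=> /is_derive_eq; apply; rewrite /step1 /GRing.scale/=; by field.
Qed.

Lemma is_derive_step1 x : is_derive x (1:R) step1 (step2 x).
Proof.
have h0 := is_derive_posX 0 x; have h1 := is_derive_pos_shift 0 1 x.
have h2 := is_derive_pos_shift 0 2 x; have h3 := is_derive_pos_shift 0 3 x.
have := is_deriveZ 2^-1 (is_deriveB (is_deriveD (is_deriveB h0 (is_deriveZ 3 h1)) (is_deriveZ 3 h2)) h3).
move=> /is_derive_eq; apply; rewrite /step2 /GRing.scale/= !expr1; by field.
Qed.

(** Makes [step] of class C^2, the regularity that the extension of the normal inherits. *)
Lemma continuous_step2 : continuous step2.
Proof.
move=> x; have c a : pos (y - a) @[y --> x] --> pos (x - a).
  by apply: (@continuous_comp _ _ _ (fun y => y - a) pos); [apply: continuousB; [|exact: cst_continuous]|exact: continuous_pos].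
have c0 : pos y @[y --> x] --> pos x by exact: continuous_pos.
have cz (k : R) a : k * pos (y - a) @[y --> x] --> k * pos (x - a).
  by apply: cvgM; [exact: cvg_cst|exact: c].
rewrite /continuous_at /step2.
by apply: cvgB => //; apply: cvgD => //; apply: cvgB.
Qed.

Lemma continuous_of_is_derive g dg : (forall x, is_derive x (1:R) g (dg x)) -> continuous g.
Proof.
move=> gd x; apply: differentiable_continuous; apply/derivable1_diffP.
by have [] := gd x.
Qed.

Lemma step_le0 y : y <= 0 -> step y = 0 /\ step1 y = 0.
Proof. by move=> y0; rewrite /step /step1 !pos_l; try lra; split; ring. Qed.

Lemma step_ge3 y : 3 <= y -> step y = 1 /\ step1 y = 0.
Proof. by move=> y3; rewrite /step /step1 !pos_r; try lra; split; by field. Qed.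

(** Monotonicity of the cutoff, which fixes the sign of the comparison field in
    [null_flux_boundary]. *)
Lemma step1_ge0 y : 0 <= step1 y.
Proof.
have [h0|h0] := leP y 0; first by rewrite (step_le0 h0).2.
have [h3|h3] := leP 3 y; first by rewrite (step_ge3 h3).2.
rewrite /step1 (pos_l (x := y - 3)); last lra.
rewrite (pos_r (x := y)); last lra.
have [h1|h1] := leP y 1; first by rewrite !pos_l; try lra; nra.
rewrite (pos_r (x := y - 1)); last lra.
have [h2|h2] := leP y 2; first by rewrite pos_l; try lra; nra.
by rewrite pos_r; try lra; nra.
Qed.

Lemma step_itv y : 0 <= step y <= 1.
Proof.
have [h0|h0] := leP y 0; first by rewrite (step_le0 h0).1 lexx ler01.
have [h3|h3] := leP 3 y; first by rewrite (step_ge3 h3).1 lexx ler01.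
rewrite /step (pos_l (x := y - 3)); last lra.
rewrite (pos_r (x := y)); last lra.
have [h1|h1] := leP y 1.
  rewrite !pos_l; try lra.
  have : 0 <= y ^+ 3 <= 1 by rewrite exprn_ge0 ?exprn_ile1//; lra.
  by move=> /andP[? ?]; apply/andP; split; lra.
rewrite (pos_r (x := y - 1)); last lra.
have [h2|h2] := leP y 2.
  rewrite pos_l; try lra.
  pose w := y - 1; have -> : y = w + 1 by rewrite /w; ring.
  have w0 : 0 <= w <= 1 by rewrite /w; apply/andP; split; lra.
  clearbody w; rewrite addrK; apply/andP; split; nra.
rewrite pos_r; try lra.
pose w := 3 - y; have -> : y = 3 - w by rewrite /w; ring.
have w0 : 0 <= w <= 1 by rewrite /w; apply/andP; split; lra.
have : 0 <= w ^+ 3 <= 1 by case/andP: w0 => ? ?; rewrite exprn_ge0 ?exprn_ile1.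
by move=> /andP[? ?]; apply/andP; split; nra.
Qed.

End OneVariable.

(** * Mean values and first-order expansion in space *)

Section Space.
Variable R : realType.
Implicit Types (f g : E3 R -> R) (p x y : E3 R).

Lemma line_coord x (j k : 'I_3) (s : R) :
  (x + s *: axis R j) 0 k = x 0 k + s * (k == j)%:R.
Proof. by rewrite !mxE. Qed.

Lemma MVT_axis f p (r : R) x (j : 'I_3) (h : R) : 0 < r ->
  (forall y, ball p r y -> derivable f y (axis R j)) ->
  ball p r x -> ball p r (x + h *: axis R j) ->
  exists2 xi, ball p r xi & f (x + h *: axis R j) - f x = 'D_(axis R j) f xi * h.
Proof.
move=> r0 df /(ball_rV _ _ r0) px /(ball_rV _ _ r0) ph.
have [h0|h0] := eqVneq h 0.
  exists x; first exact/ball_rV.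
  by rewrite h0 scale0r addr0 subrr mulr0.
pose a := Num.min 0 h; pose b := Num.max 0 h.
have ab : a < b by rewrite /a /b; case: (ltgtP 0 h) h0 => // h0 _; rewrite ?eqxx.
have inball s : a <= s <= b -> ball p r (x + s *: axis R j).
  move=> sab; apply/(ball_rV _ _ r0) => k; rewrite line_coord.
  have := px k; have := ph k; rewrite line_coord.
  case: eqP => _; rewrite ?mulr1 ?mulr0//.
  rewrite !ltr_norml => /andP[? ?] /andP[? ?]; apply/andP.
  by move: sab; rewrite /a /b; have [?|?] := leP 0 h => /andP[? ?]; split; lra.
have dl s : a <= s <= b -> is_derive s (1:R) (fun s : R => f (x + s *: axis R j)) ('D_(axis R j) f (x + s *: axis R j)).
  by move=> sab; apply/is_derive_line/derivableP/df/inball.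
have cl : {within `[a, b], continuous (fun s : R => f (x + s *: axis R j))}.
  apply: derivable_within_continuous => s; rewrite in_itv/= => /dl[h1 _].
  exact: h1.
have [|c] := @MVT _ (fun s : R => f (x + s *: axis R j)) (fun s => 'D_(axis R j) f (x + s *: axis R j)) a b ab _ cl.
  by move=> s; rewrite in_itv/= => /andP[? ?]; apply: dl; rewrite !ltW.
rewrite in_itv/= => /andP[ac cb] E; exists (x + c *: axis R j).
  by apply: inball; rewrite !ltW.
move: E; rewrite /a /b; have [_|_] := leP 0 h; rewrite scale0r addr0.
  by rewrite subr0.
by move=> E; rewrite -opprB E sub0r mulrN opprK.
Qed.

(** The ball is a cube, so it contains the path from x to y that changes one coordinate at a time;
    each leg has its own intermediate point. *)
Lemma MVT_space f p (r : R) x y : 0 < r ->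
  (forall j z, ball p r z -> derivable f z (axis R j)) ->
  ball p r x -> ball p r y ->
  exists2 xi : 'I_3 -> E3 R, (forall j, ball p r (xi j)) &
    f y - f x = \sum_j 'D_(axis R j) f (xi j) * (y 0 j - x 0 j).
Proof.
move=> r0 df px py.
pose z0 := x; pose z1 := z0 + (y 0 (inord 0) - x 0 (inord 0)) *: axis R (inord 0).
pose z2 := z1 + (y 0 (inord 1) - x 0 (inord 1)) *: axis R (inord 1).
pose z3 := z2 + (y 0 (inord 2) - x 0 (inord 2)) *: axis R (inord 2).
have ne (a b : nat) : (a < 3)%N -> (b < 3)%N -> (inord a == inord b :> 'I_3) = (a == b).
  by move=> a3 b3; rewrite -val_eqE /= !inordK.
have Ez3 : z3 = y.
  apply/rowP; apply: I3_cases; rewrite /z3 /z2 /z1 /z0 !line_coord !ne//= ?mulr1 ?mulr0 ?addr0; ring.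
have px' := (ball_rV p x r0).1 px; have py' := (ball_rV p y r0).1 py.
have b1 : ball p r z1.
  apply/(ball_rV _ _ r0); apply: I3_cases; rewrite /z1 /z0 !line_coord !ne//= ?mulr1 ?mulr0 ?addr0//.
  by rewrite addrCA subrr addr0.
have b2 : ball p r z2.
  apply/(ball_rV _ _ r0); apply: I3_cases; rewrite /z2 /z1 /z0 !line_coord !ne//= ?mulr1 ?mulr0 ?addr0//.
    by rewrite addrCA subrr addr0.
  by rewrite addrCA subrr addr0.
have [xi0 bx0 E0] := MVT_axis r0 (df (inord 0)) px b1.
have [xi1 bx1 E1] := MVT_axis r0 (df (inord 1)) b1 b2.
have b3 : ball p r z3 by rewrite Ez3.
have [xi2 bx2 E2] := MVT_axis r0 (df (inord 2)) b2 b3.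
exists (fun j : 'I_3 => if j == inord 0 then xi0 else if j == inord 1 then xi1 else xi2).
  by apply: I3_cases; rewrite !ne.
have S3 (F : 'I_3 -> R) : \sum_j F j = F (inord 0) + F (inord 1) + F (inord 2).
  rewrite !big_ord_recl big_ord0 addr0 addrA.
  by congr (_ + _ + _); congr F; apply: val_inj; rewrite /= inordK.
rewrite S3 !ne//= -E0 -E1 -E2 -/z1 -/z2 -/z3 Ez3; ring.
Qed.

Lemma sum_I3 (F : 'I_3 -> R) : \sum_j F j = F (inord 0) + F (inord 1) + F (inord 2).
Proof.
rewrite !big_ord_recl big_ord0 addr0 addrA.
by congr (_ + _ + _); congr F; apply: val_inj; rewrite /= inordK.
Qed.

Lemma norm_coord x (j : 'I_3) : `|x 0 j| <= `|x|.
Proof.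
rewrite [leRHS]/Num.Def.normr/= mx_normrE.
by apply/bigmax_geP; right => /=; exists (0, j).
Qed.

Lemma near_forall_I3 (T : topologicalType) (t : T) (P : 'I_3 -> T -> Prop) :
  (forall j, \forall y \near t, P j y) -> \forall y \near t, forall j, P j y.
Proof.
move=> H; apply: filterS3 (H (inord 0)) (H (inord 1)) (H (inord 2)) => y h0 h1 h2.
by apply: I3_cases.
Qed.

Lemma first_order f p :
  (\forall y \near p, forall j, derivable f y (axis R j)) ->
  (forall j, {for p, continuous (fun y => 'D_(axis R j) f y)}) ->
  forall e, 0 < e -> exists2 d, 0 < d & forall v : E3 R, `|v| < d ->
    `|f (p + v) - f p - \sum_j 'D_(axis R j) f p * v 0 j| <= e * `|v|.
Proof.
move=> /nbhs_ballP[r /= r0 df] cf e e0.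
have e30 : 0 < e / 3 by rewrite divr_gt0.
have : \forall y \near p, forall j, `|'D_(axis R j) f y - 'D_(axis R j) f p| <= e / 3.
  apply: near_forall_I3 => j.
  have /cvgrPdist_le/(_ _ e30) := cf j.
  by apply: filterS => y; rewrite distrC.
move=> /nbhs_ballP[d /= d0 Hd].
pose m := Num.min r d.
have m0 : 0 < m by rewrite lt_min r0.
exists m => // v vm.
have bv : ball p m (p + v).
  apply/(ball_rV _ _ m0) => j; rewrite mxE opprD addNKr normrN.
  exact: le_lt_trans (norm_coord _ _) vm.
have mr : m <= r by rewrite ge_min lexx.
have md : m <= d by rewrite ge_min lexx orbT.
have [|xi bxi ->] := @MVT_space f p m p (p + v) m0 _ (ballxx _ m0) bv.
  by move=> j z bz; apply: df; exact: le_ball mr _ bz.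
have -> : \sum_j 'D_(axis R j) f (xi j) * ((p + v) 0 j - p 0 j) -
    \sum_j 'D_(axis R j) f p * v 0 j =
    \sum_j ('D_(axis R j) f (xi j) - 'D_(axis R j) f p) * v 0 j.
  by rewrite -sumrB; apply: eq_bigr => j _; rewrite mxE; ring.
apply: le_trans (ler_norm_sum _ _ _) _.
apply: (@le_trans _ _ (\sum_(j < 3) e / 3 * `|v|)).
  apply: ler_sum => j _; rewrite normrM; apply: ler_pM => //; last exact: norm_coord.
  by apply: Hd; exact: le_ball md _ (bxi j).
by rewrite sum_I3 le_eqVlt; apply/orP; left; apply/eqP; field.
Qed.

End Space.

(** * Functions of class C^k up to the boundary *)

Section Regularity.
Variables (R : realType) (B D : set (E3 R)).
Hypotheses (oB : open B) (BD : B `<=` D) (DB : D `<=` closure B).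
Implicit Types (f g G : E3 R -> R).

(* Used with D = B and with D = closure B. *)
Inductive Ck : nat -> (E3 R -> R) -> Prop :=
| Ck0 f : {within D, continuous f} -> Ck 0 f
| CkS k f : {within D, continuous f} ->
    (forall j x, B x -> derivable f x (axis R j)) ->
    (forall j, Ck k (pd B j f)) -> Ck k.+1 f.

Lemma pd_in j f x : B x -> pd B j f x = 'D_(axis R j) f x.
Proof. by move=> Bx; rewrite /pd mem_set. Qed.

Lemma pd_out j f x : ~ B x -> pd B j f x = lim ('D_(axis R j) f y @[y --> within B (nbhs x)]).
Proof. by move=> Bx; rewrite /pd memNset. Qed.

#[local] Opaque pd.

Lemma within_body_proper x : D x -> ProperFilter (within B (nbhs x)).
Proof.
move=> /DB Dx; apply: Build_ProperFilter_ex.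
move=> P; rewrite /within/= => BP; have [y [By Py]] := Dx _ BP.
by exists y; exact: Py.
Qed.

Lemma within_body_cvg f x : {within D, continuous f} -> D x ->
  f y @[y --> within B (nbhs x)] --> f x.
Proof.
move=> /within_continuousP cf Dx; apply: cvg_trans (cf _ Dx).
by move=> P; apply: within_subset.
Qed.

Lemma within_eq f g : (forall x, D x -> f x = g x) ->
  {within D, continuous f} -> {within D, continuous g}.
Proof. by move=> fg; apply: subspace_eq_continuous => x; rewrite inE; exact: fg. Qed.

Lemma near_body x : B x -> \forall y \near x, B y.
Proof. by move=> Bx; exact: open_nbhs_nbhs. Qed.

Lemma derive_body_eq f g (j : 'I_3) : (forall x, B x -> f x = g x) ->
  forall x, B x -> 'D_(axis R j) f x = 'D_(axis R j) g x.
Proof.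
move=> fg x Bx; apply: near_eq_derive.
by apply: filterS (near_body Bx).
Qed.

Lemma lim_near_eq (T : Type) (F : set_system T) (FF : Filter F) (f g : T -> R) :
  (\forall x \near F, f x = g x) -> lim (f x @[x --> F]) = lim (g x @[x --> F]).
Proof.
move=> fg; congr (lim _); apply/predeqP => P; split => h.
  by apply: filterS2 fg h => x /= ->.
by apply: filterS2 fg h => x /= ->.
Qed.

Lemma pd_ext f g (j : 'I_3) x : (forall x, B x -> f x = g x) -> pd B j f x = pd B j g x.
Proof.
move=> fg; have [Bx|Bx] := pselect (B x).
  by rewrite !pd_in//; exact: derive_body_eq.
rewrite pd_out; last exact: Bx.
rewrite pd_out; last exact: Bx.
apply: lim_near_eq; rewrite near_withinE; apply: nearW => y By; exact: derive_body_eq.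
Qed.

(** On the boundary [pd] is a bare limit, without meaning unless it exists. A candidate G continuous
    on D identifies it; the rules of calculus for [pd] up to the boundary are obtained in this
    way. *)
Lemma pd_lim f G (j : 'I_3) x : {within D, continuous G} ->
  (forall x, B x -> 'D_(axis R j) f x = G x) -> D x -> pd B j f x = G x.
Proof.
move=> cG fG Dx; have [Bx|Bx] := pselect (B x); first by rewrite pd_in// fG.
rewrite pd_out; last exact: Bx.
have PF := within_body_proper Dx.
rewrite (@lim_near_eq _ _ _ _ G); last first.
  by rewrite near_withinE; apply: nearW => y By; exact: fG.
by apply: cvg_lim => //; exact: within_body_cvg.
Qed.

Lemma Ck_continuous k f : Ck k f -> {within D, continuous f}.
Proof. by case. Qed.

Lemma Ck_derivable k f (j : 'I_3) x : Ck k.+1 f -> B x -> derivable f x (axis R j).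
Proof. by move=> H; inversion H as [|k' f' cf df Cf]; exact: df. Qed.

Lemma Ck_pd k f (j : 'I_3) : Ck k.+1 f -> Ck k (pd B j f).
Proof. by move=> H; inversion H as [|k' f' cf df Cf]; exact: Cf. Qed.

Lemma Ck_is_derive k f (j : 'I_3) x : Ck k.+1 f -> B x ->
  is_derive x (axis R j) f (pd B j f x).
Proof. by move=> Cf Bx; rewrite pd_in//; apply/derivableP; exact: Ck_derivable Cf Bx. Qed.

(** The derivatives may be given by formulas verified in B; on the rest of D they agree with the
    limits by [pd_lim]. The induction shows that [Ck] is unchanged when a function is replaced by
    one equal to it on D. *)
Lemma Ck_intro k f (G : 'I_3 -> E3 R -> R) : {within D, continuous f} ->
  (forall j x, B x -> is_derive x (axis R j) f (G j x)) ->
  (forall j, Ck k (G j)) -> Ck k.+1 f.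
Proof.
move=> cf fG CG; apply: CkS => // j; first by move=> x Bx; have [] := fG j _ Bx.
have H x : D x -> G j x = pd B j f x.
  move=> Dx; apply/esym/(pd_lim (Ck_continuous (CG j))) => // y By.
  by have [_ ->] := fG j _ By.
move: (G j) (pd B j f) H (CG j) => {CG fG}; elim: k => [|k IH] g h gh Cg.
  by apply: Ck0; apply: within_eq gh _; exact: Ck_continuous Cg.
apply: CkS; first by apply: within_eq gh _; exact: Ck_continuous Cg.
- move=> i x Bx; have [h1 _] : is_derive x (axis R i) h ('D_(axis R i) g x).
    apply: (@is_derive_near_eq _ g); last by apply/derivableP; exact: Ck_derivable Cg Bx.
    by apply: filterS (near_body Bx) => y /BD/gh.
  exact: h1.
- move=> i; apply: IH (Ck_pd i Cg) => x Dx; apply: pd_ext => y /BD; exact: gh.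
Qed.

Lemma Ck_ext k f g : (forall x, D x -> f x = g x) -> Ck k f -> Ck k g.
Proof.
case: k => [|k] fg Cf.
  by apply: Ck0; apply: within_eq fg _; exact: Ck_continuous Cf.
apply: (@Ck_intro k g (fun j => pd B j f)).
- by apply: within_eq fg _; exact: Ck_continuous Cf.
- move=> j x Bx; apply: (@is_derive_near_eq _ f); last exact: Ck_is_derive Cf Bx.
  by apply: filterS (near_body Bx) => y /BD/fg.
- by move=> j; exact: Ck_pd.
Qed.

Lemma CkW k f : Ck k.+1 f -> Ck k f.
Proof.
elim: k f => [|k IH] f Cf; first by apply: Ck0; exact: Ck_continuous Cf.
apply: CkS; first exact: Ck_continuous Cf.
  by move=> j x Bx; exact: Ck_derivable Cf Bx.
by move=> j; apply: IH; exact: Ck_pd.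
Qed.

Lemma pd_eq k f G (j : 'I_3) x : Ck k G ->
  (forall x, B x -> is_derive x (axis R j) f (G x)) -> D x -> pd B j f x = G x.
Proof.
move=> CG fG; apply: pd_lim; first exact: Ck_continuous CG.
by move=> y By; have [_ ->] := fG _ By.
Qed.

Lemma Ck_cst k c : Ck k (fun=> c).
Proof.
elim: k c => [|k IH] c; first by apply: Ck0; apply: continuousP_within; exact: cst_continuous.
apply: (@Ck_intro k _ (fun=> (fun=> 0))) => //.
by apply: continuousP_within; exact: cst_continuous.
Qed.

Lemma withinD f g : {within D, continuous f} -> {within D, continuous g} ->
  {within D, continuous (fun x => f x + g x)}.
Proof. by move=> cf cg x; apply: continuousD; [exact: cf|exact: cg]. Qed.

Lemma withinM f g : {within D, continuous f} -> {within D, continuous g} ->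
  {within D, continuous (fun x => f x * g x)}.
Proof. by move=> cf cg x; apply: continuousM; [exact: cf|exact: cg]. Qed.

Lemma is_derive_add f g x (v : E3 R) df dg : is_derive x v f df -> is_derive x v g dg ->
  is_derive x v (fun x => f x + g x) (df + dg).
Proof. by move=> hf hg; exact: is_deriveD. Qed.

Lemma is_derive_mul f g x (v : E3 R) df dg : is_derive x v f df -> is_derive x v g dg ->
  is_derive x v (fun x => f x * g x) (df * g x + f x * dg).
Proof.
move=> hf hg; have := is_deriveM hf hg; move=> /is_derive_eq; apply.
by rewrite /GRing.scale/= addrC mulrC.
Qed.

Lemma CkD k f g : Ck k f -> Ck k g -> Ck k (fun x => f x + g x).
Proof.
elim: k f g => [|k IH] f g Cf Cg.
  by apply: Ck0; apply: withinD; [exact: Ck_continuous Cf|exact: Ck_continuous Cg].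
apply: (@Ck_intro k _ (fun j x => pd B j f x + pd B j g x)).
- by apply: withinD; [exact: Ck_continuous Cf|exact: Ck_continuous Cg].
- by move=> j x Bx; apply: is_derive_add; [exact: Ck_is_derive Cf Bx|exact: Ck_is_derive Cg Bx].
- by move=> j; apply: IH; exact: Ck_pd.
Qed.

Lemma pdD f g (j : 'I_3) x : Ck 1 f -> Ck 1 g -> D x ->
  pd B j (fun x => f x + g x) x = pd B j f x + pd B j g x.
Proof.
move=> Cf Cg; apply: (@pd_eq 0 _ (fun x => pd B j f x + pd B j g x)).
  by apply: CkD; exact: Ck_pd.
by move=> y By; apply: is_derive_add; [exact: Ck_is_derive Cf By|exact: Ck_is_derive Cg By].
Qed.

Lemma CkM k f g : Ck k f -> Ck k g -> Ck k (fun x => f x * g x).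
Proof.
elim: k f g => [|k IH] f g Cf Cg.
  by apply: Ck0; apply: withinM; [exact: Ck_continuous Cf|exact: Ck_continuous Cg].
apply: (@Ck_intro k _ (fun j x => pd B j f x * g x + f x * pd B j g x)).
- by apply: withinM; [exact: Ck_continuous Cf|exact: Ck_continuous Cg].
- by move=> j x Bx; apply: is_derive_mul; [exact: Ck_is_derive Cf Bx|exact: Ck_is_derive Cg Bx].
- by move=> j; apply: CkD; apply: IH; try exact: Ck_pd; exact: CkW.
Qed.

Lemma pdM f g (j : 'I_3) x : Ck 1 f -> Ck 1 g -> D x ->
  pd B j (fun x => f x * g x) x = pd B j f x * g x + f x * pd B j g x.
Proof.
move=> Cf Cg; apply: (@pd_eq 0 _ (fun x => pd B j f x * g x + f x * pd B j g x)).
  by apply: CkD; apply: CkM; try exact: Ck_pd; exact: CkW.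
by move=> y By; apply: is_derive_mul; [exact: Ck_is_derive Cf By|exact: Ck_is_derive Cg By].
Qed.

Lemma pd_cst c (j : 'I_3) x : D x -> pd B j (fun=> c) x = 0.
Proof. by apply: (@pd_eq 0); exact: Ck_cst. Qed.

Lemma CkZ k c f : Ck k f -> Ck k (fun x => c * f x).
Proof. by apply: CkM; exact: Ck_cst. Qed.

Lemma pdZ c f (j : 'I_3) x : Ck 1 f -> D x -> pd B j (fun x => c * f x) x = c * pd B j f x.
Proof. move=> Cf Dx; rewrite (pdM j (Ck_cst 1 c) Cf Dx) (pd_cst c j Dx).
by rewrite mul0r add0r. Qed.

Lemma CkN k f : Ck k f -> Ck k (fun x => - f x).
Proof. by move=> /(CkZ (-1)); apply: Ck_ext => x _; rewrite mulN1r. Qed.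

Lemma pdN f (j : 'I_3) x : Ck 1 f -> D x -> pd B j (fun x => - f x) x = - pd B j f x.
Proof.
move=> Cf Dx; rewrite -mulN1r -(pdZ (-1) j Cf Dx).
by apply: pd_ext => y _; rewrite mulN1r.
Qed.

Lemma CkB k f g : Ck k f -> Ck k g -> Ck k (fun x => f x - g x).
Proof. by move=> Cf Cg; apply: CkD => //; exact: CkN. Qed.

Lemma pdB f g (j : 'I_3) x : Ck 1 f -> Ck 1 g -> D x ->
  pd B j (fun x => f x - g x) x = pd B j f x - pd B j g x.
Proof. by move=> Cf Cg Dx; rewrite (pdD j Cf (CkN Cg) Dx) (pdN j Cg Dx). Qed.

Lemma Ck_sum k (I : finType) (F : I -> E3 R -> R) : (forall i, Ck k (F i)) ->
  Ck k (fun x => \sum_i F i x).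
Proof.
move=> CF; elim: (index_enum I) => [|i s IH].
  by apply: Ck_ext (Ck_cst k 0) => x _; rewrite big_nil.
by apply: Ck_ext (CkD (CF i) IH) => x _; rewrite big_cons.
Qed.

Lemma pd_sum (I : finType) (F : I -> E3 R -> R) (j : 'I_3) x : (forall i, Ck 1 (F i)) -> D x ->
  pd B j (fun x => \sum_i F i x) x = \sum_i pd B j (F i) x.
Proof.
move=> CF Dx.
suff H s : Ck 1 (fun x => \sum_(i <- s) F i x) /\
    pd B j (fun x => \sum_(i <- s) F i x) x = \sum_(i <- s) pd B j (F i) x.
  by case: (H (index_enum I)).
elim: s => [|i s [IH1 IH2]].
  split; first by apply: Ck_ext (Ck_cst 1 0) => y _; rewrite big_nil.
  rewrite big_nil -[RHS](pd_cst 0 j Dx).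
  by apply: pd_ext => y _; rewrite big_nil.
split; first by apply: Ck_ext (CkD (CF i) IH1) => y _; rewrite big_cons.
rewrite big_cons -IH2 -(pdD j (CF i) IH1 Dx).
by apply: pd_ext => y _; rewrite big_cons.
Qed.

(** The derivative of [pd B i f] along the axis j is computed twice: by [mixed_derivative], which
    gives the order i, j, and by definition, which gives the order j, i. *)
Lemma pd_swap f (i j : 'I_3) x : Ck 2 f -> B x ->
  pd B i (pd B j f) x = pd B j (pd B i f) x.
Proof.
move=> Cf Bx.
have /nbhs_ballP[r /= r0 rB] := near_body Bx.
have r20 : 0 < r / 2 by rewrite divr_gt0.
pose z (a b : R) := x + a *: axis R i + b *: axis R j.
have Bz a b : `|a| < r / 2 -> `|b| < r / 2 -> B (z a b).
  move=> ar br; apply: rB; apply/(ball_rV _ _ r0) => k.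
  rewrite /z !line_coord -addrA opprD addNKr normrN.
  apply: le_lt_trans (ler_normD _ _) _; rewrite [ltRHS]splitr; apply: ltrD.
    by case: eqP => _; rewrite ?mulr1// mulr0 normr0.
  by case: eqP => _; rewrite ?mulr1// mulr0 normr0.
have zswap a b : z a b = x + b *: axis R j + a *: axis R i by rewrite /z -!addrA [_ *: axis R i + _]addrC.
have C1 := CkW Cf.
have Cij : {within D, continuous (pd B i (pd B j f))}.
  by apply: (@Ck_continuous 0); do 2 apply: Ck_pd.
have line g (y : E3 R) (k : 'I_3) (s : R) : Ck 1 g -> B (y + s *: axis R k) ->
    is_derive s (1:R) (fun s : R => g (y + s *: axis R k)) (pd B k g (y + s *: axis R k)).
  by move=> Cg By; apply/is_derive_line; exact: Ck_is_derive Cg By.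
have z00 : z 0 0 = x by rewrite /z !scale0r !addr0.
have r00 : `|0 : R| < r / 2 by rewrite normr0.
have M : is_derive (0:R) (1:R) (fun b => pd B i f (z 0 b)) (pd B i (pd B j f) (z 0 0)).
  apply: (@mixed_derivative R (fun a b => f (z a b)) (fun a b => pd B j f (z a b))
    (fun a b => pd B i (pd B j f) (z a b)) (fun b => pd B i f (z 0 b)) (r / 2) r20).
  - move=> b br; rewrite zswap.
    rewrite (_ : (fun a => f (z a b)) = (fun a => f (x + b *: axis R j + a *: axis R i))); last first.
      by apply/funext => a; rewrite zswap.
    by apply: line => //; rewrite -zswap; exact: Bz.
  - by move=> a b ar br; apply: line => //; exact: Bz.
  - move=> a b ar br; rewrite zswap.
    rewrite (_ : (fun a => pd B j f (z a b)) = (fun a => pd B j f (x + b *: axis R j + a *: axis R i))); last first.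
      by apply/funext => c; rewrite zswap.
    by apply: line; [exact: Ck_pd|rewrite -zswap; exact: Bz].
  - move=> e e0; rewrite z00.
    have cx : {for x, continuous (pd B i (pd B j f))}.
      move/within_continuousP : Cij => /(_ _ (BD Bx)) h P hP.
      have := h _ hP; rewrite /= /within/= => hh.
      have : \forall y \near x, (D y -> P (pd B i (pd B j f) y)) /\ B y.
        by apply: filterI; [exact: hh|exact: near_body].
      by apply: filterS => y [h1 /BD]; exact: h1.
    have /cvgrPdist_le/(_ _ e0)/nbhs_ballP[d /= d0 Hd] := cx.
    have d20 : 0 < d / 2 by rewrite divr_gt0.
    exists (d / 2) => // a b ad bd; rewrite distrC; apply: Hd.
    apply/(ball_rV _ _ d0) => k.
    rewrite /z !line_coord -addrA opprD addNKr normrN.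
    apply: le_lt_trans (ler_normD _ _) _; rewrite [ltRHS]splitr; apply: ltrD.
      by case: eqP => _; rewrite ?mulr1// mulr0 normr0.
    by case: eqP => _; rewrite ?mulr1// mulr0 normr0.
have N : is_derive (0:R) (1:R) (fun b => pd B i f (z 0 b)) (pd B j (pd B i f) (z 0 0)).
  rewrite (_ : (fun b => pd B i f (z 0 b)) = (fun b => pd B i f (x + b *: axis R j))); last first.
    by apply/funext => b; rewrite /z scale0r addr0.
  rewrite (_ : z 0 0 = x + (0:R) *: axis R j); last by rewrite z00 scale0r addr0.
  by apply: line; [exact: Ck_pd|rewrite scale0r addr0].
by have [_ h1] := M; have [_ h2] := N; rewrite -z00 -h1 -h2.
Qed.

End Regularity.

#[local] Opaque pd step step1 step2.

(** * Locality of C^k regularity *)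

Section Gluing.
Variable R : realType.
Implicit Types (O U B D : set (E3 R)) (f g : E3 R -> R).

Lemma within_openP O f : open O ->
  {within O, continuous f} <-> forall x, O x -> {for x, continuous f}.
Proof.
move=> oO; split => [/within_continuousP cf x Ox|cf].
  move=> P hP; have := cf x Ox P hP; rewrite /= /within/= => h.
  have : \forall y \near x, (O y -> P (f y)) /\ O y.
    by apply: filterI; [exact: h|exact: near_body].
  by apply: filterS => y [h1]; exact: h1.
by apply/within_continuousP => x Ox; apply: cvg_within_filter; exact: cf.
Qed.

Lemma Ck_restrict O B D k f : open O -> open B -> B `<=` D -> D `<=` closure B -> D `<=` O ->
  Ck O O k f -> Ck B D k f.
Proof.
move=> oO oB BD DB DO; elim: k f => [|k IH] f Cf.
  by apply: Ck0; apply: continuous_subspaceW DO _; exact: Ck_continuous Cf.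
apply: (@Ck_intro _ _ _ oB BD DB k f (fun j => pd O j f)).
- by apply: continuous_subspaceW DO _; exact: Ck_continuous Cf.
- by move=> j x /BD/DO Ox; exact: Ck_is_derive Cf Ox.
- by move=> j; apply: IH; exact: Ck_pd Cf.
Qed.

Lemma Ck_glue O1 O2 k f : open O1 -> open O2 -> Ck O1 O1 k f -> Ck O2 O2 k f ->
  Ck (O1 `|` O2) (O1 `|` O2) k f.
Proof.
move=> o1 o2; have oU : open (O1 `|` O2) by exact: openU.
have glue_c g : {within O1, continuous g} -> {within O2, continuous g} ->
    {within O1 `|` O2, continuous g}.
  move=> /(within_openP _ o1) c1 /(within_openP _ o2) c2.
  by apply/(within_openP _ oU) => x [/c1|/c2].
elim: k f => [|k IH] f C1 C2.
  by apply: Ck0; apply: glue_c; [exact: Ck_continuous C1|exact: Ck_continuous C2].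
apply: CkS; first by apply: glue_c; [exact: Ck_continuous C1|exact: Ck_continuous C2].
  by move=> j x [Ox|Ox]; [exact: Ck_derivable C1 Ox|exact: Ck_derivable C2 Ox].
have cl (A : set (E3 R)) : A `<=` closure A by exact: subset_closure.
move=> j; apply: IH.
- apply: (Ck_ext o1 (@subset_refl _ _) (cl O1)) (Ck_pd j C1) => x Ox.
  by rewrite pd_in// pd_in//; left.
- apply: (Ck_ext o2 (@subset_refl _ _) (cl O2)) (Ck_pd j C2) => x Ox.
  by rewrite pd_in// pd_in//; right.
Qed.

Lemma smooth_on_Ck U g k : open U -> smooth_on U g -> Ck U U k g.
Proof.
move=> oU sg.
have cl (A : set (E3 R)) : A `<=` closure A by exact: subset_closure.
suff H (s : seq 'I_3) : Ck U U k (partials s g) by exact: (H [::]).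
elim: k s => [|k IH] s.
  by apply: Ck0; apply/(within_openP _ oU) => x Ux; have [] := sg s x Ux.
apply: CkS.
- by apply/(within_openP _ oU) => x Ux; have [] := sg s x Ux.
- by move=> j x Ux; have [_] := sg s x Ux; apply.
- move=> j; apply: (Ck_ext oU (@subset_refl _ _) (cl U)) (IH (j :: s)) => x Ux.
  by rewrite pd_in.
Qed.

End Gluing.

(** * Cutoff functions of class C^2 *)

Section Cutoffs.
Variable R : realType.
Implicit Types (O U B D : set (E3 R)) (f g : E3 R -> R).

Section Composition.
Variables (B D : set (E3 R)).
Hypotheses (oB : open B) (BD : B `<=` D) (DB : D `<=` closure B).

Lemma within_comp1 (h : R -> R) f : continuous h -> {within D, continuous f} ->
  {within D, continuous (h \o f)}.
Proof.
by move=> ch cf; apply: (within_comp (D := setT) cf) => //; exact: continuousP_within.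
Qed.

Lemma Ck_comp1 k (h dh : R -> R) f : (forall y, is_derive y (1:R) h (dh y)) ->
  Ck B D k.+1 f -> Ck B D k (dh \o f) -> Ck B D k.+1 (h \o f).
Proof.
move=> hd Cf Cd; apply: (@Ck_intro _ _ _ oB BD DB k _ (fun j x => dh (f x) * pd B j f x)).
- by apply: within_comp1; [exact: continuous_of_is_derive hd|exact: Ck_continuous Cf].
- by move=> j x Bx; apply: is_derive_comp1 => //; exact: Ck_is_derive Cf Bx.
- by move=> j; apply: CkM => //; exact: Ck_pd.
Qed.

Lemma Ck_step f : Ck B D 2 f -> Ck B D 2 (@step R \o f).
Proof.
move=> Cf; apply: (Ck_comp1 (dh := @step1 R)); [exact: is_derive_step|exact: Cf|].
apply: (Ck_comp1 (dh := @step2 R)); [exact: is_derive_step1|exact: CkW|].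
by apply: Ck0; apply: within_comp1; [exact: continuous_step2|exact: Ck_continuous Cf].
Qed.

Lemma Ck1_step f : Ck B D 1 f -> Ck B D 1 (@step R \o f).
Proof.
move=> Cf; apply: (Ck_comp1 (dh := @step1 R)); [exact: is_derive_step|exact: Cf|].
apply: Ck0; apply: within_comp1; last exact: Ck_continuous Cf.
exact: (continuous_of_is_derive (@is_derive_step1 R)).
Qed.

Lemma is_derive_coord (x : E3 R) (i j : 'I_3) :
  is_derive x (axis R j) (fun y : E3 R => y 0 i) (i == j)%:R.
Proof.
apply/(is_derive_at_line (fun y : E3 R => y 0 i)).
rewrite (_ : (fun s => _) = (fun s : R => x 0 i + s * (i == j)%:R)); last first.
  by apply/funext => s; rewrite line_coord.
apply: is_derive0P => e e0; exists 1 => // k _.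
rewrite (_ : _ - _ = 0); last by ring.
by rewrite normr0 mulr_ge0// ltW.
Qed.

Lemma Ck_coord k (i : 'I_3) : Ck B D k (fun y : E3 R => y 0 i).
Proof.
have c : {within D, continuous (fun y : E3 R => y 0 i)}.
  by apply: continuousP_within => x; exact: coord_continuous.
case: k => [|k]; first exact: Ck0.
apply: (@Ck_intro _ _ _ oB BD DB k _ (fun j _ => (i == j)%:R)) => //.
- by move=> j x _; exact: is_derive_coord.
- by move=> j; exact: Ck_cst.
Qed.

(** The Euclidean distance squared is a polynomial, unlike the maximum norm that defines the
    balls. *)
Definition dist2 (p x : E3 R) : R := \sum_j (x 0 j - p 0 j) * (x 0 j - p 0 j).

Lemma Ck_dist2 k p : Ck B D k (dist2 p).
Proof.
apply: Ck_sum => // j; apply: CkM => //; apply: CkB => //; try exact: Ck_coord; exact: Ck_cst.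
Qed.

(** The argument of [step] is at least 3 where dist2 <= a and at most 0 where dist2 >= 2 a, the
    thresholds beyond which [step] is constant. *)
Definition bump (p : E3 R) (a : R) (x : E3 R) : R := step (6 - 3 * a^-1 * dist2 p x).

Lemma Ck_bump p a : Ck B D 2 (bump p a).
Proof.
apply: (@Ck_step (fun x => 6 - 3 * a^-1 * dist2 p x)).
apply: CkB => //; [exact: Ck_cst|apply: CkZ => //; exact: Ck_dist2].
Qed.

End Composition.

Lemma bump1 p a x : 0 < a -> dist2 p x <= a -> bump p a x = 1.
Proof.
move=> a0 h; apply: (step_ge3 _).1.
have : a^-1 * dist2 p x <= 1 by rewrite mulrC ler_pdivrMr// mul1r.
by rewrite -mulrA; lra.
Qed.

Lemma bump0 p a x : 0 < a -> 2 * a <= dist2 p x -> bump p a x = 0.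
Proof.
move=> a0 h; apply: (step_le0 _).1.
have : 2 <= a^-1 * dist2 p x by rewrite mulrC ler_pdivlMr.
by rewrite -mulrA; lra.
Qed.

Lemma bump_itv p a x : 0 <= bump p a x <= 1.
Proof. exact: step_itv. Qed.

Lemma dist2_ge (p x : E3 R) (j : 'I_3) : (x 0 j - p 0 j) * (x 0 j - p 0 j) <= dist2 p x.
Proof.
rewrite /dist2 (bigD1 j)//= lerDl; apply: sumr_ge0 => i _.
by rewrite -expr2 sqr_ge0.
Qed.

Lemma dist2_ball p x e : 0 < e -> dist2 p x < e * e -> ball p e x.
Proof.
move=> e0 h; apply/(ball_rV _ _ e0) => j.
have := le_lt_trans (dist2_ge p x j) h; rewrite -!expr2.
move=> h2; rewrite distrC -(ltr_pXn2r (n := 2)) ?nnegrE// ?ltW//.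
by rewrite real_normK ?num_real// ltW.
Qed.

Lemma dist2_self p : dist2 p p = 0.
Proof. by rewrite /dist2 big1// => j _; rewrite subrr mul0r. Qed.

Lemma continuous_dist2 p : continuous (dist2 p).
Proof.
have C : Ck [set: E3 R] setT 0 (dist2 p).
  by apply: Ck_dist2 => //; [exact: openT|exact: subset_closure].
by move=> x; have /(within_openP _ openT) := Ck_continuous C; apply.
Qed.

Lemma closed_dist2 p c : closed [set x | dist2 p x <= c].
Proof.
have -> : [set x | dist2 p x <= c] = dist2 p @^-1` [set y | y <= c] by [].
by apply: preimage_closed => [x _|]; [exact: continuous_dist2|exact: closed_le].
Qed.

Lemma compact_dist2_cover (C : set (E3 R)) (a : E3 R -> R) : compact C ->
  (forall p, C p -> 0 < a p) ->
  exists s : seq (E3 R), (forall p, p \in s -> C p) /\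
    forall x, C x -> exists2 p, p \in s & dist2 p x < a p.
Proof.
move=> cC a0.
have : cover_compact C by rewrite -compact_cover.
move=> /(_ _ C (fun p => [set x | dist2 p x < a p]))[].
- move=> p Cp.
  have -> : [set x | dist2 p x < a p] = dist2 p @^-1` [set y | y < a p] by [].
  by apply: open_comp; [move=> x _; exact: continuous_dist2|exact: open_lt].
- by move=> x Cx; exists x => //=; rewrite dist2_self; exact: a0.
move=> S SC cov; exists (finmap.enum_fset S); split.
  by move=> p /SC; rewrite inE.
by move=> x /cov[p /= pS h]; exists p.
Qed.

Lemma compact_cutoff (C U : set (E3 R)) : compact C -> open U -> C `<=` U ->
  exists psi : E3 R -> R, exists K : set (E3 R),
    [/\ Ck setT setT 2 psi, closed K, K `<=` U,
        forall x, ~ K x -> psi x = 0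
      & forall x, C x -> \forall y \near x, psi y = 1].
Proof.
move=> cC oU CU.
have TT : [set: E3 R] `<=` closure [set: E3 R] by exact: subset_closure.
have oT := @openT (E3 R).
have T0 : [set: E3 R] `<=` [set: E3 R] by [].
have Ha p : exists a : R, C p -> 0 < a /\ [set x | dist2 p x <= 2 * a] `<=` U.
  have [Cp|] := pselect (C p); last by exists 0.
  have /nbhs_ballP[e /= e0 eU] : nbhs p U by apply: open_nbhs_nbhs; split => //; exact: CU.
  (* The bump of parameter a lives on dist2 <= 2 a = e^2 / 2, inside the ball of radius e. *)
  exists (e * e / 4) => _; split; first by rewrite divr_gt0// mulr_gt0.
  move=> x /= h; apply: eU; apply: dist2_ball => //; apply: le_lt_trans h _.
  have : 0 < e * e by rewrite mulr_gt0.
  lra.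
have [a /= Ha'] := choice Ha.
have [s [sC cov]] := compact_dist2_cover cC (fun p Cp => (Ha' p Cp).1).
have {}cov x : C x -> \forall y \near x, exists2 p, p \in s & dist2 p y < a p.
  move=> /cov[p ps h].
  have : \forall y \near x, dist2 p y < a p.
    by have := @continuous_dist2 p x => /cvgr_lt; apply.
  by apply: filterS => y hy; exists p.
suff [psi [K [h1 h2 h3 h4 h5]]] : exists psi : E3 R -> R, exists K : set (E3 R),
    [/\ Ck setT setT 2 psi, closed K, K `<=` U, forall x, ~ K x -> psi x = 0
      & forall x, (exists2 p, p \in s & dist2 p x < a p) -> psi x = 1].
  exists psi, K; split => // x /cov; apply: filterS => y; exact: h5.
elim: s sC {cov} => [|p s IH] sC.
  exists (fun=> 0), set0; split; [exact: (Ck_cst oT T0 TT)|exact: closed0|by []|by []|].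
  by move=> x [].
have [psi [K [h1 h2 h3 h4 h5]]] := IH (fun q qs => sC q (mem_behead (s := p :: s) qs)).
have Cp : C p by apply: sC; rewrite mem_head.
have [a0 aU] := Ha' p Cp.
(* Equal to 1 as soon as one of the two cutoffs is 1, and to 0 where both vanish; no normalisation
   is involved. *)
exists (fun x => 1 - (1 - bump p (a p) x) * (1 - psi x)), (K `|` [set x | dist2 p x <= 2 * a p]).
split.
- apply: (CkB oT T0 TT); first exact: (Ck_cst oT T0 TT).
  apply: (CkM oT T0 TT); apply: (CkB oT T0 TT); first exact: (Ck_cst oT T0 TT).
  + exact: (Ck_bump oT T0 TT).
  + exact: (Ck_cst oT T0 TT).
  + exact: h1.
- by apply: closedU; [exact: h2|exact: closed_dist2].
- by move=> x [/h3|/aU].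
- move=> x /not_orP[/h4 -> /negP]; rewrite -ltNge => /ltW/bump0 -> //.
  by rewrite !subr0 mulr1 subrr.
- move=> x [q]; rewrite inE => /predU1P[->|qs] h.
    by rewrite bump1// ?subrr ?mul0r ?subr0// ltW.
  by rewrite (h5 x) ?subrr ?mulr0 ?subr0//; exists q.
Qed.

End Cutoffs.

#[local] Opaque bump.

(** * The flux of a tangential field *)

Section Tangential.
Variables (R : realType) (B : set (E3 R)).
Hypothesis oB : open B.

Lemma bdry_out x : bdry B x -> ~ B x.
Proof. by move: oB; rewrite openE => BB [_ nB] /BB. Qed.

Lemma bdry_intro x : closure B x -> ~ B x -> bdry B x.
Proof. by move=> cx nB; split => // /interior_subset. Qed.

Lemma bdry_closure x : bdry B x -> closure B x.
Proof. by case. Qed.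

(** Without a boundary point on the segment, the parameters whose image lies in B would form an open
    and closed part of [a, b], which is connected. *)
Lemma bdry_crossing (x w : E3 R) (a b : R) : a <= b ->
  B (x + a *: w) -> ~ B (x + b *: w) ->
  exists2 s, a <= s <= b & bdry B (x + s *: w).
Proof.
move=> ab Ba Bb.
have [//|no] := pselect (exists2 s, a <= s <= b & bdry B (x + s *: w)).
exfalso; apply: Bb.
have C : connected `[a, b]%classic by exact: segment_connected.
pose gam (s : R) := x + s *: w.
have cg : continuous gam by move=> s; exact: continuous_line.
have E : `[a, b]%classic `&` gam @^-1` B = `[a, b]%classic.
  apply: C.
  - by exists a; split => //=; rewrite in_itv/= lexx.
  - by exists (gam @^-1` B) => //; apply: open_comp => // s _; exact: cg.
  - exists (gam @^-1` closure B).
      by apply: preimage_closed => [s _|]; [exact: cg|exact: closed_closure].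
    apply/seteqP; split => s [sab Bs]; split => //.
      exact: subset_closure.
    apply: contrapT => nB; apply: no; exists s; first by rewrite /= in_itv in sab.
    exact: bdry_intro.
have : `[a, b]%classic b by rewrite /= in_itv/= ab lexx.
by rewrite -E => -[].
Qed.

(* Moving from p by eps * v and then by s * grad g with s = o(eps), one meets the boundary again
   (bdry_crossing): there f is equal to f p. *)
Lemma tangential_derivative p (g f : E3 R -> R) (v : E3 R) :
  bdry B p -> local_defining_function B p g ->
  \sum_j v 0 j * 'D_(axis R j) g p = 0 ->
  (\forall y \near p, forall j, derivable f y (axis R j)) ->
  (forall j, {for p, continuous (fun y => 'D_(axis R j) f y)}) ->
  (\forall y \near p, bdry B y -> f y = f p) ->
  \sum_j 'D_(axis R j) f p * v 0 j = 0.
Proof.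
move=> bp [U [oU Up sg ng BU]] vg df cdf fp.
pose w : E3 R := \row_j 'D_(axis R j) g p.
have wE j : w 0 j = 'D_(axis R j) g p by rewrite mxE.
(* As a limit of points of B, where g < 0, p cannot satisfy g p > 0; and g p < 0 would put p in
   B. *)
have gp : g p = 0.
  have cg : {for p, continuous g} by have [] := sg [::] p Up.
  apply/eqP; rewrite eq_le; apply/andP; split.
    rewrite leNgt; apply/negP => gp.
    have : \forall y \near p, 0 < g y /\ U y.
      apply: filterI; last exact: open_nbhs_nbhs.
      by move: cg => /cvgr_gt; apply.
    move/(bdry_closure bp) => [y [By [gy Uy]]].
    have : (B `&` U) y by [].
    by rewrite BU => -[/=]; lra.
  rewrite leNgt; apply/negP => gp.
  have : ([set x | g x < 0] `&` U) p by [].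
  by rewrite -BU => -[/(bdry_out bp)].
have A0 : 0 < \sum_j w 0 j * w 0 j.
  rewrite lt_neqAle eq_sym; apply/andP; split; last by apply: sumr_ge0 => j _; rewrite -expr2 sqr_ge0.
  move: ng; apply: contra => /eqP A0.
  rewrite /grad_norm (_ : \sum_j _ = 0) ?sqrtr0// -[RHS]A0.
  by apply: eq_bigr => j _; rewrite wE expr2.
set A := \sum_j w 0 j * w 0 j in A0.
set L := \sum_j _; pose Fw := \sum_j 'D_(axis R j) f p * w 0 j.
pose N := `|v| + `|w|.
have N0 : 0 <= N by rewrite addr_ge0.
(* The transversal displacement is bounded by d eps; the claim L = 0 follows as d tends to 0. *)
suff H d : 0 < d -> d <= 1 -> `|L| <= d * (`|Fw| + N).
  apply/eqP; rewrite -normr_le0; apply/ler_addgt0Pl => e e0; rewrite addr0.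
  pose d := Num.min 1 (e / (`|Fw| + N + 1)).
  have K0 : 0 < `|Fw| + N + 1 by rewrite ltr_wpDl// addr_ge0.
  have d0 : 0 < d by rewrite lt_min ltr01 divr_gt0.
  have d1 : d <= 1 by rewrite ge_min lexx.
  apply: le_trans (H d d0 d1) _.
  have : d <= e / (`|Fw| + N + 1) by rewrite ge_min lexx orbT.
  rewrite ler_pdivlMr// => h.
  have : d * (`|Fw| + N + 1) = d * (`|Fw| + N) + d by ring.
  lra.
move=> d0 d1.
have dg : \forall y \near p, forall j, derivable g y (axis R j).
  by apply: filterS (open_nbhs_nbhs (conj oU Up)) => y Uy j; have [_] := sg [::] y Uy; apply.
have cdg j : {for p, continuous (fun y => 'D_(axis R j) g y)} by have [] := sg [:: j] p Up.
(* With this tolerance the first-order error of g stays below d eps A, the change of g under a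
   displacement d eps along its gradient. Hence g has opposite signs for s = - d eps and s = d
   eps. *)
pose e1 := d * A / (2 * (N + 1)).
have e10 : 0 < e1 by rewrite divr_gt0// ?mulr_gt0//; lra.
have [r1 r10 Hg] := first_order dg cdg e10.
have [r2 r20 Hf] := first_order df cdf d0.
have /nbhs_ballP[r3 /= r30 HU] : nbhs p U by exact: open_nbhs_nbhs.
have /nbhs_ballP[r4 /= r40 Hfp] := fp.
pose r := Num.min (Num.min r1 r2) (Num.min r3 r4).
have r0 : 0 < r by rewrite !lt_min r10 r20 r30.
have N1 : 0 < 2 * (N + 1) by lra.
have [eps eps0 epsN] : exists2 eps : R, 0 < eps & eps * N < r.
  exists (r / (2 * (N + 1))); first by rewrite divr_gt0.
  by rewrite mulrAC ltr_pdivrMr// ltr_pM2l//; lra.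
have small s : `|s| <= d * eps -> `|eps *: v + s *: w| <= eps * N.
  move=> sd; apply: le_trans (ler_normD _ _) _; rewrite !normrZ (gtr0_norm eps0) mulrDr.
  by rewrite lerD2l ler_wpM2r// (le_trans sd)// ler_piMl// ltW.
have lin F s : \sum_j F j * (eps *: v + s *: w) 0 j =
    eps * (\sum_j F j * v 0 j) + s * (\sum_j F j * w 0 j).
  rewrite !mulr_sumr -big_split/=; apply: eq_bigr => j _; rewrite !mxE; ring.
have vg' : \sum_j 'D_(axis R j) g p * v 0 j = 0.
  by rewrite -[RHS]vg; apply: eq_bigr => j _; rewrite mulrC.
have wg : \sum_j 'D_(axis R j) g p * w 0 j = A.
  by apply: eq_bigr => j _; rewrite wE.
have gs s : `|s| <= d * eps -> `|g (p + (eps *: v + s *: w)) - s * A| <= e1 * (eps * N).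
  move=> sd; have sN := small _ sd.
  have lr1 : `|eps *: v + s *: w| < r1.
    by apply: le_lt_trans sN (lt_le_trans epsN _); rewrite /r !ge_min lexx.
  have := Hg _ lr1; rewrite lin vg' wg gp mulr0 add0r subr0 => /le_trans; apply.
  by rewrite ler_wpM2l// ltW.
have fs s : `|s| <= d * eps -> `|f (p + (eps *: v + s *: w)) - f p - (eps * L + s * Fw)| <= d * (eps * N).
  move=> sd; have sN := small _ sd.
  have lr2 : `|eps *: v + s *: w| < r2.
    by apply: le_lt_trans sN (lt_le_trans epsN _); rewrite /r !ge_min lexx !orbT.
  have := Hf _ lr2; rewrite lin => /le_trans; apply.
  by rewrite ler_wpM2l// ltW.
have inb s rr : `|s| <= d * eps -> r <= rr -> ball p rr (p + (eps *: v + s *: w)).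
  move=> sd rrr; have rr0 : 0 < rr by exact: lt_le_trans rrr.
  apply/(ball_rV _ _ rr0) => j; rewrite mxE opprD addNKr normrN.
  by apply: le_lt_trans (norm_coord _ _) (le_lt_trans (small _ sd) (lt_le_trans epsN rrr)).
have inU s : `|s| <= d * eps -> U (p + (eps *: v + s *: w)).
  by move=> sd; apply: HU; apply: inb => //; rewrite /r !ge_min lexx !orbT.
have de0 : 0 < d * eps by rewrite mulr_gt0.
have e1N : e1 * (eps * N) < d * eps * A.
  have E : e1 * (2 * (N + 1)) = d * A by rewrite /e1 divfK// gt_eqF.
  have : e1 * (2 * (N + 1)) = 2 * (e1 * N) + 2 * e1 by ring.
  have : 0 <= e1 * N by rewrite mulr_ge0// ltW.
  move=> h1 h2; have h3 : e1 * N < d * A by lra.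
  rewrite (_ : e1 * (eps * N) = eps * (e1 * N)); last by ring.
  by rewrite (_ : d * eps * A = eps * (d * A)) ?ltr_pM2l//; ring.
have asc s : p + (eps *: v + s *: w) = (p + eps *: v) + s *: w by rewrite addrA.
have [s sde bs] : exists2 s, - (d * eps) <= s <= d * eps & bdry B (p + eps *: v + s *: w).
  apply: bdry_crossing; first by lra.
  - have nd : `|- (d * eps)| <= d * eps by rewrite normrN gtr0_norm.
    rewrite -asc; have : ([set x | g x < 0] `&` U) (p + (eps *: v + - (d * eps) *: w)).
      split; last exact: inU.
      have := gs _ nd; rewrite ler_norml => /andP[_] /=; rewrite mulNr; lra.
    by rewrite -BU => -[].
  - have nd : `|d * eps| <= d * eps by rewrite gtr0_norm.
    rewrite -asc => Bx; have : (B `&` U) (p + (eps *: v + (d * eps) *: w)) by split => //; exact: inU.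
    rewrite BU => -[/= + _].
    have := gs _ nd; rewrite ler_norml => /andP[+ _]; lra.
have ns : `|s| <= d * eps by rewrite ler_norml.
have fb : f (p + (eps *: v + s *: w)) = f p.
  apply: Hfp; last by rewrite asc.
  by apply: inb => //; rewrite /r !ge_min lexx !orbT.
have := fs _ ns; rewrite fb subrr sub0r normrN => h.
have : `|eps * L| <= d * (eps * N) + d * eps * `|Fw|.
  have -> : eps * L = (eps * L + s * Fw) - s * Fw by ring.
  apply: le_trans (ler_normB _ _) _; apply: lerD => //.
  by rewrite normrM ler_wpM2r.
rewrite normrM gtr0_norm// => h2.
rewrite -(ler_pM2l eps0); apply: le_trans h2 _.
by rewrite le_eqVlt; apply/orP; left; apply/eqP; ring.
Qed.

End Tangential.

Section Flux.
Variables (R : realType) (B : set (E3 R)) (n : E3 R -> E3 R).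
Hypotheses (hB : smooth_bounded_region B) (hn : outward_unit_normal B n).

Let oB : open B. Proof. by case: hB. Qed.
Let bB : bounded_set B. Proof. by case: hB. Qed.
Let BD : B `<=` closure B. Proof. exact: subset_closure. Qed.
Let DB : closure B `<=` closure B. Proof. by []. Qed.
Let BB : B `<=` B. Proof. by []. Qed.

Implicit Types (f : E3 R -> R) (x p : E3 R).

Local Notation C := (Ck B (closure B)).
Local Notation Co := (Ck B B).

Lemma closure_bounded : bounded_set (closure B).
Proof.
have [M M0 BM] := bounded_ball bB.
have cl : closed [set x : E3 R | `|x| <= M].
  have -> : [set x : E3 R | `|x| <= M] = Num.norm @^-1` [set y | y <= M] by [].
  by apply: preimage_closed => [x _|]; [exact: norm_continuous|exact: closed_le].
have : closure B `<=` [set x : E3 R | `|x| <= M].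
  rewrite closureE => x; apply; split => // y /BM /=.
  by rewrite -ball_normE /ball_/= sub0r normrN => /ltW.
move=> BM2; exists M; split; first exact: num_real.
by move=> K MK x /BM2 /= h; apply: le_trans h (ltW MK).
Qed.

Lemma closure_compact : compact (closure B).
Proof. by apply: bounded_closed_compact; [exact: closure_bounded|exact: closed_closure]. Qed.

Lemma C_Co k f : C k f -> Co k f.
Proof.
elim: k f => [|k IH] f Cf.
  by apply: Ck0; apply: continuous_subspaceW BD _; exact: Ck_continuous Cf.
apply: CkS; first by apply: continuous_subspaceW BD _; exact: Ck_continuous Cf.
  by move=> j x Bx; exact: Ck_derivable Cf Bx.
by move=> j; apply: IH; exact: Ck_pd.
Qed.

Lemma C_bc k f : C k f -> bounded_continuous B f.
Proof.
move=> Cf; have cf := Ck_continuous Cf; split.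
  by apply/(within_openP _ oB); apply: continuous_subspaceW BD _.
have := continuous_compact cf closure_compact => /compact_bounded[M [_ HM]].
exists (M + 1) => x Bx; apply: HM; first by rewrite ltrDl.
by exists x => //; exact: BD.
Qed.

Lemma compact_bc K f : closed K -> K `<=` B ->
  (forall x, B x -> {for x, continuous f}) -> (forall x, B x -> ~ K x -> f x = 0) ->
  bounded_continuous B f.
Proof.
move=> cK KB cf f0; split => //.
have kK : compact K by apply: subclosed_compact cK closure_compact _ => x /KB/BD.
have cfK : {within K, continuous f}.
  by apply/within_continuousP => x Kx; apply: cvg_within_filter; apply: cf; exact: KB.
have := continuous_compact cfK kK => /compact_bounded[M [_ HM]].
exists (`|M| + 1) => x Bx; have [Kx|Kx] := pselect (K x).
  by apply: HM; [rewrite ltr_pwDr// ler_norm|exists x].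
by rewrite f0// normr0 addr_ge0.
Qed.

Lemma Co_continuous_at k f x : Co k f -> B x -> {for x, continuous f}.
Proof. by move=> Cf; have /(within_openP _ oB) := Ck_continuous Cf; apply. Qed.

Lemma near_zero_outside (K : set (E3 R)) f x : closed K -> B x -> ~ K x ->
  (forall y, B y -> ~ K y -> f y = 0) -> \forall y \near x, f y = 0.
Proof.
move=> cK Bx Kx f0.
have : \forall y \near x, B y /\ ~ K y.
  apply: filterI; first exact: near_body.
  by apply: open_nbhs_nbhs; split => //; exact: closed_openC.
by apply: filterS => y [By Ky]; exact: f0.
Qed.

Lemma pd_zero_outside (K : set (E3 R)) f (j : 'I_3) x : closed K -> B x -> ~ K x ->
  (forall y, B y -> ~ K y -> f y = 0) -> pd B j f x = 0.
Proof.
move=> cK Bx Kx f0; rewrite pd_in//.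
have E : \forall y \near x, cst 0 y = f y.
  by have := near_zero_outside cK Bx Kx f0; apply: filterS => y ->.
suff [_ ->] : is_derive x (axis R j) f 0 by [].
exact: (@is_derive_near_eq _ (cst 0) f x (axis R j) 0 E).
Qed.

Lemma vint_pd_compact K f (j : 'I_3) : closed K -> K `<=` B -> Co 1 f ->
  (forall x, B x -> ~ K x -> f x = 0) ->
  bounded_continuous B (pd B j f) /\ vint B (pd B j f) = 0.
Proof.
move=> cK KB Cf f0.
have b : bounded_continuous B (pd B j f).
  apply: (compact_bc cK KB).
    by move=> x Bx; exact: Co_continuous_at (Ck_pd j Cf) Bx.
  by move=> x Bx Kx; exact: pd_zero_outside cK Bx Kx f0.
split=> //.
have E x : B x -> pd B j f x = 'D_(axis R j) f x by move=> Bx; rewrite pd_in.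
rewrite (vint_ext E); apply: (vint_derive_compact oB bB cK KB) => //.
  by move=> x Bx; exact: Ck_derivable Cf Bx.
by apply: bc_ext b => //.
Qed.

Definition tangential (X : 'I_3 -> E3 R -> R) : Prop :=
  forall p, bdry B p -> \sum_j X j p * n p 0 j = 0.

Lemma tangential_scale c X : tangential X -> tangential (fun j x => c x * X j x).
Proof.
move=> tX p bp; transitivity (c p * \sum_j X j p * n p 0 j).
  by rewrite mulr_sumr; apply: eq_bigr => j _; rewrite mulrA.
by rewrite tX// mulr0.
Qed.

(** The local form of the claim, for fields that vanish where [bump p a] does. *)
Definition null_flux_near (p : E3 R) (a : R) : Prop :=
  forall Y : 'I_3 -> E3 R -> R, (forall j, C 1 (Y j)) -> tangential Y ->
  (forall x, B x -> 2 * a < dist2 p x -> forall j, Y j x = 0) ->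
  vint B (fun x => \sum_j pd B j (Y j) x) = 0.

Lemma null_flux_interior p : B p -> exists2 a, 0 < a & null_flux_near p a.
Proof.
move=> Bp; have /nbhs_ballP[e /= e0 eB] := near_body oB Bp.
have ee : 0 < e * e by rewrite mulr_gt0.
exists (e * e / 4); first by rewrite divr_gt0.
move=> Y CY _ Y0.
have KB : [set x | dist2 p x <= 2 * (e * e / 4)] `<=` B.
  by move=> x /= h; apply: eB; apply: dist2_ball => //; apply: le_lt_trans h _; lra.
have H j : bounded_continuous B (pd B j (Y j)) /\ vint B (pd B j (Y j)) = 0.
  apply: (vint_pd_compact j (closed_dist2 (p := p) (c := _)) KB); first exact: C_Co.
  by move=> x Bx /= /negP; rewrite -ltNge => h; exact: Y0.
rewrite (vint_sum oB bB (fun j => (H j).1)) big1// => j _.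
exact: (H j).2.
Qed.

(** Induction on the centres of a finite cover. Multiplication by [bump] and by 1 - [bump] keeps a
    field tangential; the first part falls under the local claim, and the second vanishes near the
    current centre too. No partition of unity has to be normalised. *)
Lemma null_flux_global : (forall p, closure B p -> exists2 a, 0 < a & null_flux_near p a) ->
  forall X : 'I_3 -> E3 R -> R, (forall j, C 1 (X j)) -> tangential X ->
  vint B (fun x => \sum_j pd B j (X j) x) = 0.
Proof.
move=> loc.
have loc' p : exists a, closure B p -> 0 < a /\ null_flux_near p a.
  have [/loc[a a0 h]|] := pselect (closure B p); last by exists 0.
  by exists a.
have [a /= Ha] := choice loc'.
have [s [sC cov]] := compact_dist2_cover closure_compact (fun p Cp => (Ha p Cp).1).
suff H : forall X : 'I_3 -> E3 R -> R, (forall j, C 1 (X j)) -> tangential X ->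
    (forall x, B x -> (forall p, p \in s -> a p <= dist2 p x) -> forall j, X j x = 0) ->
    vint B (fun x => \sum_j pd B j (X j) x) = 0.
  move=> X CX tX; apply: H => // x Bx h.
  have [p ps] := cov x (BD Bx).
  by rewrite ltNge h.
elim: s sC {cov} => [|p s IH] sC X CX tX X0.
  rewrite -[RHS](vint0 oB bB); apply: vint_ext => x Bx; rewrite big1// => j _.
  rewrite -[RHS](pd_cst oB BD DB 0 j (BD Bx)); apply: (pd_ext oB) => y By.
  by apply: X0.
have [a0 ap] := Ha p (sC p (mem_head _ _)).
have Cb : C 1 (bump p (a p)) by apply: CkW; exact: (Ck_bump oB BD DB).
have Cb' : C 1 (fun x => 1 - bump p (a p) x) by exact: (CkB oB BD DB (Ck_cst oB BD DB 1 1) Cb).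
pose X1 j x := bump p (a p) x * X j x.
pose X2 j x := (1 - bump p (a p) x) * X j x.
have C1 j : C 1 (X1 j) by exact: (CkM oB BD DB Cb (CX j)).
have C2 j : C 1 (X2 j) by exact: (CkM oB BD DB Cb' (CX j)).
have E x : B x -> \sum_j pd B j (X j) x = \sum_j pd B j (X1 j) x + \sum_j pd B j (X2 j) x.
  move=> Bx; rewrite -big_split/=; apply: eq_bigr => j _.
  rewrite -(pdD oB BD DB j (C1 j) (C2 j) (BD Bx)); apply: (pd_ext oB) => y _.
  by rewrite /X1 /X2; ring.
have b Y : (forall j, C 1 (Y j)) -> bounded_continuous B (fun x => \sum_j pd B j (Y j) x).
  by move=> CY; apply: (bc_sum oB) => j; exact: C_bc (Ck_pd j (CY j)).
rewrite (vint_ext E) (vintD oB bB (b _ C1) (b _ C2)).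
have -> : vint B (fun x => \sum_j pd B j (X1 j) x) = 0.
  apply: ap => //.
    exact: (tangential_scale (bump p (a p)) tX).
  by move=> x _ h j; rewrite /X1 bump0 ?mul0r// ltW.
rewrite add0r; apply: IH => //.
- by move=> q qs; apply: sC; rewrite inE qs orbT.
- exact: (tangential_scale (fun x => 1 - bump p (a p) x) tX).
- move=> x Bx h j; rewrite /X2; have [ha|ha] := leP (a p) (dist2 p x).
    rewrite X0 ?mulr0// => q; rewrite inE => /predU1P[->//|]; exact: h.
  by rewrite bump1 ?subrr ?mul0r// ltW.
Qed.

(** The defining function that yields the normal at p may differ from the one in use elsewhere. The
    conclusion holds for every regular f constant on the boundary near p: below, another defining
    function, and |n|^2. *)
Lemma grad_tangential p f (v : 'I_3 -> R) : bdry B p ->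
  (\forall y \near p, forall j, derivable f y (axis R j)) ->
  (forall j, {for p, continuous (fun y => 'D_(axis R j) f y)}) ->
  (\forall y \near p, bdry B y -> f y = f p) ->
  \sum_j v j * n p 0 j = 0 -> \sum_j 'D_(axis R j) f p * v j = 0.
Proof.
move=> bp df cf fp vn; have [g lg ng] := hn.2 p bp.
have gn : grad_norm g p != 0 by case: lg => U [].
transitivity (\sum_j 'D_(axis R j) f p * (\row_j v j : E3 R) 0 j).
  by apply: eq_bigr => j _; rewrite mxE.
apply: (tangential_derivative oB bp lg) => //.
transitivity (grad_norm g p * \sum_j v j * n p 0 j); last by rewrite vn mulr0.
rewrite mulr_sumr; apply: eq_bigr => j _; rewrite mxE ng; field; exact: gn.
Qed.

(** F is controlled on U only. Off K the product is zero, and the open sets B minus K and B meet U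
    cover B. *)
Lemma Co_mul_local U (K : set (E3 R)) k F f : open U -> closed K -> K `<=` U ->
  Ck U U k F -> Co k f -> (forall x, B x -> ~ K x -> f x = 0) -> Co k (fun x => F x * f x).
Proof.
move=> oU cK KU CF Cf f0.
have cl (A : set (E3 R)) : A `<=` closure A by exact: subset_closure.
have o1 : open (B `&` U) by exact: openI.
have o2 : open (B `&` ~` K) by apply: openI => //; exact: closed_openC.
have E : B = (B `&` U) `|` (B `&` ~` K).
  apply/seteqP; split => [x Bx|x [[]|[]]//].
  by have [Kx|Kx] := pselect (K x); [left; split => //; exact: KU|right].
have : Ck ((B `&` U) `|` (B `&` ~` K)) ((B `&` U) `|` (B `&` ~` K)) k (fun x => F x * f x).
  apply: Ck_glue => //.
    apply: (CkM o1 (@subset_refl _ _) (cl _)).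
      by apply: (Ck_restrict oU o1 (@subset_refl _ _) (cl _)) CF => x [].
    by apply: (Ck_restrict oB o1 (@subset_refl _ _) (cl _)) Cf => x [].
  apply: (Ck_ext o2 (@subset_refl _ _) (cl _)) (Ck_cst o2 (@subset_refl _ _) (cl _) k 0).
  by move=> x [Bx Kx]; rewrite f0// mulr0.
by rewrite -E.
Qed.

Lemma pd_mul_local U k F f (j : 'I_3) x : Ck U U k.+1 F -> Co k.+1 f -> B x -> U x ->
  pd B j (fun x => F x * f x) x = pd U j F x * f x + F x * pd B j f x.
Proof.
move=> CF Cf Bx Ux; rewrite (pd_in j (fun x => F x * f x) Bx).
by have [_ ->] := is_derive_mul (Ck_is_derive j CF Ux) (Ck_is_derive j Cf Bx).
Qed.

Lemma null_flux_boundary p : bdry B p -> exists2 a, 0 < a & null_flux_near p a.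
Proof.
move=> bp; have [_ _ _ /(_ p bp)[g [U [oU Up sg ng BU]]]] := hB.
have cl (A : set (E3 R)) : A `<=` closure A by exact: subset_closure.
have rf (A : set (E3 R)) : A `<=` A by [].
have Cg : Ck U U 2 g by exact: smooth_on_Ck.
have cgU x : U x -> {for x, continuous g} by move=> Ux; have [] := sg [::] x Ux.
have cdg j x : U x -> {for x, continuous (fun y => 'D_(axis R j) g y)}.
  by move=> Ux; have [] := sg [:: j] x Ux.
have gneg x : B x -> U x -> g x < 0.
  by move=> Bx Ux; have : (B `&` U) x by []; rewrite BU => -[].
have gB x : U x -> g x < 0 -> B x.
  by move=> Ux gx; have : ([set x | g x < 0] `&` U) x by []; rewrite -BU => -[].
have [k gk] : exists k, 'D_(axis R k) g p != 0.
  apply: contrapT => no; move/negP: ng; apply; rewrite /grad_norm big1 ?sqrtr0// => j _.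
  by apply/eqP; rewrite expf_eq0/=; apply: contrapT => /negP h; apply: no; exists j.
(* The axis k is transversal to the boundary at p; the sign [sgm] and the lower bound c make this
   quantitative near p. *)
have [sgm [sgm1 sgmk]] : exists sgm : R, sgm * sgm = 1 /\ 0 < sgm * 'D_(axis R k) g p.
  have [h|h|h] := ltgtP 0 ('D_(axis R k) g p).
  - by exists 1; rewrite !mul1r.
  - by exists (-1); split; [rewrite mulrNN mulr1|rewrite mulN1r oppr_gt0].
  - by move: gk; rewrite -h eqxx.
pose c := sgm * 'D_(axis R k) g p / 2.
have c0 : 0 < c by rewrite divr_gt0.
have : \forall y \near p, U y /\ c < sgm * 'D_(axis R k) g y.
  apply: filterI; first exact: open_nbhs_nbhs.
  have : {for p, continuous (fun y : E3 R => sgm * 'D_(axis R k) g y)}.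
    by apply: continuousM; [exact: cst_continuous|exact: cdg].
  by move=> /cvgr_gt; apply; rewrite /c; lra.
move=> /nbhs_ballP[e /= e0 eU].
have ee : 0 < e * e by rewrite mulr_gt0.
(* Y lives on dist2 <= 2 a and the auxiliary cutoff [psi] on dist2 <= 4 a; both regions must lie in
   the ball of radius e. *)
pose a := e * e / 8.
have a0 : 0 < a by rewrite divr_gt0.
have a4 : 4 * a < e * e by rewrite /a; lra.
clearbody a; exists a => // Y CY tY Y0.
have inb x : dist2 p x <= 4 * a -> U x /\ c < sgm * 'D_(axis R k) g x.
  by move=> h; apply: eU; apply: dist2_ball => //; exact: le_lt_trans h a4.
pose K := [set x | dist2 p x <= 2 * a]; pose K4 := [set x | dist2 p x <= 4 * a].
have cK : closed K by exact: closed_dist2.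
have cK4 : closed K4 by exact: closed_dist2.
have KK4 : K `<=` K4.
  by move=> x; rewrite /K /K4 /= => h; apply: le_trans h _; rewrite ler_pM2r// ler_nat.
have K4U : K4 `<=` U by move=> x /= h; exact: (inb _ h).1.
have KU : K `<=` U by move=> x /KK4/K4U.
have YK j x : B x -> ~ K x -> Y j x = 0.
  by move=> Bx /= /negP; rewrite -ltNge => h; exact: Y0.
pose gY x := \sum_j 'D_(axis R j) g x * Y j x.
pose div x := \sum_j pd B j (Y j) x.
have bdiv : bounded_continuous B div.
  by apply: (bc_sum oB) => j; exact: C_bc (Ck_pd j (CY j)).
(* Equal to 1 where Y may be nonzero; multiplied by the k-th axis vector it is the field with which
   Y is compared. *)
pose psi := bump p (2 * a).
have Cpsi : C 2 psi by exact: (Ck_bump oB BD DB).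
have psi0 x : B x -> ~ K4 x -> psi x = 0.
  by move=> _ /= /negP; rewrite -ltNge => h; apply: bump0; lra.
have psi1 x : dist2 p x <= 2 * a -> psi x = 1 by move=> h; apply: bump1; lra.
have bpsi : bounded_continuous B (fun x => `|pd B k psi x|).
  by apply: bc_norm; exact: C_bc (Ck_pd k Cpsi).
pose M := vint B (fun x => `|pd B k psi x|).
have M0 : 0 <= M by apply: vint_ge0 => x _.
(* Equal to 0 for - g <= eps and to 1 for - g >= 4 eps, so that the layer in which it varies stays
   away from the boundary. *)
pose he (eps : R) x := step (- eps^-1 * g x - 1).
(* gY = grad g . Y vanishes on the boundary, hence is small in the layer - m <= g < 0. *)
have small d : 0 < d -> exists2 m, 0 < m &
    forall x, B x -> dist2 p x <= 2 * a -> - g x <= m -> `|gY x| <= d.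
  move=> d0; pose CK := closure B `&` K.
  have kCK : compact CK.
    apply: subclosed_compact closure_compact _; last by move=> x [].
    by apply: closedI => //; exact: closed_closure.
  have gcl x : CK x -> g x <= 0 /\ (g x = 0 -> bdry B x).
    move=> [cx /KU Ux]; split; last first.
      by move=> gx; apply: bdry_intro => // /(gneg x)/(_ Ux); rewrite gx ltxx.
    rewrite leNgt; apply/negP => gx.
    have : \forall y \near x, 0 < g y /\ U y.
      apply: filterI; last exact: open_nbhs_nbhs.
      by move: (cgU x Ux) => /cvgr_gt; apply.
    by move/cx => [y [By [gy Uy]]]; have := gneg y By Uy; lra.
  have gY0 x : CK x -> g x = 0 -> gY x = 0.
    move=> Cx gx; have bx := (gcl x Cx).2 gx; have Ux := KU _ Cx.2.
    apply: (grad_tangential (f := g) (v := fun j => Y j x) bx).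
    - by apply: filterS (open_nbhs_nbhs (conj oU Ux)) => y Uy j; have [_] := sg [::] y Uy; apply.
    - by move=> j; exact: cdg.
    - have : \forall y \near x, 4 * a > dist2 p y /\ U y.
        apply: filterI; last exact: open_nbhs_nbhs.
        have := @continuous_dist2 R p x => /cvgr_lt; apply.
        by have := Cx.2; rewrite /K/=; lra.
      apply: filterS => y [_ Uy] byy; rewrite gx; apply/eqP; rewrite eq_le; apply/andP; split.
        rewrite leNgt; apply/negP => gy.
        have : \forall z \near y, 0 < g z /\ U z.
          apply: filterI; last exact: open_nbhs_nbhs.
          by move: (cgU y Uy) => /cvgr_gt; apply.
        by move/(bdry_closure byy) => [z [Bz [gz Uz]]]; have := gneg z Bz Uz; lra.
      by rewrite leNgt; apply/negP => /(gB y Uy); exact: bdry_out.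
    - exact: tY.
  have cgY : {within CK, continuous gY}.
    have cU (h : E3 R -> R) : (forall x, U x -> {for x, continuous h}) -> {within CK, continuous h}.
      by move=> ch; apply/within_continuousP => x Cx; apply: cvg_within_filter; apply: ch; exact: KU Cx.2.
    have H (s : seq 'I_3) : {within CK, continuous (fun x => \sum_(j <- s) 'D_(axis R j) g x * Y j x)}.
      elim: s => [|j s IHs].
        rewrite (_ : (fun x => _) = fun=> 0); last by apply/funext => x; rewrite big_nil.
        by apply: continuousP_within; exact: cst_continuous.
      rewrite (_ : (fun x => _) = fun x => 'D_(axis R j) g x * Y j x + \sum_(i <- s) 'D_(axis R i) g x * Y i x); last by apply/funext => x; rewrite big_cons.
      apply: withinD => //; apply: withinM; first by apply: cU => x; exact: cdg.
      by apply: continuous_subspaceW (Ck_continuous (CY j)) => x [].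
    exact: H.
  have [[x0 Cx0]|] := pselect (CK !=set0); last first.
    by move=> no; exists 1 => // x Bx h; exfalso; apply: no; exists x; split => //; exact: BD.
  (* Positive on the compact set [CK], as gY = 0 where g = 0. Where |gY| > d the second term is 0,
     so the minimum of [th] bounds - g from below there. *)
  pose th x := - g x + pos (d - `|gY x|).
  have cth : {within CK, continuous th}.
    apply: withinD.
      apply/within_continuousP => x Cx; apply: cvg_within_filter; apply: cvgN.
      by apply: cgU; exact: KU Cx.2.
    apply: (within_comp1 (h := @pos R)); first exact: continuous_pos.
    apply: (within_comp1 (h := fun y : R => d - `|y|)) cgY => y.
    by apply: cvgB; [exact: cvg_cst|exact: norm_continuous].
  have [y /set_mem Cy ymin] := EVT_min_rV (ex_intro _ x0 Cx0) kCK cth.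
  have ty : 0 < th y.
    have [gy gy0] := gcl y Cy; rewrite /th.
    have := pos_ge0 (d - `|gY y|); move: gy; rewrite le_eqVlt => /predU1P[gy|gy]; last by lra.
    by rewrite (gY0 y Cy gy) gy normr0 subr0 oppr0 add0r pos_r// ltW.
  exists (th y / 2); first by rewrite divr_gt0.
  move=> x Bx hx gx; have Cx : CK x by split => //; exact: BD.
  have := ymin x (mem_set Cx); rewrite /th -/(th y) => h.
  rewrite leNgt; apply/negP => hd; move: h; rewrite pos_l; lra.
(* Cutting Y off by step (- g / eps - 1) leaves the error Be, dominated by d / c times the field
   T1 >= 0, whose integral is bounded independently of eps by an integration by parts in the
   direction k, which is transversal to the boundary. *)
have key d m eps : 0 < d -> 0 < eps -> 4 * eps <= m ->
    (forall x, B x -> dist2 p x <= 2 * a -> - g x <= m -> `|gY x| <= d) ->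
    bounded_continuous B (fun x => he eps x * div x) /\
    `|vint B (fun x => he eps x * div x)| <= d / c * M.
  move=> d0 eps0 epsm Hm; pose F := he eps.
  have CF : Ck U U 1 F.
    apply: (Ck1_step oU (rf U) (cl U)); apply: (CkB oU (rf U) (cl U)).
      exact: (CkZ oU (rf U) (cl U) _ (CkW Cg)).
    exact: (Ck_cst oU (rf U) (cl U)).
  have pF j x : U x -> pd U j F x = step1 (- eps^-1 * g x - 1) * (- eps^-1 * 'D_(axis R j) g x).
    move=> Ux; rewrite pd_in//.
    have hg : is_derive x (axis R j) (fun x => - eps^-1 * g x - 1) (- eps^-1 * 'D_(axis R j) g x).
      have dg : is_derive x (axis R j) g ('D_(axis R j) g x).
        by apply/derivableP; have [_] := sg [::] x Ux; apply.
      have := is_deriveB (is_deriveZ (- eps^-1) dg) (is_derive_cst (1:R) x (axis R j)).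
      by move=> /is_derive_eq; apply; rewrite subr0.
    by have [_ ->] := is_derive_comp1 (is_derive_step (- eps^-1 * g x - 1)) hg.
  (* Closed, since g is continuous near K4, and contained in B. Outside it the products of F with Y
     and with [psi] vanish, so they can be integrated by parts without boundary terms. *)
  pose Ke := K4 `&` [set x | g x <= - eps].
  have cKe : closed Ke.
    move=> x cx; have K4x : K4 x.
      by apply: cK4 => N /cx[y [[]]] ? ? ?; exists y.
    split => //; rewrite /= leNgt; apply/negP => gx.
    have : \forall y \near x, - eps < g y.
      by move: (cgU x (K4U _ K4x)) => /cvgr_gt; apply.
    by move=> /cx[y [[_ /= h1] h2]]; move: h1; rewrite leNgt h2.
  have KeB : Ke `<=` B by move=> x [/K4U Ux /= gx]; apply: gB => //; lra.
  have y0 x : - eps < g x -> - eps^-1 * g x - 1 <= 0.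
    move=> h; have : eps^-1 * - g x <= eps^-1 * eps by rewrite ler_pM2l ?invr_gt0//; lra.
    rewrite mulVf ?gt_eqF// mulrN mulNr; lra.
  have F0 x : - eps < g x -> F x = 0 by move=> /y0 h; exact: (step_le0 h).1.
  have out f x : (forall x, B x -> ~ K4 x -> f x = 0) -> B x -> ~ Ke x -> F x * f x = 0.
    move=> f0 Bx nK; have [Kx|Kx] := pselect (K4 x); last by rewrite f0 ?mulr0.
    rewrite F0 ?mul0r// ltNge; apply/negP => h; exact: nK.
  have YK4 j x : B x -> ~ K4 x -> Y j x = 0.
    by move=> Bx K4x; apply: YK => // /KK4.
  have CoY j : Co 1 (Y j) := C_Co (CY j).
  have CZ j : Co 1 (fun x => F x * Y j x) by exact: (Co_mul_local oU cK KU CF (CoY j) (YK j)).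
  have VZ j := vint_pd_compact j cKe KeB (CZ j) (fun x => out (Y j) x (YK4 j)).
  pose Be x := - \sum_j pd U j F x * Y j x.
  have E1 x : B x -> F x * div x = \sum_j pd B j (fun x => F x * Y j x) x + Be x.
    move=> Bx; rewrite /Be /div mulr_sumr -sumrB; apply: eq_bigr => j _.
    have [Ux|Ux] := pselect (U x).
      by rewrite (pd_mul_local j CF (CoY j) Bx Ux); ring.
    have Kx : ~ K x by move=> /KU.
    rewrite (pd_zero_outside j cK Bx Kx (YK j)) (YK j x Bx Kx) !mulr0 subr0.
    by rewrite (pd_zero_outside (f := fun x => F x * Y j x) j cK Bx Kx)// => y By Ky; rewrite YK// mulr0.
  have cBe j : Co 0 (fun x => pd U j F x * Y j x).
    exact: (Co_mul_local oU cK KU (Ck_pd j CF) (CkW (CoY j)) (YK j)).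
  have outp j f x : (forall x, B x -> ~ K4 x -> f x = 0) -> B x -> ~ Ke x -> pd U j F x * f x = 0.
    move=> f0 Bx nK; have [Kx|Kx] := pselect (K4 x); last by rewrite f0 ?mulr0.
    rewrite pF; last exact: K4U.
    rewrite (step_le0 (y0 _ _)).2 ?mul0r// ltNge; apply/negP => h; exact: nK.
  have bpY j : bounded_continuous B (fun x => pd U j F x * Y j x).
    apply: (compact_bc cKe KeB); last by move=> x; apply: outp; exact: YK4.
    by move=> x Bx; exact: Co_continuous_at (cBe j) Bx.
  have bBe : bounded_continuous B Be by apply: (bc_opp oB); apply: (bc_sum oB).
  have bS : bounded_continuous B (fun x => \sum_j pd B j (fun x => F x * Y j x) x).
    by apply: (bc_sum oB) => j; exact: (VZ j).1.
  have bA : bounded_continuous B (fun x => F x * div x).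
    by apply: (bc_ext oB) (bc_add bS bBe) => x Bx; rewrite E1.
  split => //.
  have -> : vint B (fun x => F x * div x) = vint B Be.
    rewrite (vint_ext E1) (vintD oB bB bS bBe) (vint_sum oB bB (fun j => (VZ j).1)).
    by rewrite big1 ?add0r// => j _; exact: (VZ j).2.
  have Copsi : Co 1 psi := C_Co (CkW Cpsi).
  have CW : Co 1 (fun x => F x * psi x) by exact: (Co_mul_local oU cK4 K4U CF Copsi psi0).
  have [bW vW] := vint_pd_compact k cKe KeB CW (fun x => out psi x psi0).
  pose T1 x := - sgm * (pd U k F x * psi x).
  have bT1 : bounded_continuous B T1.
    apply: bc_mul; first exact: bc_cst.
    apply: (compact_bc cKe KeB); last by move=> x; exact: outp psi0.
    move=> x Bx; apply: (Co_continuous_at (k := 0)) Bx.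
    exact: (Co_mul_local oU cK4 K4U (Ck_pd k CF) (CkW Copsi) psi0).
  have E2 x : B x -> F x * pd B k psi x = pd B k (fun x => F x * psi x) x + sgm * T1 x.
    move=> Bx; rewrite /T1 mulrA mulrN sgm1 mulN1r.
    have [Ux|Ux] := pselect (U x).
      by rewrite (pd_mul_local k CF Copsi Bx Ux); ring.
    have Kx : ~ K4 x by move=> /K4U.
    rewrite (pd_zero_outside k cK4 Bx Kx psi0) (psi0 x Bx Kx) !mulr0 subr0.
    by rewrite (pd_zero_outside (f := fun x => F x * psi x) k cK4 Bx Kx)// => y By Ky; rewrite psi0// mulr0.
  have bT2 : bounded_continuous B (fun x => F x * pd B k psi x).
    apply: (bc_ext oB) (bc_add bW (bc_mul (bc_cst B sgm) bT1)) => x Bx; by rewrite E2.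
  have vT : vint B (fun x => F x * pd B k psi x) = sgm * vint B T1.
    by rewrite (vint_ext E2) (vintD oB bB bW (bc_mul (bc_cst B sgm) bT1)) vW add0r (vintZ oB bB _ bT1).
  have vT1 : vint B T1 <= M.
    have -> : vint B T1 = sgm * vint B (fun x => F x * pd B k psi x) by rewrite vT mulrA sgm1 mul1r.
    have ns : `|sgm| = 1.
      by apply/eqP; rewrite -(eqrXn2 (n := 2))// ?expr1n -?normrX ?expr2 ?sgm1 ?normr1.
    apply: le_trans (ler_norm _) _; rewrite normrM ns mul1r.
    apply: le_trans (vint_norm oB bB bT2) _; apply: (vint_le oB bB (bc_norm bT2) bpsi) => x Bx.
    rewrite normrM -[leRHS]mul1r; apply: ler_pM => //.
    by have /andP[h1 h2] := step_itv (- eps^-1 * g x - 1); rewrite ger0_norm.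
  have dc0 : 0 < d / c by rewrite divr_gt0.
  have E3 x : B x -> `|Be x| <= d / c * T1 x.
    move=> Bx; pose st := step1 (- eps^-1 * g x - 1).
    have st0 : 0 <= st by exact: step1_ge0.
    have ei : 0 < eps^-1 by rewrite invr_gt0.
    have [Kx|Kx] := pselect (K x); last first.
      rewrite /Be big1 ?oppr0 ?normr0; last by move=> j _; rewrite YK// mulr0.
      apply: mulr_ge0; first exact: ltW.
      have [K4x|K4x] := pselect (K4 x); last by rewrite /T1 psi0// mulr0 mulr0.
      have [Ux cx] := inb x K4x; have /andP[p0 _] := bump_itv p (2 * a) x.
      have -> : T1 x = st * eps^-1 * (sgm * 'D_(axis R k) g x) * psi x.
        by rewrite /T1 pF// -/st; ring.
      have sD : 0 <= sgm * 'D_(axis R k) g x := ltW (lt_trans c0 cx).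
      exact: mulr_ge0 (mulr_ge0 (mulr_ge0 st0 (ltW ei)) sD) p0.
    have K4x : K4 x by exact: KK4.
    have [Ux cx] := inb x K4x.
    have -> : Be x = eps^-1 * st * gY x.
      rewrite /Be /gY mulr_sumr -sumrN; apply: eq_bigr => j _; rewrite pF// -/st; ring.
    have -> : T1 x = eps^-1 * st * (sgm * 'D_(axis R k) g x).
      rewrite /T1 psi1// pF// -/st; ring.
    have es : 0 <= eps^-1 * st by rewrite mulr_ge0// ltW.
    rewrite normrM (ger0_norm es) [leRHS]mulrCA.
    (* Only the part of the layer with - g < 4 eps <= m contributes. There |gY| <= d, and d is at
       most d / c times the transversal derivative. *)
    have [h3|h3] := leP 3 (- eps^-1 * g x - 1).
      by rewrite /st (step_ge3 h3).2 mulr0 !mul0r.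
    apply: ler_wpM2l => //.
    apply: (@le_trans _ _ d).
      apply: Hm => //.
      have : eps * (eps^-1 * - g x) < eps * 4.
        by rewrite ltr_pM2l// mulrN; move: h3; rewrite mulNr; lra.
      rewrite mulrA mulfV ?gt_eqF// mul1r; lra.
    have : d / c * c <= d / c * (sgm * 'D_(axis R k) g x) by rewrite ler_pM2l// ltW.
    by rewrite divfK// gt_eqF.
  apply: le_trans (vint_norm oB bB bBe) _.
  apply: le_trans (vint_le oB bB (bc_norm bBe) (bc_mul (bc_cst B (d / c)) bT1) E3) _.
  by rewrite (vintZ oB bB _ bT1) ler_pM2l.
have bound d : 0 < d -> `|vint B div| <= d / c * M.
  move=> d0; have [m m0 Hm] := small d d0.
  (* Makes 4 eps_i = m / (i + 1), within the range of [key] and tending to 0. *)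
  pose eps (i : nat) := m / 4 * i.+1%:R^-1.
  have eps0 i : 0 < eps i by rewrite mulr_gt0// ?divr_gt0// invr_gt0.
  have Eeps i : 4 * eps i = m / i.+1%:R by rewrite /eps mulrA [4 * _]mulrC divfK// pnatr_eq0.
  have epsm i : 4 * eps i <= m.
    by rewrite Eeps ler_pdivrMr// ler_peMr ?ler1n// ltW.
  have [_ [Cd HCd]] := bdiv.
  have : vint B (fun x => he (eps i) x * div x) @[i --> \oo] --> vint B div.
    apply: (vint_cvg oB bB (C := Cd)) => //.
    - by move=> i; exact: (key d m (eps i) d0 (eps0 i) (epsm i) Hm).1.
    - move=> i x Bx; rewrite normrM -[leRHS]mul1r; apply: ler_pM => //; last exact: HCd.
      by have /andP[h1 h2] := step_itv (- (eps i)^-1 * g x - 1); rewrite ger0_norm.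
    - move=> x Bx; have [Ux|Ux] := pselect (U x); last first.
        have -> : div x = 0.
          by rewrite /div big1// => j _; apply: (pd_zero_outside j cK Bx _ (YK j)) => /KU.
        by under eq_fun do rewrite mulr0; exact: cvg_cst.
      have gx := gneg x Bx Ux.
      apply: cvg_near_cst; exists (Num.truncn (m / - g x)) => // i /= hi.
      rewrite /he (step_ge3 _).1 ?mul1r//.
      have h : 4 * eps i < - g x.
        rewrite Eeps ltr_pdivrMr// mulrC -ltr_pdivrMr ?oppr_gt0//.
        by apply: lt_le_trans (truncnS_gt _) _; rewrite ler_nat ltnS.
      have : (eps i)^-1 * (4 * eps i) < (eps i)^-1 * - g x by rewrite ltr_pM2l// invr_gt0.
      rewrite mulrCA mulVf ?gt_eqF// mulr1 mulrN mulNr; lra.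
  move=> /cvg_norm /cvgr_to_le; apply; apply: nearW => i.
  exact: (key d m (eps i) d0 (eps0 i) (epsm i) Hm).2.
apply/eqP; rewrite -normr_le0; apply/ler_addgt0Pl => d d0; rewrite addr0.
have M1 : 0 < M + 1 by lra.
have d1 : 0 < d * c / (M + 1) by rewrite divr_gt0// mulr_gt0.
apply: le_trans (bound _ d1) _.
have -> : d * c / (M + 1) / c * M = d * (M / (M + 1)).
  by field; rewrite !gt_eqF.
by rewrite ler_piMr ?(ltW d0)// ler_pdivrMr// mul1r lerDl ler01.
Qed.

Theorem flux_zero X : (forall j, C 1 (X j)) -> tangential X ->
  vint B (fun x => \sum_j pd B j (X j) x) = 0.
Proof.
apply: null_flux_global => p cp; have [Bp|nBp] := pselect (B p).
  exact: null_flux_interior.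
by apply: null_flux_boundary; exact: bdry_intro.
Qed.

End Flux.

(** * Second-order tractions *)

Section SecondOrder.
Variables (R : realType) (B : set (E3 R)) (n : E3 R -> E3 R).
Hypotheses (hB : smooth_bounded_region B) (hn : outward_unit_normal B n).

Let oB : open B. Proof. by case: hB. Qed.
Let bB : bounded_set B. Proof. by case: hB. Qed.
Let BD : B `<=` closure B. Proof. exact: subset_closure. Qed.
Let DB : closure B `<=` closure B. Proof. by []. Qed.

Local Notation C := (Ck B (closure B)).

Lemma pd_near f g (j : 'I_3) p : bdry B p -> (\forall y \near p, f y = g y) ->
  pd B j f p = pd B j g p.
Proof.
move=> bp fg; have nB := bdry_out oB bp.
rewrite (pd_out j f nB) (pd_out j g nB); apply: lim_near_eq.
have : \forall y \near p, \forall z \near y, f z = g z by exact: nbhs_interior.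
move=> H; rewrite near_withinE; apply: filterS H => y Hy By.
exact: near_eq_derive.
Qed.

Lemma bdry_compact : compact (bdry B).
Proof.
apply: (subclosed_compact _ (closure_compact hB)); last by move=> x [].
rewrite /bdry setDE; apply: closedI; first exact: closed_closure.
by apply: open_closedC; exact: open_interior.
Qed.

(** The normal is smooth near the boundary and arbitrary elsewhere; after the cutoff it is a
    legitimate factor for the calculus on the closure of B. Equality on a neighbourhood of each
    boundary point preserves the derivatives there, by [pd_near]. *)
Lemma normal_extension : exists N : 'I_3 -> E3 R -> R,
  (forall j, C 2 (N j)) /\
  forall p, bdry B p -> \forall y \near p, forall j, N j y = n y 0 j.
Proof.
have [[U [oU bU nU]] _] := hn.
have [psi [K [Cpsi cK KU psi0 psi1]]] := compact_cutoff bdry_compact oU bU.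
exists (fun j x => psi x * n x 0 j); split; last first.
  by move=> p /psi1; apply: filterS => y -> j; rewrite mul1r.
have cl (A : set (E3 R)) : A `<=` closure A by exact: subset_closure.
have rf (A : set (E3 R)) : A `<=` A by [].
have oT := @openT (E3 R).
move=> j; have oK : open (~` K) by exact: closed_openC.
have : Ck (U `|` ~` K) (U `|` ~` K) 2 (fun x => psi x * n x 0 j).
  apply: Ck_glue => //.
    apply: (CkM oU (rf U) (cl U)); last exact: smooth_on_Ck.
    exact: (Ck_restrict oT oU (rf U) (cl U) _ Cpsi).
  apply: (Ck_ext oK (rf _) (cl _)) (Ck_cst oK (rf _) (cl _) 2 0) => x Kx.
  by rewrite psi0// mul0r.
have -> : U `|` ~` K = setT.
  apply/seteqP; split => // x _; have [/KU|] := pselect (K x); first by left.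
  by right.
exact: (Ck_restrict oT oB BD DB _).
Qed.

(** The boundary hypothesis says that the field q w is tangential. *)
Lemma divergence_pairing (q : 'I_3 -> E3 R -> R) (w : E3 R -> R) :
  (forall j, C 1 (q j)) -> C 1 w ->
  (forall p, bdry B p -> (\sum_j q j p * n p 0 j) * w p = 0) ->
  vint B (fun x => (\sum_j pd B j (q j) x) * w x + \sum_j q j x * pd B j w x) = 0.
Proof.
move=> Cq Cw qw.
have CX j : C 1 (fun x => q j x * w x) by exact: (CkM oB BD DB (Cq j) Cw).
rewrite -[RHS](flux_zero hB hn CX); last first.
  move=> p /qw h; rewrite -[RHS]h mulr_suml; apply: eq_bigr => j _; ring.
apply: vint_ext => x /BD Dx; rewrite mulr_suml -big_split/=; apply: eq_bigr => j _.
by rewrite (pdM oB BD DB j (Cq j) Cw Dx).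
Qed.

Lemma normal_unit p : bdry B p -> \sum_j n p 0 j * n p 0 j = 1.
Proof.
move=> bp; have [g lg ng] := hn.2 p bp.
have gn : grad_norm g p != 0 by case: lg => U [].
have S0 : 0 <= \sum_j ('D_(axis R j) g p) ^+ 2 by apply: sumr_ge0 => j _; rewrite sqr_ge0.
have E : grad_norm g p ^+ 2 = \sum_j ('D_(axis R j) g p) ^+ 2 by rewrite sqr_sqrtr.
transitivity ((\sum_j ('D_(axis R j) g p) ^+ 2) / grad_norm g p ^+ 2).
  rewrite mulr_suml; apply: eq_bigr => j _; rewrite ng; field; exact: gn.
by rewrite -E divff// expf_neq0.
Qed.

(* The derivative of |n|^2 = 1 in a tangential direction vanishes. *)
Lemma normal_ext_tangential (N : 'I_3 -> E3 R -> R) p (v : 'I_3 -> R) :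
  (forall j, C 2 (N j)) ->
  (forall p, bdry B p -> \forall y \near p, forall j, N j y = n y 0 j) ->
  bdry B p -> \sum_i v i * n p 0 i = 0 ->
  \sum_i v i * \sum_j n p 0 j * pd B i (N j) p = 0.
Proof.
move=> CN Nn bp vn; have [[U [oU bU nU]] _] := hn.
have cl (A : set (E3 R)) : A `<=` closure A by exact: subset_closure.
have rf (A : set (E3 R)) : A `<=` A by [].
have Up : U p by exact: bU.
have Cn j : Ck U U 2 (fun x => n x 0 j) by exact: smooth_on_Ck.
pose f x := \sum_j n x 0 j * n x 0 j.
have Cf : Ck U U 2 f by apply: (Ck_sum oU (rf U) (cl U)) => j; exact: (CkM oU (rf U) (cl U)).
have np := nbhs_singleton (Nn p bp).
have Df i : 'D_(axis R i) f p = 2 * \sum_j n p 0 j * pd B i (N j) p.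
  rewrite -(pd_in i f Up) (pd_sum oU (rf U) (cl U)) => [|j|//]; last first.
    by apply: CkW; exact: (CkM oU (rf U) (cl U)).
  rewrite mulr_sumr; apply: eq_bigr => j _.
  rewrite (pdM oU (rf U) (cl U) i (CkW (Cn j)) (CkW (Cn j)) Up).
  (* A limit from inside B on the left, an ordinary derivative on the right; they agree because the
     latter is continuous at p. *)
  have -> : pd B i (N j) p = pd U i (fun x => n x 0 j) p.
    have E : \forall y \near p, N j y = n y 0 j by apply: filterS (Nn p bp) => y; exact.
    rewrite (pd_near i bp E) (pd_in i (fun x => n x 0 j) Up).
    have cD : {for p, continuous (fun y => 'D_(axis R i) (fun x => n x 0 j) y)}.
      by have [] := nU j [:: i] p Up.
    rewrite (pd_out i _ (bdry_out oB bp)).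
    have PF := within_body_proper DB (bdry_closure bp).
    by apply: cvg_lim => //; apply: cvg_within_filter.
  ring.
have := grad_tangential hB hn (f := f) (v := v) bp.
move=> /(_ _ _ _ vn) H.
have {H} : \sum_j 'D_(axis R j) f p * v j = 0.
  apply: H.
  - by apply: filterS (open_nbhs_nbhs (conj oU Up)) => y Uy j; exact: Ck_derivable Cf Uy.
  - move=> j; have /(within_openP _ oU)/(_ p Up) := Ck_continuous (Ck_pd j Cf).
    apply: continuous_near_eq; apply: filterS (open_nbhs_nbhs (conj oU Up)) => y Uy.
    by rewrite pd_in.
  - apply: filterS (open_nbhs_nbhs (conj oU Up)) => y _ byy.
    by rewrite /f (normal_unit byy) (normal_unit bp).
under eq_bigr do rewrite Df -mulrA.
rewrite -mulr_sumr => /eqP; rewrite mulf_eq0 pnatr_eq0/= => /eqP h.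
by rewrite -[RHS]h; apply: eq_bigr => i _; rewrite mulrC.
Qed.

Lemma kron_sum (i : 'I_3) (F : 'I_3 -> R) : \sum_j kron R i j * F j = F i.
Proof.
rewrite (bigD1 i)//= big1 => [|j ji]; first by rewrite /kron eqxx mul1r addr0.
by rewrite /kron eq_sym (negbTE ji) mul0r.
Qed.

(** Pointwise algebra at a boundary point: a_j = s_j - m_kj,k, b_j = m_kj n_k, nu is the normal, w
    the gradient of v, while [bd i j] and [nd i j] are the i-th derivatives of b_j and N_j. The
    hypotheses express |n|^2 = 1 and the vanishing of its derivative along the tangential part of
    b. *)
Lemma boundary_identity (a b nu w : 'I_3 -> R) (bd nd : 'I_3 -> 'I_3 -> R) (v : R) :
  \sum_j nu j * nu j = 1 ->
  \sum_i (b i - (\sum_j b j * nu j) * nu i) * (\sum_j nu j * nd i j) = 0 ->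
  \sum_j (a j * v + \sum_i (nd i i * (b j * v) + nu i * (bd i j * v + b j * w i)
     - (nd i j * (b i * v) + nu j * (bd i i * v + b i * w i)))) * nu j
  + \sum_k b k * w k =
  (\sum_j a j * nu j - \sum_j \sum_i (kron R j i - nu j * nu i) * bd i j
   + (\sum_l \sum_i (kron R l i - nu l * nu i) * nd i l) * (\sum_j b j * nu j)) * v
  + (\sum_j b j * nu j) * (\sum_j nu j * w j).
Proof.
move=> nu1 T.
have K1 (F : 'I_3 -> 'I_3 -> R) : \sum_j \sum_i (kron R j i - nu j * nu i) * F i j =
    \sum_j F j j - \sum_j \sum_i nu j * nu i * F i j.
  rewrite -sumrB; apply: eq_bigr => j _; rewrite -[F j j](kron_sum j (F^~ j)) -sumrB.
  by apply: eq_bigr => i _; rewrite mulrBl.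
rewrite !K1; apply/eqP; rewrite -subr_eq0; apply/eqP.
(* The difference of the two sides, written so that each hypothesis annihilates one term. *)
transitivity ((1 - \sum_j nu j * nu j) * (\sum_k b k * w k + v * \sum_i bd i i)
  - v * \sum_i (b i - (\sum_j b j * nu j) * nu i) * (\sum_j nu j * nd i j)).
  by rewrite !sum_I3; ring.
by rewrite T nu1 subrr mul0r mulr0 subrr.
Qed.

(** [normal_traction] with the time frozen, and convertible with it. *)
Definition traction (s : 'I_3 -> E3 R -> R) (m : 'I_3 -> 'I_3 -> E3 R -> R) (p : E3 R) : R :=
  \sum_j (s j p - \sum_k pd B k (m k j) p) * n p 0 j
  - \sum_j surf_deriv B n j (fun x => \sum_k m k j x * n x 0 k) p
  + surf_div_normal B n p * \sum_k \sum_j m k j p * n p 0 k * n p 0 j.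

Lemma surf_deriv_near f g (j : 'I_3) p : bdry B p -> (\forall y \near p, f y = g y) ->
  surf_deriv B n j f p = \sum_i (kron R j i - n p 0 j * n p 0 i) * pd B i g p.
Proof. by move=> bp fg; apply: eq_bigr => i _; rewrite (pd_near i bp fg). Qed.

Lemma eq_opp0 (y : R) : y = - y -> y = 0.
Proof. by lra. Qed.

Lemma tractionE (s : 'I_3 -> E3 R -> R) (m : 'I_3 -> 'I_3 -> E3 R -> R) p (X Y Z : R) :
  \sum_j surf_deriv B n j (fun x => \sum_k m k j x * n x 0 k) p = X ->
  surf_div_normal B n p = Y -> \sum_k \sum_j m k j p * n p 0 k * n p 0 j = Z ->
  traction s m p = \sum_j (s j p - \sum_k pd B k (m k j) p) * n p 0 j - X + Y * Z.
Proof. by move=> <- <- <-. Qed.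

Lemma flux_algebra (ps s w : 'I_3 -> R) (pp q mm ww : 'I_3 -> 'I_3 -> R) (v : R) :
  (\sum_j ps j - \sum_j \sum_k pp j k) * v + \sum_j s j * w j + \sum_j \sum_k mm j k * ww j k =
  \sum_j ((ps j - \sum_k pp j k) * v + (s j - \sum_k q k j) * w j
    + \sum_k (q j k * w k + mm j k * ww j k)).
Proof.
have E4 : \sum_j \sum_k (q j k * w k + mm j k * ww j k) =
    \sum_j (\sum_k q k j) * w j + \sum_j \sum_k mm j k * ww j k.
  under eq_bigr do rewrite big_split.
  rewrite big_split/=; congr (_ + _); rewrite exchange_big; apply: eq_bigr => j _.
  by rewrite mulr_suml.
rewrite !big_split/= E4 -mulr_suml -sumrB addrA; congr (_ + _); rewrite -addrA; congr (_ + _).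
rewrite -big_split/=; apply: eq_bigr => j _; ring.
Qed.

(** On the boundary the flux F involves the whole gradient of v, whereas the conditions control only
    v and its normal derivative. The correction H removes the tangential derivatives without
    changing the divergence. *)
Lemma second_order_pairing (s : 'I_3 -> E3 R -> R) (m : 'I_3 -> 'I_3 -> E3 R -> R)
    (v : E3 R -> R) :
  (forall j, C 1 (s j)) -> (forall k j, C 2 (m k j)) -> C 2 v ->
  (forall p, bdry B p -> traction s m p * v p
     + (\sum_k \sum_j m k j p * n p 0 k * n p 0 j) * (\sum_j n p 0 j * pd B j v p) = 0) ->
  vint B (fun x =>
    (\sum_j pd B j (s j) x - \sum_j \sum_k pd B j (pd B k (m k j)) x) * v x
    + \sum_j s j x * pd B j v x + \sum_j \sum_k m j k x * pd B j (pd B k v) x) = 0.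
Proof.
move=> Cs Cm Cv bc.
have [N [CN Nn]] := normal_extension.
have addC k f g : C k f -> C k g -> C k (fun x => f x + g x) := CkD oB BD DB (k := k) (f := f) (g := g).
have mulC k f g : C k f -> C k g -> C k (fun x => f x * g x) := CkM oB BD DB (k := k) (f := f) (g := g).
have subC k f g : C k f -> C k g -> C k (fun x => f x - g x) := CkB oB BD DB (k := k) (f := f) (g := g).
have sumC k (F : 'I_3 -> E3 R -> R) : (forall i, C k (F i)) -> C k (fun x => \sum_i F i x) :=
  Ck_sum oB BD DB (k := k) (F := F).
pose b j x := \sum_k m k j x * N k x.
have Cb j : C 2 (b j) by apply: sumC => k; exact: mulC (Cm k j) (CN k).
pose G j x := b j x * v x.
have CG j : C 2 (G j) by exact: mulC (Cb j) Cv.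
(* H is divergence free, and the normal component of F + H on the boundary is the expression in
   the hypothesis bc. *)
pose A i j x := N i x * G j x - N j x * G i x.
have CA i j : C 2 (A i j) by exact: subC (mulC _ _ _ (CN i) (CG j)) (mulC _ _ _ (CN j) (CG i)).
pose a j x := s j x - \sum_k pd B k (m k j) x.
have Ca j : C 1 (a j) by apply: subC (Cs j) (sumC _ _ _) => k; exact: Ck_pd (Cm k j).
pose F j x := a j x * v x + \sum_k m j k x * pd B k v x.
have CF j : C 1 (F j).
  apply: addC (mulC _ _ _ (Ca j) (CkW Cv)) (sumC _ _ _) => k.
  exact: mulC (CkW (Cm j k)) (Ck_pd k Cv).
pose H j x := \sum_i pd B i (A i j) x.
have CH j : C 1 (H j) by apply: sumC => i; exact: Ck_pd (CA i j).
have tX : tangential B n (fun j x => F j x + H j x).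
  move=> p bp; have Dp := bdry_closure bp.
  have np := nbhs_singleton (Nn p bp).
  have dG i j : pd B i (G j) p = pd B i (b j) p * v p + b j p * pd B i v p.
    exact: (pdM oB BD DB i (CkW (Cb j)) (CkW Cv) Dp).
  have dA i j : pd B i (A i j) p =
      pd B i (N i) p * (b j p * v p) + n p 0 i * (pd B i (b j) p * v p + b j p * pd B i v p)
      - (pd B i (N j) p * (b i p * v p) + n p 0 j * (pd B i (b i) p * v p + b i p * pd B i v p)).
    rewrite (pdB oB BD DB i (CkW (mulC _ _ _ (CN i) (CG j))) (CkW (mulC _ _ _ (CN j) (CG i))) Dp).
    rewrite (pdM oB BD DB i (CkW (CN i)) (CkW (CG j)) Dp) (pdM oB BD DB i (CkW (CN j)) (CkW (CG i)) Dp).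
    by rewrite !dG !np.
  have bE j : b j p = \sum_k m k j p * n p 0 k by apply: eq_bigr => k _; rewrite np.
  have Rb : \sum_k \sum_j m k j p * n p 0 k * n p 0 j = \sum_j b j p * n p 0 j.
    rewrite exchange_big; apply: eq_bigr => j _; rewrite bE mulr_suml.
    by apply: eq_bigr.
  have Sb j : surf_deriv B n j (fun x => \sum_k m k j x * n x 0 k) p =
      \sum_i (kron R j i - n p 0 j * n p 0 i) * pd B i (b j) p.
    apply: (surf_deriv_near _ bp).
    by apply: filterS (Nn p bp) => y Ny; apply: eq_bigr => k _; rewrite Ny.
  have Sn : surf_div_normal B n p =
      \sum_l \sum_i (kron R l i - n p 0 l * n p 0 i) * pd B i (N l) p.
    apply: eq_bigr => l _; apply: (surf_deriv_near _ bp).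
    by apply: filterS (Nn p bp) => y Ny; rewrite Ny.
  have nu1 := normal_unit bp.
  have T : \sum_i (b i p - (\sum_j b j p * n p 0 j) * n p 0 i) * (\sum_j n p 0 j * pd B i (N j) p) = 0.
    apply: (normal_ext_tangential CN Nn bp).
    under eq_bigr do rewrite mulrBl.
    rewrite sumrB; under [X in _ - X]eq_bigr do rewrite -mulrA.
    by rewrite -mulr_sumr nu1 mulr1 subrr.
  have Et : traction s m p = \sum_j a j p * n p 0 j
      - \sum_j \sum_i (kron R j i - n p 0 j * n p 0 i) * pd B i (b j) p
      + (\sum_l \sum_i (kron R l i - n p 0 l * n p 0 i) * pd B i (N l) p)
        * \sum_j b j p * n p 0 j.
    have Ss : \sum_j surf_deriv B n j (fun x => \sum_k m k j x * n x 0 k) p =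
        \sum_j \sum_i (kron R j i - n p 0 j * n p 0 i) * pd B i (b j) p.
      by apply: eq_bigr => j _; rewrite Sb.
    have E := tractionE s Ss Sn Rb; exact: E.
  have := bc p bp; rewrite Et Rb => Z.
  have I := @boundary_identity (fun j => a j p) (fun j => b j p) (fun j => n p 0 j)
    (fun i => pd B i v p) (fun i j => pd B i (b j) p) (fun i j => pd B i (N j) p) (v p) nu1 T.
  have {}I := etrans I Z.
  rewrite -[RHS]I -[X in _ = _ + X](_ : \sum_j (\sum_k m j k p * pd B k v p) * n p 0 j = _); last first.
    under eq_bigr do rewrite mulr_suml.
    rewrite exchange_big; apply: eq_bigr => k _; rewrite bE mulr_suml.
    by apply: eq_bigr => j _; rewrite mulrAC.
  rewrite -big_split/=; apply: eq_bigr => j _.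
  rewrite /F /H (eq_bigr _ (fun i _ => dA i j)); ring.
have CX j : C 1 (fun x => F j x + H j x) by exact: addC (CF j) (CH j).
rewrite -[RHS](flux_zero hB hn CX tX); apply: vint_ext => x Bx; have Dx := BD Bx.
have E1 j : pd B j (fun x => F j x + H j x) x = pd B j (F j) x + pd B j (H j) x.
  exact: (pdD oB BD DB j (CF j) (CH j) Dx).
have E2 : \sum_j pd B j (H j) x = 0.
  have E j : pd B j (H j) x = \sum_i pd B j (pd B i (A i j)) x.
    by apply: (pd_sum oB BD DB j _ Dx) => i; exact: Ck_pd (CA i j).
  rewrite (eq_bigr _ (fun j _ => E j)).
  (* [A] is antisymmetric and second derivatives commute in B, so the double divergence equals its
     own opposite. *)
  have anti i j : pd B j (pd B i (A i j)) x = - pd B i (pd B j (A j i)) x.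
    rewrite (pd_swap oB BD i j (CA j i) Bx).
    rewrite -(pdN oB BD DB j (Ck_pd i (CA j i)) Dx).
    apply: (pd_ext oB) => y /BD Dy; rewrite -(pdN oB BD DB i (CkW (CA j i)) Dy).
    by apply: (pd_ext oB) => z _; rewrite /A opprB.
  have h : \sum_j \sum_i pd B j (pd B i (A i j)) x = - \sum_j \sum_i pd B j (pd B i (A i j)) x.
    rewrite [in RHS]exchange_big -sumrN; apply: eq_bigr => j _; rewrite -sumrN.
    by apply: eq_bigr => i _; exact: anti.
  exact: eq_opp0 h.
have S1 : \sum_j pd B j (fun x => F j x + H j x) x = \sum_j pd B j (F j) x.
  by rewrite -[RHS]addr0 -[X in _ = _ + X]E2 -big_split; apply: eq_bigr => j _; exact: E1.
have E3 j : pd B j (F j) x = (pd B j (s j) x - \sum_k pd B j (pd B k (m k j)) x) * v x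
    + a j x * pd B j v x
    + \sum_k (pd B j (m j k) x * pd B k v x + m j k x * pd B j (pd B k v) x).
  have C1 : C 1 (fun x => a j x * v x) := mulC _ _ _ (Ca j) (CkW Cv).
  have C2 k : C 1 (fun x => m j k x * pd B k v x) := mulC _ _ _ (CkW (Cm j k)) (Ck_pd k Cv).
  have C3 k : C 1 (pd B k (m k j)) := Ck_pd k (Cm k j).
  rewrite (pdD oB BD DB j C1 (sumC _ _ C2) Dx) (pdM oB BD DB j (Ca j) (CkW Cv) Dx).
  rewrite (pdB oB BD DB j (Cs j) (sumC _ _ C3) Dx) (pd_sum oB BD DB j C3 Dx) (pd_sum oB BD DB j C2 Dx).
  congr (_ + _); apply: eq_bigr => k _.
  exact: (pdM oB BD DB j (CkW (Cm j k)) (Ck_pd k Cv) Dx).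
have FA := @flux_algebra (fun j => pd B j (s j) x) (fun j => s j x) (fun j => pd B j v x)
  (fun j k => pd B j (pd B k (m k j)) x) (fun j k => pd B j (m j k) x) (fun j k => m j k x)
  (fun j k => pd B j (pd B k v) x) (v x).

rewrite S1; apply: (etrans FA); apply: eq_bigr => j _; by rewrite E3 /a.
Qed.

End SecondOrder.

(** * Time derivatives and differences of solutions *)

Section TimeDerivative.
Variable R : realType.
Implicit Types (a b : R -> R) (t : R).

Definition dtv a t : R := lim (dt_quotient a t h @[h --> dt_filter t]).

Lemma dt_filter_proper t : 0 <= t -> ProperFilter (dt_filter t).
Proof.
move=> t0; apply: Build_ProperFilter_ex => P.
rewrite /dt_filter /within/= /dnbhs /within/= => /nbhs_ballP[e /= e0 eP].
have e20 : 0 < e / 2 by rewrite divr_gt0.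
exists (e / 2); apply: eP; last by rewrite /timeI/= addr_ge0// ltW.
  by rewrite /ball/= sub0r normrN gtr0_norm// ltr_pdivrMr// ltr_pMr// ltr1n.
by rewrite gt_eqF.
Qed.

Lemma dt_quotient_eq a b t : 0 <= t -> (forall s, 0 <= s -> a s = b s) ->
  \forall h \near dt_filter t, dt_quotient a t h = dt_quotient b t h.
Proof.
move=> t0 ab; apply: filterS (withinT _ _) => h th.
by rewrite /dt_quotient (ab _ t0) (ab _ th).
Qed.

Lemma dtv_ext a b t : 0 <= t -> (forall s, 0 <= s -> a s = b s) -> dtv a t = dtv b t.
Proof. by move=> t0 ab; apply: lim_near_eq; exact: dt_quotient_eq. Qed.

Lemma derivable_t_ext a b t : 0 <= t -> (forall s, 0 <= s -> a s = b s) ->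
  derivable_t a t -> derivable_t b t.
Proof.
move=> t0 ab /cvg_ex[l al]; apply/cvg_ex; exists l.
apply: cvg_trans al; apply: near_eq_cvg.
by apply: filterS (dt_quotient_eq t0 ab) => h ->.
Qed.

Lemma dt_quotientB a b t h :
  dt_quotient (fun s => a s - b s) t h = dt_quotient a t h - dt_quotient b t h.
Proof. by rewrite /dt_quotient; ring. Qed.

Lemma dtvB_cvg a b t : 0 <= t -> derivable_t a t -> derivable_t b t ->
  dt_quotient (fun s => a s - b s) t h @[h --> dt_filter t] --> dtv a t - dtv b t.
Proof.
move=> t0 da db; rewrite (_ : dt_quotient _ t = fun h => dt_quotient a t h - dt_quotient b t h).
  by have PF := dt_filter_proper t0; apply: cvgB.
by apply/funext => h; exact: dt_quotientB.
Qed.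

Lemma dtvB a b t : 0 <= t -> derivable_t a t -> derivable_t b t ->
  dtv (fun s => a s - b s) t = dtv a t - dtv b t.
Proof.
by move=> t0 da db; have PF := dt_filter_proper t0; apply: cvg_lim => //; exact: dtvB_cvg.
Qed.

Lemma derivable_tB a b t : 0 <= t -> derivable_t a t -> derivable_t b t ->
  derivable_t (fun s => a s - b s) t.
Proof. by move=> t0 da db; apply/cvg_ex; eexists; exact: dtvB_cvg. Qed.

Lemma dtv_cst c t : 0 <= t -> dtv (fun=> c) t = 0.
Proof.
move=> t0; have PF := dt_filter_proper t0; apply: cvg_lim => //.
rewrite (_ : dt_quotient _ t = fun=> 0); first exact: cvg_cst.
by apply/funext => h; rewrite /dt_quotient subrr mulr0.
Qed.

(** For t > 0 the constraint t + h >= 0 holds for all small h, and the one-sided filter is the usual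
    one. *)
Lemma derivable_t_is_derive a t : 0 < t -> derivable_t a t ->
  is_derive t (1 : R) a (dtv a t).
Proof.
move=> t0 da.
suff C : (fun h : R => h^-1 *: ((a \o shift t) (h *: (1:R)) - a t)) @ 0^' --> dtv a t.
  by split; [apply/cvg_ex; exists (dtv a t)|apply: cvg_lim].
rewrite (_ : (fun h => _) = dt_quotient a t); last first.
  by apply/funext => h; rewrite /dt_quotient /GRing.scale/= mulr1 [h + t]addrC.
move=> P /(da : _ --> _); rewrite /= /dt_filter /nbhs/= /within/= /dnbhs /within/= => H.
move: H => /nbhs_ballP[e /= e0 eP]; apply/nbhs_ballP.
exists (Num.min e t); first by rewrite /= lt_min e0.
move=> h; rewrite /ball/= sub0r normrN lt_min => /andP[he ht] h0.
apply: eP => //; first by rewrite /ball/= sub0r normrN.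
rewrite /timeI/=; move: ht; rewrite ltr_norml => /andP[ht _]; lra.
Qed.

End TimeDerivative.

Section Regularity.
Variables (R : realType) (B : set (E3 R)).
Hypothesis oB : open B.
Let BD : B `<=` closure B. Proof. exact: subset_closure. Qed.
Let DB : closure B `<=` closure B. Proof. by []. Qed.

Local Notation C := (Ck B (closure B)).
Implicit Types f g : tfield R.

Definition jointly_continuous f := {within cyl (closure B), continuous (fun z : E3 R * R => f z.1 z.2)}.

Lemma jc_space f t : jointly_continuous f -> 0 <= t -> {within closure B, continuous (f^~ t)}.
Proof.
move=> cf t0.
have := @within_comp _ _ _ (closure B) (cyl (closure B)) (fun x => (x, t)) (fun z => f z.1 z.2) _ _ cf.
apply; last by move=> x Dx; split.
apply/within_continuousP => x _; apply: cvg_within_filter.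
move=> P [[P1 P2] /= [h1 h2] sub]; apply: filterS h1 => y Py.
by apply: sub; split => //=; exact: nbhs_singleton h2.
Qed.

Lemma jc_time f x : jointly_continuous f -> closure B x -> {within @timeI R, continuous (f x)}.
Proof.
move=> cf Dx.
have := @within_comp _ _ _ (@timeI R) (cyl (closure B)) (fun t => (x, t)) (fun z => f z.1 z.2) _ _ cf.
apply; last by move=> t t0; split.
apply/within_continuousP => t _; apply: cvg_within_filter.
move=> P [[P1 P2] /= [h1 h2] sub]; apply: filterS h2 => y Py.
by apply: sub; split => //=; exact: nbhs_singleton h1.
Qed.

Lemma jc_ext f g : (forall x t, closure B x -> 0 <= t -> f x t = g x t) ->
  jointly_continuous f -> jointly_continuous g.
Proof.
move=> fg /within_continuousP cf; apply/within_continuousP => -[x t] xt.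
have [/= Dx t0] := xt; rewrite -fg//; apply: cvg_trans (cf _ xt).
by apply: near_eq_cvg; apply: filterS (withinT _ _) => -[y s] [/= Dy s0]; rewrite fg.
Qed.

Lemma jcB f g : jointly_continuous f -> jointly_continuous g ->
  jointly_continuous (fun x t => f x t - g x t).
Proof.
move=> /within_continuousP cf /within_continuousP cg; apply/within_continuousP => z zD.
by apply: cvgB; [exact: cf|exact: cg].
Qed.

Lemma classC_Ck_dxs M N k K s f t : classC B M N f -> (k <= N)%N -> 0 <= t ->
  (size s + K <= M)%N -> C K ((dxs B s (iter k (@dt R) f))^~ t).
Proof.
move=> [jc dd _] kN t0; elim: K s => [|K IH] s sK.
  by apply: Ck0; apply: jc_space t0; apply: jc kN; move: sK; rewrite addn0.
have ltM : (size s < M)%N by apply: leq_trans sK; rewrite addnS ltnS leq_addr.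
apply: CkS.
- by apply: jc_space t0; apply: jc kN; exact: ltnW.
- by move=> j x Bx; exact: dd.
- by move=> j; apply: (IH (j :: s)); rewrite /= addSn -addnS.
Qed.

Lemma classC_Ck M N k f t : classC B M N f -> (k <= N)%N -> 0 <= t ->
  C M ((iter k (@dt R) f)^~ t).
Proof. by move=> Cf kN t0; exact: (classC_Ck_dxs (s := [::]) Cf kN t0 (leqnn M)). Qed.

Lemma classC_jc M N k s f : classC B M N f -> (size s <= M)%N -> (k <= N)%N ->
  jointly_continuous (dxs B s (iter k (@dt R) f)).
Proof. by move=> [jc _ _]; exact: jc. Qed.

Lemma classC_dt M N k f x t : classC B M N f -> (k < N)%N -> closure B x -> 0 <= t ->
  derivable_t (iter k (@dt R) f x) t.
Proof. by move=> [_ _ dd] kN; exact: dd. Qed.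

Lemma dt_sub M N k f g x t : classC B M N f -> classC B M N g -> (k <= N)%N ->
  closure B x -> 0 <= t ->
  iter k (@dt R) (fun x t => f x t - g x t) x t = iter k (@dt R) f x t - iter k (@dt R) g x t.
Proof.
move=> Cf Cg; elim: k t => [//|k IH] t kN Dx t0.
have E := dtv_ext t0 (fun s s0 => IH s (ltnW kN) Dx s0).
rewrite [LHS]E; exact: dtvB (classC_dt Cf kN Dx t0) (classC_dt Cg kN Dx t0).
Qed.

(** [dx] and [dt] are defined by limits, additive only where the limits exist; membership in the
    class ensures this up to the stated orders, one derivative at a time. *)
Lemma dxs_sub M N k s f g x t : classC B M N f -> classC B M N g -> (k <= N)%N ->
  (size s <= M)%N -> closure B x -> 0 <= t ->
  dxs B s (iter k (@dt R) (fun x t => f x t - g x t)) x t =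
  dxs B s (iter k (@dt R) f) x t - dxs B s (iter k (@dt R) g) x t.
Proof.
move=> Cf Cg kN; elim: s x t => [|j s IH] x t sM Dx t0; first exact: dt_sub Cf Cg kN Dx t0.
have E := pd_ext oB j x (fun y By => IH y t (ltnW sM) (BD By) t0).
have s1 : (size s + 1 <= M)%N by rewrite addn1.
rewrite [LHS]E.
exact: (pdB oB BD DB j (classC_Ck_dxs Cf kN t0 s1) (classC_Ck_dxs Cg kN t0 s1) Dx).
Qed.

Lemma classC_sub M N f g : classC B M N f -> classC B M N g ->
  classC B M N (fun x t => f x t - g x t).
Proof.
move=> Cf Cg; split.
- move=> s k sM kN; apply: (jc_ext (f := fun x t =>
    dxs B s (iter k (@dt R) f) x t - dxs B s (iter k (@dt R) g) x t)).
    by move=> x t Dx t0; rewrite (dxs_sub Cf Cg).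
  by apply: jcB; [exact: classC_jc Cf sM kN|exact: classC_jc Cg sM kN].
- move=> s k sM kN j x t Bx t0.
  have s1 : (size s + 1 <= M)%N by rewrite addn1.
  have CB := CkB oB BD DB (classC_Ck_dxs Cf kN t0 s1) (classC_Ck_dxs Cg kN t0 s1).
  have CD : C 1 ((dxs B s (iter k (@dt R) (fun x t => f x t - g x t)))^~ t).
    by apply: (Ck_ext oB BD DB) CB => y Dy; rewrite (dxs_sub Cf Cg kN (ltnW sM) Dy t0).
  exact: Ck_derivable CD Bx.
- move=> k kN x t Dx t0.
  apply: (derivable_t_ext (a := fun t => iter k (@dt R) f x t - iter k (@dt R) g x t)) => //.
    by move=> r r0; rewrite (dt_sub Cf Cg (ltnW kN) Dx r0).
  by apply: derivable_tB => //; [exact: classC_dt Cf kN Dx t0|exact: classC_dt Cg kN Dx t0].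
Qed.

End Regularity.

Section Sums.
Variable R : realType.

Lemma sumZB (c f g : 'I_3 -> R) :
  \sum_i c i * (f i - g i) = \sum_i c i * f i - \sum_i c i * g i.
Proof. by rewrite -sumrB; apply: eq_bigr => i _; rewrite mulrBr. Qed.

Lemma sumZB2 (c f g : 'I_3 -> 'I_3 -> R) : \sum_i \sum_j c i j * (f i j - g i j) =
  \sum_i \sum_j c i j * f i j - \sum_i \sum_j c i j * g i j.
Proof. by rewrite -sumrB; apply: eq_bigr => i _; exact: sumZB. Qed.

Lemma sumZB3 (c f g : 'I_3 -> 'I_3 -> 'I_3 -> R) :
  \sum_i \sum_j \sum_k c i j k * (f i j k - g i j k) =
  \sum_i \sum_j \sum_k c i j k * f i j k - \sum_i \sum_j \sum_k c i j k * g i j k.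
Proof. by rewrite -sumrB; apply: eq_bigr => i _; exact: sumZB2. Qed.

Lemma sumB2 (f g : 'I_3 -> 'I_3 -> R) : \sum_i \sum_j (f i j - g i j) =
  \sum_i \sum_j f i j - \sum_i \sum_j g i j.
Proof. by rewrite -sumrB; apply: eq_bigr => i _; exact: sumrB. Qed.

Lemma subr4_mul (a b q c d e : R) : q = c - d -> (a - b - q) * e = (a - c - (b - d)) * e.
Proof. by move=> ->; congr (_ * _); ring. Qed.

Lemma momentum_difference (a a' b b' c f u u' s q v : R) : s = a - a' -> q = b - b' -> v = u - u' ->
  a - b + c * f = c * u -> a' - b' + c * f = c * u' -> s - q + c * 0 = c * v.
Proof. by move=> -> -> -> h h'; rewrite [RHS]mulrBr -h -h'; ring. Qed.

Lemma charge_difference (a a' b b' g s q : R) : s = a - a' -> q = b - b' ->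
  a - b = g -> a' - b' = g -> s - q = 0.
Proof. lra. Qed.

Lemma energy_difference (c u u' b b' h v s r : R) : v = u - u' -> s = b - b' ->
  c * u + b - r * h = 0 -> c * u' + b' - r * h = 0 -> c * v + s - r * 0 = 0.
Proof.
move=> -> -> h1 h2; transitivity (c * u + b - r * h - (c * u' + b' - r * h)); first by ring.
by rewrite h1 h2 subrr.
Qed.

Lemma strain_difference (a a' b b' s q e e' : R) : s = a - a' -> q = b - b' ->
  e = 2^-1 * (a + b) -> e' = 2^-1 * (a' + b') -> e - e' = 2^-1 * (s + q).
Proof. by move=> -> -> -> ->; ring. Qed.

Lemma eq_difference (a a' s e e' : R) : s = a - a' -> e = a -> e' = a' -> e - e' = s.
Proof. by move=> -> -> ->. Qed.

Lemma eqN_difference (a a' s e e' : R) : s = a - a' -> e = - a -> e' = - a' -> e - e' = - s.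
Proof. by move=> -> -> ->; ring. Qed.

Lemma traction_algebra (a a' x x' y z z' : R) :
  a - a' - (x - x') + y * (z - z') = a - x + y * z - (a' - x' + y * z').
Proof. ring. Qed.

End Sums.

Section Difference.
Variables (R : realType).
Implicit Types (f g : tfield R) (p : process_array R).

Definition fsub f g : tfield R := fun x t => f x t - g x t.

Definition psub p p' : process_array R := Process
  (fun i => fsub (p_u p i) (p_u p' i)) (fsub (p_theta p) (p_theta p'))
  (fsub (p_phi p) (p_phi p')) (fun i j => fsub (p_e p i j) (p_e p' i j))
  (fun i j k => fsub (p_kappa p i j k) (p_kappa p' i j k))
  (fun i => fsub (p_beta p i) (p_beta p' i)) (fun i => fsub (p_E p i) (p_E p' i))
  (fun i j => fsub (p_V p i j) (p_V p' i j)) (fun i j => fsub (p_tau p i j) (p_tau p' i j))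
  (fun i j k => fsub (p_mu p i j k) (p_mu p' i j k))
  (fun i => fsub (p_sigma p i) (p_sigma p' i)) (fun i j => fsub (p_Q p i j) (p_Q p' i j))
  (fsub (p_eta p) (p_eta p')) (fun i => fsub (p_q p i) (p_q p' i)).

Definition zero_data : prescribed_data R :=
  Data (fun _ _ _ => 0) (fun _ _ => 0) (fun _ _ => 0) (fun _ _ => 0) (fun _ _ => 0)
    (fun=> 0) (fun=> 0) (fun _ _ _ => 0) (fun _ _ _ => 0) (fun _ _ => 0) (fun _ _ => 0)
    (fun _ _ => 0) (fun _ _ _ => 0) (fun _ _ _ => 0) (fun _ _ => 0) (fun _ _ => 0)
    (fun _ _ => 0).

Variables (B : set (E3 R)) (n : E3 R -> E3 R).
Hypotheses (hB : smooth_bounded_region B) (hn : outward_unit_normal B n).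

Let oB : open B. Proof. by case: hB. Qed.
Let BD : B `<=` closure B. Proof. exact: subset_closure. Qed.
Let DB : closure B `<=` closure B. Proof. by []. Qed.
Local Notation C := (Ck B (closure B)).

Lemma dx_sub M N j f g x t : classC B M.+1 N f -> classC B M.+1 N g ->
  closure B x -> 0 <= t -> dx B j (fsub f g) x t = dx B j f x t - dx B j g x t.
Proof. by move=> Cf Cg Dx t0; exact: (dxs_sub oB (k := 0) (s := [:: j]) Cf Cg _ _ Dx t0). Qed.

Lemma dxx_sub M N i j f g x t : classC B M.+2 N f -> classC B M.+2 N g ->
  closure B x -> 0 <= t ->
  dx B i (dx B j (fsub f g)) x t = dx B i (dx B j f) x t - dx B i (dx B j g) x t.
Proof. by move=> Cf Cg Dx t0; exact: (dxs_sub oB (k := 0) (s := [:: i; j]) Cf Cg _ _ Dx t0). Qed.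

Lemma dt_fsub M N f g x t : classC B M N.+1 f -> classC B M N.+1 g ->
  closure B x -> 0 <= t -> dt (fsub f g) x t = dt f x t - dt g x t.
Proof. by move=> Cf Cg Dx t0; exact: (dt_sub (k := 1) Cf Cg _ Dx t0). Qed.

Lemma dtdt_fsub M N f g x t : classC B M N.+2 f -> classC B M N.+2 g ->
  closure B x -> 0 <= t -> dt (dt (fsub f g)) x t = dt (dt f) x t - dt (dt g) x t.
Proof. by move=> Cf Cg Dx t0; exact: (dt_sub (k := 2) Cf Cg _ Dx t0). Qed.

(** The surface operators differentiate products of m and n. With n replaced by its extension N
    these are C^1 up to the boundary, where [pd] is additive. *)
Lemma traction_sub (s s' : 'I_3 -> E3 R -> R) (m m' : 'I_3 -> 'I_3 -> E3 R -> R)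
    (p : E3 R) :
  (forall k j, C 1 (m k j)) -> (forall k j, C 1 (m' k j)) -> bdry B p ->
  traction B n (fun j x => s j x - s' j x) (fun k j x => m k j x - m' k j x) p =
  traction B n s m p - traction B n s' m' p.
Proof.
move=> Cm Cm' bp; have Dp := bdry_closure bp.
have [N [CN Nn]] := normal_extension hB hn.
pose b (m : 'I_3 -> 'I_3 -> E3 R -> R) j x := \sum_k m k j x * N k x.
have Cb m0 (C0 : forall k j, C 1 (m0 k j)) j : C 1 (b m0 j).
  by apply: (Ck_sum oB BD DB) => k; exact: (CkM oB BD DB (C0 k j) (CkW (CN k))).
have Sb m0 j : surf_deriv B n j (fun x => \sum_k m0 k j x * n x 0 k) p =
    \sum_i (kron R j i - n p 0 j * n p 0 i) * pd B i (b m0 j) p.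
  apply: (surf_deriv_near n hB _ bp).
  by apply: filterS (Nn p bp) => y Ny; apply: eq_bigr => k _; rewrite Ny.
have Sd j : surf_deriv B n j (fun x => \sum_k (m k j x - m' k j x) * n x 0 k) p =
    surf_deriv B n j (fun x => \sum_k m k j x * n x 0 k) p -
    surf_deriv B n j (fun x => \sum_k m' k j x * n x 0 k) p.
  rewrite (Sb (fun k j x => m k j x - m' k j x)) (Sb m) (Sb m') -sumZB; apply: eq_bigr => i _.
  have Q : pd B i (b (fun k j x => m k j x - m' k j x) j) p =
      pd B i (fun x => b m j x - b m' j x) p.
    by apply: (pd_ext oB) => y _; rewrite /b -sumrB; apply: eq_bigr => k _; rewrite mulrBl.
  by rewrite Q (pdB oB BD DB i (Cb _ Cm j) (Cb _ Cm' j) Dp).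
have Z0 : \sum_k \sum_j (m k j p - m' k j p) * n p 0 k * n p 0 j =
    \sum_k \sum_j m k j p * n p 0 k * n p 0 j - \sum_k \sum_j m' k j p * n p 0 k * n p 0 j.
  by rewrite -sumB2; apply: eq_bigr => k _; apply: eq_bigr => j _; rewrite !mulrBl.
have X0 : \sum_j surf_deriv B n j (fun x => \sum_k (m k j x - m' k j x) * n x 0 k) p =
    \sum_j surf_deriv B n j (fun x => \sum_k m k j x * n x 0 k) p -
    \sum_j surf_deriv B n j (fun x => \sum_k m' k j x * n x 0 k) p.
  by rewrite -sumrB; apply: eq_bigr => j _; exact: Sd.
have A0 : \sum_j (s j p - s' j p - \sum_k pd B k (fun x => m k j x - m' k j x) p) * n p 0 j =
    \sum_j (s j p - \sum_k pd B k (m k j) p) * n p 0 j -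
    \sum_j (s' j p - \sum_k pd B k (m' k j) p) * n p 0 j.
  rewrite -sumrB; apply: eq_bigr => j _; rewrite -mulrBl.
  have Q : \sum_k pd B k (fun x => m k j x - m' k j x) p =
      \sum_k pd B k (m k j) p - \sum_k pd B k (m' k j) p.
    by rewrite -sumrB; apply: eq_bigr => k _; exact: (pdB oB BD DB k (Cm k j) (Cm' k j) Dp).
  exact: (subr4_mul _ _ _ Q).
have E1 := tractionE (fun j x => s j x - s' j x) X0 (erefl (surf_div_normal B n p)) Z0.
rewrite [LHS]E1 A0; exact: traction_algebra.
Qed.

Variables (m : material R) (S Sigma : nat -> set (E3 R)) (d : prescribed_data R).

Lemma psub_admissible p p' : admissible B p -> admissible B p' -> admissible B (psub p p').
Proof.
move=> A A'.
have sub M N f g := @classC_sub R B oB M N f g.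
split=> *; rewrite /psub/=.
- exact: sub (u_reg A _) (u_reg A' _).
- exact: sub (phi_reg A) (phi_reg A').
- exact: sub (theta_reg A) (theta_reg A').
- exact: sub (e_reg A _ _) (e_reg A' _ _).
- exact: sub (V_reg A _ _) (V_reg A' _ _).
- exact: sub (eta_reg A) (eta_reg A').
- exact: sub (kappa_reg A _ _ _) (kappa_reg A' _ _ _).
- exact: sub (E_reg A _) (E_reg A' _).
- exact: sub (mu_reg A _ _ _) (mu_reg A' _ _ _).
- exact: sub (Q_reg A _ _) (Q_reg A' _ _).
- exact: sub (beta_reg A _) (beta_reg A' _).
- exact: sub (tau_reg A _ _) (tau_reg A' _ _).
- exact: sub (sigma_reg A _) (sigma_reg A' _).
- exact: sub (q_reg A _) (q_reg A' _).
- move=> x t Dx t0.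
  exact: (congr2 (fun a b => a - b) (e_sym A _ _ Dx t0) (e_sym A' _ _ Dx t0)).
- move=> x t Dx t0.
  exact: (congr2 (fun a b => a - b) (kappa_sym A _ _ _ Dx t0) (kappa_sym A' _ _ _ Dx t0)).
- move=> x t Dx t0.
  exact: (congr2 (fun a b => a - b) (V_sym A _ _ Dx t0) (V_sym A' _ _ Dx t0)).
- move=> x t Dx t0.
  exact: (congr2 (fun a b => a - b) (tau_sym A _ _ Dx t0) (tau_sym A' _ _ Dx t0)).
- move=> x t Dx t0.
  exact: (congr2 (fun a b => a - b) (mu_sym A _ _ _ Dx t0) (mu_sym A' _ _ _ Dx t0)).
- move=> x t Dx t0.
  exact: (congr2 (fun a b => a - b) (Q_sym A _ _ Dx t0) (Q_sym A' _ _ Dx t0)).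
Qed.

Lemma psub_balance p p' : admissible B p -> admissible B p' -> balance B m d p ->
  balance B m d p' -> balance B m zero_data (psub p p').
Proof.
move=> A A' H H'; split.
- move=> i x t Bx t0; have Dx := BD Bx.
  have E1 : \sum_j dx B j (p_tau (psub p p') j i) x t =
      \sum_j dx B j (p_tau p j i) x t - \sum_j dx B j (p_tau p' j i) x t.
    rewrite -sumrB; apply: eq_bigr => j _.
    exact: (dx_sub j (tau_reg A j i) (tau_reg A' j i) Dx t0).
  have E2 : \sum_j \sum_k dx B j (dx B k (p_mu (psub p p') k j i)) x t =
      \sum_j \sum_k dx B j (dx B k (p_mu p k j i)) x t -
      \sum_j \sum_k dx B j (dx B k (p_mu p' k j i)) x t.
    rewrite -sumB2; apply: eq_bigr => j _; apply: eq_bigr => k _.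
    exact: (dxx_sub j k (mu_reg A k j i) (mu_reg A' k j i) Dx t0).
  have E3 := dtdt_fsub (u_reg A i) (u_reg A' i) Dx t0.
  exact: (momentum_difference E1 E2 E3 (momentum H i Bx t0) (momentum H' i Bx t0)).
- move=> x t Bx t0; have Dx := BD Bx.
  have E1 : \sum_j dx B j (p_sigma (psub p p') j) x t =
      \sum_j dx B j (p_sigma p j) x t - \sum_j dx B j (p_sigma p' j) x t.
    rewrite -sumrB; apply: eq_bigr => j _.
    exact: (dx_sub j (sigma_reg A j) (sigma_reg A' j) Dx t0).
  have E2 : \sum_i \sum_j dx B i (dx B j (p_Q (psub p p') j i)) x t =
      \sum_i \sum_j dx B i (dx B j (p_Q p j i)) x t -
      \sum_i \sum_j dx B i (dx B j (p_Q p' j i)) x t.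
    rewrite -sumB2; apply: eq_bigr => j _; apply: eq_bigr => k _.
    exact: (dxx_sub j k (Q_reg A k j) (Q_reg A' k j) Dx t0).
  exact: (charge_difference E1 E2 (Defs.charge H Bx t0) (Defs.charge H' Bx t0)).
- move=> x t Bx t0; have Dx := BD Bx.
  have E1 : \sum_j dx B j (p_q (psub p p') j) x t =
      \sum_j dx B j (p_q p j) x t - \sum_j dx B j (p_q p' j) x t.
    rewrite -sumrB; apply: eq_bigr => j _.
    exact: (dx_sub j (q_reg A j) (q_reg A' j) Dx t0).
  have E3 := dt_fsub (eta_reg A) (eta_reg A') Dx t0.
  exact: (energy_difference E3 E1 (energy H Bx t0) (energy H' Bx t0)).
Qed.

Lemma psub_geometry p p' : admissible B p -> admissible B p' -> geometry B p ->
  geometry B p' -> geometry B (psub p p').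
Proof.
move=> A A' H H'; split.
- move=> i j x t Bx t0; have Dx := BD Bx.
  have E i j := dx_sub j (u_reg A i) (u_reg A' i) Dx t0.
  exact: (strain_difference (E i j) (E j i) (e_def H i j Bx t0) (e_def H' i j Bx t0)).
- move=> i j k x t Bx t0; have Dx := BD Bx.
  have E := dxx_sub j i (u_reg A k) (u_reg A' k) Dx t0.
  exact: (eq_difference E (kappa_def H i j k Bx t0) (kappa_def H' i j k Bx t0)).
- move=> i x t Bx t0; have Dx := BD Bx.
  have E := dx_sub i (theta_reg A) (theta_reg A') Dx t0.
  exact: (eq_difference E (beta_def H i Bx t0) (beta_def H' i Bx t0)).
- move=> i x t Bx t0; have Dx := BD Bx.
  have E := dx_sub i (phi_reg A) (phi_reg A') Dx t0.
  exact: (eqN_difference E (E_def H i Bx t0) (E_def H' i Bx t0)).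
- move=> i j x t Bx t0; have Dx := BD Bx.
  have E := dxx_sub j i (phi_reg A) (phi_reg A') Dx t0.
  exact: (eqN_difference E (V_def H i j Bx t0) (V_def H' i j Bx t0)).
Qed.

Lemma psub_constitutive p p' : admissible B p -> admissible B p' -> constitutive B m p ->
  constitutive B m p' -> constitutive B m (psub p p').
Proof.
move=> A A' H H'.
have ET x t : B x -> 0 <= t -> dt (p_theta (psub p p')) x t =
    dt (p_theta p) x t - dt (p_theta p') x t.
  by move=> /BD Dx t0; exact: dt_fsub (theta_reg A) (theta_reg A') Dx t0.
split.
- move=> i j x t Bx t0; rewrite ET//= /fsub !sumZB2 (tau_law H)// (tau_law H')//; ring.
- move=> i j k x t Bx t0; rewrite /= /fsub !sumZB3 sumZB (mu_law H)// (mu_law H')//; ring.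
- move=> i x t Bx t0; rewrite /= /fsub !sumZB3 sumZB.
  rewrite opprB addrC -[X in _ + X]opprK (sigma_law H)// (sigma_law H')//; ring.
- move=> i j x t Bx t0; rewrite ET//= /fsub !sumZB2.
  rewrite opprB addrC -[X in _ + X]opprK (Q_law H)// (Q_law H')//; ring.
- move=> x t Bx t0; rewrite ET//= /fsub !sumZB2 mulrBr.
  rewrite opprB addrC -[X in _ + X]opprK (eta_law H)// (eta_law H')//; ring.
- move=> i x t Bx t0; rewrite /= /fsub !sumZB mulrBr.
  rewrite opprB addrC -[X in _ + X]opprK (q_law H)// (q_law H')//; ring.
Qed.

Lemma psub_initial p p' : admissible B p -> admissible B p' -> initial_conditions B d p ->
  initial_conditions B d p' -> initial_conditions B zero_data (psub p p').
Proof.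
move=> A A' H H'; split.
- by move=> i x Dx; rewrite /= /fsub (u_init H)// (u_init H')// subrr.
- move=> i x Dx; rewrite [LHS](dt_fsub (u_reg A i) (u_reg A' i) Dx (lexx 0)).
  by rewrite (v_init H)// (v_init H')// subrr.
- by move=> x Dx; rewrite /= /fsub (theta_init H)// (theta_init H')// subrr.
- by move=> x Dx; rewrite /= /fsub (eta_init H)// (eta_init H')// subrr.
Qed.

Hypothesis hS : boundary_partition B S Sigma.

Lemma psub_boundary p p' : admissible B p -> admissible B p' ->
  boundary_conditions B n S Sigma d p -> boundary_conditions B n S Sigma d p' ->
  boundary_conditions B n S Sigma zero_data (psub p p').
Proof.
move=> A A' H H'.
have SS k x : (1 <= k <= 5)%N -> S k x -> bdry B x by move=> /hS[s _ _ _]; exact: s.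
have TT k x : (1 <= k <= 5)%N -> Sigma k x -> bdry B x by move=> /hS[_ s _ _]; exact: s.
have ND f g x t M N : classC B M.+1 N f -> classC B M.+1 N g -> bdry B x -> 0 <= t ->
    normal_deriv B n (fsub f g) x t = normal_deriv B n f x t - normal_deriv B n g x t.
  move=> Cf Cg bx t0; rewrite /normal_deriv -sumZB; apply: eq_bigr => j _.
  by rewrite (dx_sub j Cf Cg (bdry_closure bx) t0).
have DN (a b : 'I_3 -> 'I_3 -> tfield R) x t :
    double_normal n (fun k j => fsub (a k j) (b k j)) x t =
    double_normal n a x t - double_normal n b x t.
  rewrite /double_normal -sumB2; apply: eq_bigr => k _; apply: eq_bigr => j _.
  by rewrite /fsub !mulrBl.
have TR (s s' : 'I_3 -> tfield R) (a b : 'I_3 -> 'I_3 -> tfield R) x t :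
    (forall k j, classC B 2 0 (a k j)) -> (forall k j, classC B 2 0 (b k j)) ->
    bdry B x -> 0 <= t ->
    normal_traction B n (fun j => fsub (s j) (s' j)) (fun k j => fsub (a k j) (b k j)) x t =
    normal_traction B n s a x t - normal_traction B n s' b x t.
  move=> Ca Cb bx t0.
  exact: (traction_sub (fun j => (s j)^~ t) (fun j => (s' j)^~ t)
    (fun k j => CkW (classC_Ck (Ca k j) (leqnn 0) t0))
    (fun k j => CkW (classC_Ck (Cb k j) (leqnn 0) t0)) bx).
split.
- by move=> i x t Sx t0; rewrite /= /fsub (u_bc H)// (u_bc H')// subrr.
- move=> i x t Sx t0; rewrite /P_traction/= TR//; last 3 first.
  + by move=> k j; exact: (mu_reg A).
  + by move=> k j; exact: (mu_reg A').
  + exact: (@TT 1%N).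
  by rewrite [X in X - _](P_bc H i Sx t0) [X in _ - X](P_bc H' i Sx t0) subrr.
- move=> i x t Sx t0; rewrite /= (ND _ _ _ _ _ _ (u_reg A i) (u_reg A' i) (@SS 2%N _ isT Sx) t0).
  by rewrite (du_bc H)// (du_bc H')// subrr.
- move=> i x t Sx t0; rewrite /R_traction/= DN.
  by rewrite [X in X - _](R_bc H i Sx t0) [X in _ - X](R_bc H' i Sx t0) subrr.
- by move=> x t Sx t0; rewrite /= /fsub (theta_bc H)// (theta_bc H')// subrr.
- move=> x t Sx t0; rewrite /heat_flux/= /fsub.
  transitivity (heat_flux n p x t - heat_flux n p' x t).
    by rewrite -sumrB; apply: eq_bigr => i _; rewrite mulrBl.
  by rewrite (q_bc H)// (q_bc H')// subrr.
- by move=> x t Sx t0; rewrite /= /fsub (phi_bc H)// (phi_bc H')// subrr.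
- move=> x t Sx t0; rewrite /Lambda_traction/= TR//; last 3 first.
  + by move=> k j; exact: (Q_reg A).
  + by move=> k j; exact: (Q_reg A').
  + exact: (@TT 4%N).
  by rewrite [X in X - _](Lambda_bc H Sx t0) [X in _ - X](Lambda_bc H' Sx t0) subrr.
- move=> x t Sx t0; rewrite /= (ND _ _ _ _ _ _ (phi_reg A) (phi_reg A') (@SS 5%N _ isT Sx) t0).
  by rewrite (dphi_bc H)// (dphi_bc H')// subrr.
- move=> x t Sx t0; rewrite /H_traction/= DN.
  by rewrite [X in X - _](H_bc H Sx t0) [X in _ - X](H_bc H' Sx t0) subrr.
Qed.

Lemma psub_solution p p' : solution_Pi B n m S Sigma d p -> solution_Pi B n m S Sigma d p' ->
  solution_Pi B n m S Sigma zero_data (psub p p').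
Proof.
move=> [[A Ba] G Co I Bo] [[A' Ba'] G' Co' I' Bo']; split.
- by split; [exact: psub_admissible|exact: psub_balance].
- exact: psub_geometry.
- exact: psub_constitutive.
- exact: psub_initial.
- exact: psub_boundary.
Qed.

End Difference.

(** * Families depending on time *)

Section Primitive.
Variable R : realType.
Implicit Types (f g : R -> R).

Lemma primitive f : {within @timeI R, continuous f} ->
  exists2 g : R -> R, g 0 = 0 & (forall t : R, 0 <= t -> {for t, continuous g}) /\
    forall t : R, 0 < t -> is_derive t (1:R) g (f t).
Proof.
(* Constant continuation to negative times: t = 0 becomes an interior point of intervals starting at
   -1. *)
move=> cf; pose h s := f (Num.max 0 s).
have ch : continuous h.
  apply: withinT_cvg; apply: (within_comp (D := @timeI R)) cf => [|s _].
    apply: continuousP_within => s.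
    by apply: (@continuous_max _ _ (cst 0) id); [exact: cst_continuous|].
  by rewrite /timeI/= le_max lexx.
have ih u : (@lebesgue_measure R).-integrable `[(-1)%R, u] (EFin \o h).
  apply: continuous_compact_integrable; first exact: segment_compact.
  exact: continuous_subspaceT.
pose G x := \int[@lebesgue_measure R]_(t in `[(-1)%R, x]) h t.
have D (t : R) : 0 <= t -> is_derive t (1:R) G (h t).
  move=> t0; have t1 : t < t + 1 by rewrite ltrDl.
  have t2 : -1 < t by lra.
  have [d1 d2] := @continuous_FTC1_closed R h (-1) t (t + 1) t1 (ih _) t2 (ch t).
  by split; [exact: d1|rewrite -derive1E].
exists (fun t => G t - G 0); first by rewrite subrr.
split=> t t0.
  apply: differentiable_continuous; apply/derivable1_diffP.
  by have [] := is_deriveB (D _ t0) (is_derive_cst (G 0) t (1:R)).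
have := is_deriveB (D _ (ltW t0)) (is_derive_cst (G 0) t (1:R)).
by move=> /is_derive_eq; apply; rewrite subr0 /h max_r// ltW.
Qed.

Lemma increment_bound f df a b (C : R) : a <= b -> {within `[a, b], continuous f} ->
  (forall t, a < t < b -> is_derive t (1:R) f (df t)) ->
  (forall t, a < t < b -> `|df t| <= C) -> `|f b - f a| <= C * (b - a).
Proof.
rewrite le_eqVlt => /predU1P[->|ab] cf fd fC; first by rewrite !subrr normr0 mulr0.
have [c + ->] := MVT ab (fun z zab => fd z (eq_ind _ is_true zab _ (in_itv _ _))) cf.
rewrite in_itv/= => cab; rewrite normrM (gtr0_norm (x := b - a)) ?subr_gt0//.
by rewrite ler_wpM2r ?fC// subr_ge0 ltW.
Qed.

End Primitive.

Section Families.
Variables (R : realType) (B : set (E3 R)).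
Hypotheses (oB : open B) (bB : bounded_set B).
Implicit Types (F G : R -> E3 R -> R).

(** The conditions that [vint_MVT] puts on an integrand, in a form stable under sums, products and
    affine changes of time; with [tder], derivatives of long integrands are found by structural
    rules. *)
Definition tfam (a b : R) F : Prop :=
  [/\ forall s, a <= s <= b -> bounded_continuous B (F s),
      forall x, B x -> {within `[a, b], continuous (F^~ x)}
    & exists C, forall s x, a <= s <= b -> B x -> `|F s x| <= C].

Definition tder (a b : R) F dF : Prop :=
  [/\ tfam a b F, tfam a b dF
    & forall s x, a < s < b -> B x -> is_derive s (1:R) (F^~ x) (dF s x)].

Lemma tder_mean F dF a b : a < b -> tder a b F dF ->
  exists2 c, a < c < b & vint B (F b) - vint B (F a) = vint B (dF c) * (b - a).
Proof.
move=> ab [[bF cF [C FC]] [_ _ [C' dFC]] FdF].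
apply: (vint_MVT oB bB (C := Num.max C C') ab bF FdF cF) => s x sab Bx.
  by rewrite le_max FC.
by rewrite le_max dFC// orbT.
Qed.

Lemma tfam_cst a b h : bounded_continuous B h -> tfam a b (fun=> h).
Proof.
move=> bh; split=> [s _|x _|]; first exact: bh.
  by apply: continuousP_within; exact: cst_continuous.
by have [_ [C hC]] := bh; exists C => s x _; exact: hC.
Qed.

Lemma tfamD a b F G : tfam a b F -> tfam a b G -> tfam a b (fun s x => F s x + G s x).
Proof.
move=> [bF cF [C FC]] [bG cG [C' GC]]; split.
- by move=> s sab; apply: bc_add; [exact: bF|exact: bG].
- move=> x Bx; apply/within_continuousP => s sab.
  have /within_continuousP h1 := cF x Bx; have /within_continuousP h2 := cG x Bx.
  by apply: cvgD; [exact: h1|exact: h2].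
- exists (C + C') => s x sab Bx; apply: le_trans (ler_normD _ _) _.
  by apply: lerD; [exact: FC|exact: GC].
Qed.

Lemma tfamM a b F G : tfam a b F -> tfam a b G -> tfam a b (fun s x => F s x * G s x).
Proof.
move=> [bF cF [C FC]] [bG cG [C' GC]]; split.
- by move=> s sab; apply: bc_mul; [exact: bF|exact: bG].
- move=> x Bx; apply/within_continuousP => s sab.
  have /within_continuousP h1 := cF x Bx; have /within_continuousP h2 := cG x Bx.
  by apply: cvgM; [exact: h1|exact: h2].
- exists (C * C') => s x sab Bx; rewrite normrM; apply: ler_pM => //; [exact: FC|exact: GC].
Qed.

Lemma tfamZ a b c F : tfam a b F -> tfam a b (fun s x => c * F s x).
Proof. by move=> tF; apply: tfamM => //; apply: tfam_cst; exact: bc_cst. Qed.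

Lemma tder_cst a b h : bounded_continuous B h -> tder a b (fun=> h) (fun _ _ => 0).
Proof.
move=> bh; split; first exact: tfam_cst.
  by apply: tfam_cst; exact: bc_cst.
by move=> s x _ _; exact: is_derive_cst.
Qed.

Lemma tderD a b F G dF dG : tder a b F dF -> tder a b G dG ->
  tder a b (fun s x => F s x + G s x) (fun s x => dF s x + dG s x).
Proof.
move=> [tF tdF FF] [tG tdG GG]; split; [exact: tfamD|exact: tfamD|].
by move=> s x sab Bx; exact: is_deriveD (FF _ _ sab Bx) (GG _ _ sab Bx).
Qed.

Lemma tderM a b F G dF dG : tder a b F dF -> tder a b G dG ->
  tder a b (fun s x => F s x * G s x) (fun s x => dF s x * G s x + F s x * dG s x).
Proof.
move=> [tF tdF FF] [tG tdG GG]; split; [exact: tfamM|by apply: tfamD; exact: tfamM|].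
move=> s x sab Bx; have := is_deriveM (FF _ _ sab Bx) (GG _ _ sab Bx).
by move=> /is_derive_eq; apply; rewrite /GRing.scale/= addrC mulrC.
Qed.

Lemma tderZ a b c F dF : tder a b F dF ->
  tder a b (fun s x => c * F s x) (fun s x => c * dF s x).
Proof.
move=> [tF tdF FF]; split; [exact: tfamZ|exact: tfamZ|].
by move=> s x sab Bx; exact: is_deriveZ (FF _ _ sab Bx).
Qed.

Lemma tder_sum a b (F dF : 'I_3 -> R -> E3 R -> R) : (forall i, tder a b (F i) (dF i)) ->
  tder a b (fun s x => \sum_i F i s x) (fun s x => \sum_i dF i s x).
Proof.
move=> tF.
have E (H : 'I_3 -> R -> E3 R -> R) : (fun s x => \sum_i H i s x) =
    (fun s x => H (inord 0) s x + H (inord 1) s x + H (inord 2) s x).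
  by apply/funext => s; apply/funext => x; rewrite sum_I3.
by rewrite !E; apply: tderD => //; exact: tderD.
Qed.

(** Applied with e = 1 and e = -1, for the times t + z and t - z. *)
Lemma tder_affine a b F dF (t e : R) : 0 <= t -> tder a b F dF ->
  (forall z, 0 <= z <= t -> a <= t + e * z <= b) ->
  (forall z, 0 < z < t -> a < t + e * z < b) ->
  tder 0 t (fun z => F (t + e * z)) (fun z x => e * dF (t + e * z) x).
Proof.
move=> t0 [tF tdF FF] H1 H2.
have aff G : tfam a b G -> tfam 0 t (fun z => G (t + e * z)).
  move=> [bG cG [C GC]]; split.
  - by move=> s /H1; exact: bG.
  - move=> x Bx; apply: (within_comp (g := fun z => t + e * z) _ _ (cG x Bx)).
      apply: continuousP_within => z; apply: cvgD; first exact: cvg_cst.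
      by apply: cvgM; [exact: cvg_cst|exact: cvg_id].
    by move=> z; rewrite /= !in_itv/= => /H1.
  - by exists C => s x /H1; exact: GC.
split; [exact: aff|by apply: tfamZ; exact: aff|].
move=> s x /H2 h Bx.
have d1 : is_derive s (1:R) (fun z => t + e * z) e.
  have := is_deriveD (is_derive_cst t s (1:R)) (is_deriveZ e (is_derive_id s (1:R))).
  by move=> /is_derive_eq; apply; rewrite /GRing.scale/= add0r mulr1.
by rewrite mulrC; exact: (@is_derive1_comp _ (F^~ x) (fun z => t + e * z) s _ _ (FF _ _ h Bx) d1).
Qed.

(** The primitives are chosen for each x separately, so their continuity in x has to be recovered:
    it follows from a Lipschitz bound on F near x, uniform on bounded time intervals. *)
Lemma tfam_primitive F :
  (forall T, 0 < T -> tfam 0 T F) ->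
  (forall x, B x -> {within @timeI R, continuous (F^~ x)}) ->
  (forall T x, 0 < T -> B x -> exists L, \forall y \near x,
     forall s, 0 <= s <= T -> `|F s y - F s x| <= L * `|y - x|) ->
  exists2 G : R -> E3 R -> R, (forall x, G 0 x = 0) & forall T, 0 < T -> tder 0 T G F.
Proof.
move=> tF cF LF.
have P x : exists g : R -> R, g 0 = 0 /\ (B x -> (forall t : R, 0 <= t -> {for t, continuous g}) /\
    forall t : R, 0 < t -> is_derive t (1:R) g (F t x)).
  have [Bx|nB] := pselect (B x); last by exists (fun=> 0).
  by have [g g0 gP] := primitive (cF x Bx); exists g.
have [g gP] := choice P.
have g0 x : g x 0 = 0 by have [] := gP x.
have gc x (t : R) : B x -> 0 <= t -> {for t, continuous (g x)}.
  by move=> Bx; have [_ /(_ Bx)[h _]] := gP x; exact: h.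
have gd x (t : R) : B x -> 0 < t -> is_derive t (1:R) (g x) (F t x).
  by move=> Bx; have [_ /(_ Bx)[_ h]] := gP x; exact: h.
have gw x (a b : R) : B x -> 0 <= a -> {within `[a, b], continuous (g x)}.
  move=> Bx a0; apply/within_continuousP => t; rewrite /= in_itv/= => /andP[at_ _].
  by apply: cvg_within_filter; apply: gc => //; exact: le_trans at_.
exists (fun t x => g x t); first exact: g0.
move=> T T0; split.
- split.
  + move=> s /andP[s0 sT]; split; last first.
      have [_ _ [C FC]] := tF T T0; exists (C * s) => x Bx.
      have := @increment_bound _ (g x) (F^~ x) 0 s C s0 (gw _ _ _ Bx (lexx 0)).
      rewrite g0 !subr0; apply => t /andP[t0 ts]; first exact: gd.
      by apply: FC => //; rewrite ltW//= (le_trans (ltW ts)).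
    move=> x Bx; have [L LF'] := LF T x T0 Bx.
    apply: (iffRL (@cvgrPdist_le _ _ _ (nbhs x) (nbhs_filter x) (g^~ s) (g x s))) => e e0.
    have M0 : 0 < `|L| * s + 1 by rewrite ltr_wpDl// mulr_ge0.
    have : \forall y \near x, `|y - x| < e / (`|L| * s + 1).
      apply/nbhs_ballP; exists (e / (`|L| * s + 1)) => /=; first by rewrite divr_gt0.
      by move=> y; rewrite -ball_normE/= distrC.
    have Bn : \forall y \near x, B y by apply: open_nbhs_nbhs.
    move=> H; apply: filterS3 H Bn LF' => y yx By Ly.
    have := @increment_bound _ (fun t => g x t - g y t) (fun t => F t x - F t y) 0 s
      (`|L| * `|y - x|) s0.
    rewrite !g0 !subr0 => /(_ _ _ _)/le_trans; apply.
    * apply/within_continuousP => t ts.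
      have /within_continuousP h1 := gw _ 0 s Bx (lexx 0).
      have /within_continuousP h2 := gw _ 0 s By (lexx 0).
      by apply: cvgB; [exact: h1|exact: h2].
    * by move=> t /andP[t0 _]; apply: is_deriveB; exact: gd.
    * move=> t /andP[t0 ts]; rewrite distrC; apply: le_trans (Ly t _) _.
        by rewrite ltW//= (le_trans (ltW ts)).
      by rewrite ler_wpM2r// ler_norm.
    * have : `|y - x| * (`|L| * s + 1) <= e by rewrite -ler_pdivlMr// ltW.
      by apply: le_trans; rewrite mulrDr mulr1 mulrAC mulrC lerDl.
  + by move=> x Bx; exact: gw.
  + have [_ _ [C FC]] := tF T T0; exists (`|C| * T) => s x /andP[s0 sT] Bx.
    have := @increment_bound _ (g x) (F^~ x) 0 s `|C| s0 (gw _ _ _ Bx (lexx 0)).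
    rewrite g0 !subr0 => H; apply: le_trans (H _ _) _.
    * by move=> t /andP[t0 _]; exact: gd.
    * move=> t /andP[t0 ts]; apply: le_trans (ler_norm C).
      by apply: FC => //; rewrite ltW//= (le_trans (ltW ts)).
    * by rewrite ler_wpM2l.
- exact: tF.
- by move=> s x /andP[s0 _] Bx; exact: gd.
Qed.

End Families.

(** * Families given by fields of class C^{M,N} *)

Section ClassFamilies.
Variables (R : realType) (B : set (E3 R)).
Hypothesis hB : smooth_bounded_region B.

Let oB : open B. Proof. by case: hB. Qed.
Let bB : bounded_set B. Proof. by case: hB. Qed.
Let BD : B `<=` closure B. Proof. exact: subset_closure. Qed.
Let DB : closure B `<=` closure B. Proof. by []. Qed.
Local Notation C := (Ck B (closure B)).
Implicit Types f : tfield R.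

Lemma jc_bound f (a b : R) : jointly_continuous B f -> 0 <= a ->
  exists C : R, forall x t, closure B x -> a <= t <= b -> `|f x t| <= C.
Proof.
move=> cf a0; pose K := closure B `*` `[a, b]%classic.
have cK : compact K by apply: compact_setX; [exact: closure_compact|exact: segment_compact].
have KD : K `<=` cyl (closure B).
  by move=> [x t] [/= Dx]; rewrite in_itv/= => /andP[at_ _]; split => //=; exact: le_trans at_.
have := continuous_compact (continuous_subspaceW KD cf) cK => /compact_bounded[M [_ HM]].
exists (M + 1) => x t Dx tab; apply: (HM (M + 1)); first by rewrite ltrDl.
by exists (x, t) => //; split => //=; rewrite in_itv.
Qed.

Lemma classC_tfam M N f s k (a b : R) : classC B M N f -> (size s <= M)%N -> (k <= N)%N ->
  0 <= a -> tfam B a b (fun t x => dxs B s (iter k (@dt R) f) x t).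
Proof.
move=> Cf sM kN a0; have jc := classC_jc Cf sM kN; split.
- move=> t /andP[at_ _]; have t0 := le_trans a0 at_.
  apply: (C_bc hB (k := 0)); apply: (classC_Ck_dxs Cf kN t0); by rewrite addn0.
- move=> x /BD Dx; apply: continuous_subspaceW (jc_time jc Dx) => t.
  by rewrite /= in_itv/= => /andP[at_ _]; exact: le_trans at_.
- by have [c Hc] := jc_bound b jc a0; exists c => t x tab /BD Dx; exact: Hc.
Qed.

Lemma classC_tder M N f k (T : R) : classC B M N f -> (k < N)%N ->
  tder B 0 T (fun t x => iter k (@dt R) f x t) (fun t x => iter k.+1 (@dt R) f x t).
Proof.
move=> Cf kN; split.
- exact: (classC_tfam (s := [::]) T Cf (leq0n M) (ltnW kN) (lexx 0)).
- exact: (classC_tfam (s := [::]) T Cf (leq0n M) kN (lexx 0)).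
- move=> s x /andP[s0 _] Bx; apply: derivable_t_is_derive => //.
  by apply: (classC_dt Cf kN (BD Bx)); exact: ltW.
Qed.

(** [classC] speaks of derivatives taken in time first. That a space derivative can be
    differentiated in time, with the same result, is [mixed_derivative] for the displacement along
    the axis and the time. *)
Lemma dx_tder M N f (j : 'I_3) (T : R) : classC B M.+1 N.+1 f ->
  tder B 0 T (fun t x => dx B j f x t) (fun t x => dx B j (dt f) x t).
Proof.
move=> Cf; split.
- exact: (classC_tfam (s := [:: j]) (k := 0) T Cf isT (leq0n _) (lexx 0)).
- exact: (classC_tfam (s := [:: j]) (k := 1) T Cf isT isT (lexx 0)).
- move=> s x /andP[s0 _] Bx.
  have [r r0 rB] : exists2 r, 0 < r & ball x r `<=` B.
    by have /nbhs_ballP[r /= r0 rB] := near_body oB Bx; exists r.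
  pose q := Num.min r s; have q0 : 0 < q by rewrite lt_min r0.
  have line (a : R) : `|a| < q -> B (x + a *: axis R j).
    rewrite lt_min => /andP[ar _]; apply: rB; apply/(ball_rV _ _ r0) => i.
    rewrite line_coord opprD addrA subrr sub0r normrN normrM.
    by apply: le_lt_trans ar; rewrite ler_piMr//; case: (i == j); rewrite ?normr1// normr0.
  have time (b : R) : `|b| < q -> 0 < s + b.
    by rewrite lt_min => /andP[_]; rewrite ltr_norml => /andP[bs _]; lra.
  clearbody q.
  have H := @mixed_derivative R (fun a b => f (x + a *: axis R j) (s + b))
    (fun a b => dt f (x + a *: axis R j) (s + b))
    (fun a b => dx B j (dt f) (x + a *: axis R j) (s + b)) (fun b => dx B j f x (s + b)) q q0.
  have {H} := H _ _ _ _; rewrite /= scale0r !addr0 => H.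
  apply/is_derive_shiftP; apply: H.
  + move=> b bq.
    have h := Ck_is_derive j (classC_Ck (k := 0) Cf isT (ltW (time b bq))) Bx.
    exact: (is_derive_at_line _ _ _ _).1 h.
  + move=> a b aq bq; have tb := time b bq; have Dy := BD (line a aq).
    have h := derivable_t_is_derive tb (classC_dt (k := 0) Cf isT Dy (ltW tb)).
    have {}h := (is_derive_shiftP _ _ _).1 h.
    apply: ((is_derive_shiftP (fun b => f (x + a *: axis R j) (s + b)) b _).2 _).
    rewrite (_ : (fun h => _) = (fun h => f (x + a *: axis R j) (s + b + h))); first exact: h.
    by apply/funext => z; rewrite addrA.
  + move=> a b aq bq.
    have h := Ck_is_derive j (classC_Ck (k := 1) Cf isT (ltW (time b bq))) (line a aq).
    exact: (is_derive_line _ _ _ _ _).1 h.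
  + move=> e e0; have jc := classC_jc (s := [:: j]) (k := 1) Cf isT isT.
    have xs : cyl (closure B) (x, s) by split; [exact: BD|exact: ltW].
    move/within_continuousP : jc => /(_ _ xs)/cvgrPdist_le/(_ e e0).
    rewrite /within/= => -[[Q1 Q2] /= [h1 h2] sub].
    have /nbhs_ballP[d1 /= d10 D1] := h1; have /nbhs_ballP[d2 /= d20 D2] := h2.
    exists (Num.min q (Num.min d1 d2)); first by rewrite !lt_min q0 d10.
    move=> a b; rewrite !lt_min => /and3P[aq ad1 _] /and3P[bq _ bd2].
    rewrite distrC.
    apply: (sub (x + a *: axis R j, s + b)).
      split => /=.
        apply: D1; apply/(ball_rV _ _ d10) => i.
        rewrite line_coord opprD addrA subrr sub0r normrN normrM.
        by apply: le_lt_trans ad1; rewrite ler_piMr//; case: (i == j); rewrite ?normr1// normr0.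
      by apply: D2; rewrite /ball/= opprD addrA subrr sub0r normrN.
    by split; [exact: BD (line a aq)|exact: ltW (time b bq)].
Qed.

Lemma dx_primitive N f (j : 'I_3) : classC B 2 N f ->
  exists2 G : R -> E3 R -> R, (forall x, G 0 x = 0) &
    forall T, 0 < T -> tder B 0 T G (fun t x => dx B j f x t).
Proof.
move=> Cf.
apply: (tfam_primitive oB).
- move=> T _; exact: (classC_tfam (s := [:: j]) (k := 0) T Cf isT (leq0n _) (lexx 0)).
- move=> x /BD Dx; exact: (jc_time (classC_jc (s := [:: j]) (k := 0) Cf isT (leq0n _)) Dx).
move=> T x T0 Bx.
(* Bounds on the second space derivatives over a compact time interval yield the Lipschitz condition
   of [tfam_primitive]. *)
have bd k : exists C : R, forall y t, closure B y -> 0 <= t <= T -> `|dx B k (dx B j f) y t| <= C.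
  exact: (jc_bound T (classC_jc (s := [:: k; j]) (k := 0) Cf isT (leq0n _)) (lexx 0)).
have [c Hc] := choice bd.
have [r r0 rB] : exists2 r, 0 < r & ball x r `<=` B.
  by have /nbhs_ballP[r /= r0 rB] := near_body oB Bx; exists r.
exists (\sum_k c k); apply/nbhs_ballP; exists r => // y xy s sT.
have s0 : 0 <= s by case/andP: sT.
have Cj : C 1 ((dx B j f)^~ s).
  exact: (classC_Ck_dxs (s := [:: j]) (k := 0) Cf (leq0n _) s0).
have dj k z : ball x r z -> derivable ((dx B j f)^~ s) z (axis R k).
  by move=> /rB Bz; exact: Ck_derivable Cj Bz.
have [xi xiP ->] := MVT_space r0 dj (ballxx x r0) xy.
apply: le_trans (ler_norm_sum _ _ _) _; rewrite mulr_suml; apply: ler_sum => k _.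
rewrite normrM; apply: ler_pM => //.
  have := Hc k (xi k) s (BD (rB _ (xiP k))) sT.
  by rewrite /dx (pd_in k _ (rB _ (xiP k))).
by have := norm_coord (y - x) k; rewrite !mxE.
Qed.

Lemma bc_dxs M N k s f t : classC B M N f -> (k <= N)%N -> (size s <= M)%N -> 0 <= t ->
  bounded_continuous B (fun x => dxs B s (iter k (@dt R) f) x t).
Proof.
move=> Cf kN sM t0; apply: (C_bc hB (k := 0)).
by apply: (classC_Ck_dxs Cf kN t0); rewrite addn0.
Qed.

Lemma zero_on_closure (A T : set (E3 R)) (f : E3 R -> R) : T `<=` A -> closed A ->
  {within A, continuous f} -> (forall x, T x -> f x = 0) -> forall x, closure T x -> f x = 0.
Proof.
move=> TA cA /within_continuousP cf f0 x Tx.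
have Ax : A x by rewrite ((closure_id A).1 cA); exact: closureS Tx.
apply/eqP; apply: contraT => fx0.
have fx : 0 < `|f x| by rewrite normr_gt0.
have := cf x Ax => /cvgrPdist_lt/(_ _ fx) h.
have [y [Ty]] := Tx _ h; move=> /(_ (TA _ Ty)).
by rewrite (f0 _ Ty) subr0 ltxx.
Qed.

Lemma dx_zero j (f : tfield R) (t : R) x : (forall y, B y -> f y t = 0) -> closure B x ->
  dx B j f x t = 0.
Proof.
move=> f0 Dx; rewrite [LHS](pd_ext oB j x f0).
exact: (pd_cst oB BD DB (0 : R) j Dx).
Qed.

Lemma dt_zero (f : tfield R) (t : R) x : (forall s, 0 <= s -> f x s = 0) -> 0 <= t -> dt f x t = 0.
Proof. by move=> f0 t0; rewrite [LHS](dtv_ext t0 f0) dtv_cst. Qed.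

Lemma field_zero M N (f : tfield R) : classC B M N f ->
  (forall x t, 0 <= t -> B x -> f x t = 0) -> eq_on_closure B f (fun _ _ => 0).
Proof.
move=> Cf f0 x t Dx t0; have C0 : C 0 (f^~ t).
  by apply: (classC_Ck_dxs (k := 0) (s := [::]) Cf (leq0n N) t0); rewrite addn0.
apply: (@zero_on_closure (closure B) B (f^~ t)) => //; first exact: closed_closure.
  exact: Ck_continuous C0.
by move=> y By; exact: f0.
Qed.

End ClassFamilies.

(** * Reciprocity and uniqueness *)

Section Bilinear.
Variable R : realType.
Local Notation I := 'I_3.

Lemma bilin_swap (I J : finType) (a : I -> J -> R) (x : J -> R) (y : I -> R) :
  \sum_i (\sum_j a i j * x j) * y i = \sum_j (\sum_i a i j * y i) * x j.
Proof.
under eq_bigr do rewrite mulr_suml.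
rewrite exchange_big; apply: eq_bigr => j _; rewrite mulr_suml.
by apply: eq_bigr => i _; rewrite mulrAC.
Qed.

(** Multiple sums are flattened to sums over pairs and triples, so that [bilin_swap] covers tensors
    of order 1, 2 and 3. *)
Lemma sum2E (F : I -> I -> R) : \sum_i \sum_j F i j = \sum_p F p.1 p.2.
Proof. exact: pair_bigA. Qed.

Lemma sum3E (F : I -> I -> I -> R) :
  \sum_i \sum_j \sum_k F i j k = \sum_p F p.1 p.2.1 p.2.2.
Proof.
rewrite -(pair_bigA _ (fun i q => F i q.1 q.2)); apply: eq_bigr => i _.
exact: pair_bigA.
Qed.

Lemma bilin_swap22 (a : I -> I -> I -> I -> R) (x y : I -> I -> R) :
  \sum_i \sum_j (\sum_k \sum_l a i j k l * x k l) * y i j =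
  \sum_k \sum_l (\sum_i \sum_j a i j k l * y i j) * x k l.
Proof.
rewrite !sum2E; under eq_bigr do rewrite sum2E.
by rewrite bilin_swap; apply: eq_bigr => p _; rewrite sum2E.
Qed.

Lemma bilin_swap31 (a : I -> I -> I -> I -> R) (x : I -> R) (y : I -> I -> I -> R) :
  \sum_i \sum_j \sum_k (\sum_l a i j k l * x l) * y i j k =
  \sum_l (\sum_i \sum_j \sum_k a i j k l * y i j k) * x l.
Proof.
rewrite sum3E bilin_swap; apply: eq_bigr => l _; congr (_ * _).
by rewrite sum3E.
Qed.

Lemma bilin_swap33 (a : I -> I -> I -> I -> I -> I -> R) (x y : I -> I -> I -> R) :
  \sum_i \sum_j \sum_k (\sum_l \sum_h \sum_r a i j k l h r * x l h r) * y i j k =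
  \sum_l \sum_h \sum_r (\sum_i \sum_j \sum_k a i j k l h r * y i j k) * x l h r.
Proof.
rewrite !sum3E; under eq_bigr do rewrite sum3E.
by rewrite bilin_swap; apply: eq_bigr => p _; rewrite sum3E.
Qed.

Lemma sum_mulD1 (x y z : I -> R) : \sum_i (x i + y i) * z i = \sum_i x i * z i + \sum_i y i * z i.
Proof. by rewrite -big_split; apply: eq_bigr => i _; rewrite /= mulrDl. Qed.

Lemma sum_mulD2 (x y z : I -> I -> R) : \sum_i \sum_j (x i j + y i j) * z i j =
  \sum_i \sum_j x i j * z i j + \sum_i \sum_j y i j * z i j.
Proof. by rewrite -big_split; apply: eq_bigr => i _; exact: sum_mulD1. Qed.

Lemma sum_mulD3 (x y z : I -> I -> I -> R) : \sum_i \sum_j \sum_k (x i j k + y i j k) * z i j k =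
  \sum_i \sum_j \sum_k x i j k * z i j k + \sum_i \sum_j \sum_k y i j k * z i j k.
Proof. by rewrite -big_split; apply: eq_bigr => i _; exact: sum_mulD2. Qed.

Lemma sum_mulT2 (a : I -> I -> R) (T : R) (z : I -> I -> R) :
  \sum_i \sum_j (a i j * T) * z i j = T * \sum_i \sum_j a i j * z i j.
Proof.
rewrite mulr_sumr; apply: eq_bigr => i _; rewrite mulr_sumr; apply: eq_bigr => j _.
by rewrite mulrAC mulrC.
Qed.

End Bilinear.

Section Reciprocity.
Variables (R : realType) (m : material R).
Hypothesis hm : material_axioms m.
Local Notation I := 'I_3.

(* tau.e' + mu.kap' - sigma.E' - Q.V', where tau, mu, sigma, Q are given by the constitutive
   equations at (e, V, kap, E) and T = theta + beta theta_t *)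
Definition stress_work (e V : I -> I -> R) (kap : I -> I -> I -> R) (E : I -> R) (T : R)
    (e' V' : I -> I -> R) (kap' : I -> I -> I -> R) (E' : I -> R) : R :=
  \sum_i \sum_j (\sum_k \sum_l a11 m i j k l * e k l + \sum_k \sum_l a17 m i j k l * V k l
     + a14 m i j * T) * e' i j
  + \sum_i \sum_j \sum_k (\sum_l \sum_h \sum_r a22 m i j k l h r * kap l h r
     + \sum_l a23 m i j k l * E l) * kap' i j k
  + \sum_i (\sum_j \sum_k \sum_l a23 m j k l i * kap j k l + \sum_j a33 m i j * E j) * E' i
  + \sum_i \sum_j (\sum_k \sum_l a17 m k l i j * e k l + \sum_k \sum_l a77 m i j k l * V k l
     + a47 m i j * T) * V' i j.

(** The forms given by a11, a22, a33 and a77 are symmetric. Each of a17 and a23 occurs twice, in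
    transposed roles, so that the two occurrences together are symmetric as well; only the coupling
    with the temperature survives. *)
Lemma stress_work_swap (e V : I -> I -> R) (kap : I -> I -> I -> R) (E : I -> R) (T : R)
    (e' V' : I -> I -> R) (kap' : I -> I -> I -> R) (E' : I -> R) (T' : R) :
  stress_work e V kap E T e' V' kap' E' - stress_work e' V' kap' E' T' e V kap E =
  T * (\sum_i \sum_j a14 m i j * e' i j + \sum_i \sum_j a47 m i j * V' i j)
  - T' * (\sum_i \sum_j a14 m i j * e i j + \sum_i \sum_j a47 m i j * V i j).
Proof.
rewrite /stress_work !sum_mulD2 !sum_mulD3 !sum_mulD1 !sum_mulT2.
have E11 : \sum_i \sum_j (\sum_k \sum_l a11 m i j k l * e k l) * e' i j =
    \sum_i \sum_j (\sum_k \sum_l a11 m i j k l * e' k l) * e i j.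
  rewrite bilin_swap22; apply: eq_bigr => i _; apply: eq_bigr => j _; congr (_ * _).
  by apply: eq_bigr => k _; apply: eq_bigr => l _; rewrite (a11_sym2 hm).
have E77 : \sum_i \sum_j (\sum_k \sum_l a77 m i j k l * V k l) * V' i j =
    \sum_i \sum_j (\sum_k \sum_l a77 m i j k l * V' k l) * V i j.
  rewrite bilin_swap22; apply: eq_bigr => i _; apply: eq_bigr => j _; congr (_ * _).
  by apply: eq_bigr => k _; apply: eq_bigr => l _; rewrite (a77_sym2 hm).
have E33 : \sum_i (\sum_j a33 m i j * E j) * E' i = \sum_i (\sum_j a33 m i j * E' j) * E i.
  rewrite bilin_swap; apply: eq_bigr => i _; congr (_ * _).
  by apply: eq_bigr => k _; rewrite (a33_sym hm).
have E22 : \sum_i \sum_j \sum_k (\sum_l \sum_h \sum_r a22 m i j k l h r * kap l h r) * kap' i j k =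
    \sum_i \sum_j \sum_k (\sum_l \sum_h \sum_r a22 m i j k l h r * kap' l h r) * kap i j k.
  rewrite bilin_swap33; apply: eq_bigr => i _; apply: eq_bigr => j _; apply: eq_bigr => k _.
  congr (_ * _); apply: eq_bigr => l _; apply: eq_bigr => h _; apply: eq_bigr => r _.
  by rewrite (a22_sym2 hm).
rewrite (bilin_swap22 (a17 m) V e') (bilin_swap22 (a17 m) V' e).
rewrite (bilin_swap31 (a23 m) E kap') (bilin_swap31 (a23 m) E' kap).
rewrite E11 E77 E33 E22; ring.
Qed.

End Reciprocity.

Section EnergyAlgebra.
Variable R : realType.

Lemma sum3_rot (F : 'I_3 -> 'I_3 -> 'I_3 -> R) :
  \sum_i \sum_j \sum_k F j k i = \sum_i \sum_j \sum_k F i j k.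
Proof. by rewrite exchange_big; apply: eq_bigr => j _; rewrite exchange_big. Qed.

Lemma sum_sym_strain (t d : 'I_3 -> 'I_3 -> R) : (forall i j, t i j = t j i) ->
  \sum_i \sum_j t j i * d i j = \sum_i \sum_j t i j * (2^-1 * (d i j + d j i)).
Proof.
move=> ts.
transitivity (2^-1 * (\sum_i \sum_j t j i * d i j) + 2^-1 * (\sum_i \sum_j t j i * d i j)); first by field.
rewrite [X in _ + 2^-1 * X]exchange_big/= !mulr_sumr -big_split; apply: eq_bigr => i _.
rewrite /= !mulr_sumr -big_split; apply: eq_bigr => j _ /=.
by rewrite (ts j i); field.
Qed.

Lemma sum_kswap (k : 'I_3 -> 'I_3 -> R) (X Y : 'I_3 -> R) : (forall i j, k i j = k j i) ->
  \sum_i \sum_j k i j * X j * Y i = \sum_i \sum_j k i j * X i * Y j.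
Proof.
move=> ks; rewrite exchange_big; apply: eq_bigr => i _; apply: eq_bigr => j _.
by rewrite ks.
Qed.

(** Y is the part of - rho eta that depends on e and V. Its elimination leaves the factor c ((b + g
    / (c b)) - b) = g / b, in which c no longer occurs. *)
Lemma heat_algebra (rho c b g er es Tr Ts Yr Ys vr vs wr ws : R) : c != 0 -> b != 0 ->
  Tr = vr + b * wr -> Ts = vs + b * ws ->
  - (rho * er) = Yr + c * (vr + (b + g / (c * b)) * wr) ->
  - (rho * es) = Ys + c * (vs + (b + g / (c * b)) * ws) ->
  Tr * Ys - Ts * Yr - rho * er * Ts + rho * es * Tr = g / b * (wr * vs - vr * ws).
Proof.
move=> c0 b0 -> -> hr hs.
have -> : Yr = - (rho * er) - c * (vr + (b + g / (c * b)) * wr) by rewrite hr; ring.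
have -> : Ys = - (rho * es) - c * (vs + (b + g / (c * b)) * ws) by rewrite hs; ring.
by field; rewrite c0 b0.
Qed.

Lemma energy_algebra (a a' wr ws er es k k' z : R) : wr - ws - er + es = z ->
  (a - a') + (k' - k) + z = (a + wr) - (a' + ws) - (er + k) + (es + k').
Proof. by move=> <-; ring. Qed.

Lemma inertia_algebra (rho : R) (ur us u1r u1s u2r u2s : 'I_3 -> R) :
  rho * (\sum_i ((1 * u2r i) * us i + u1r i * ((-1) * u1s i)
       + ((1 * u1r i) * u1s i + ur i * ((-1) * u2s i)))) =
  \sum_i rho * u2r i * us i - \sum_i rho * u2s i * ur i.
Proof. by rewrite mulr_sumr -sumrB; apply: eq_bigr => i _; ring. Qed.

Lemma conduction_algebra (k : 'I_3 -> 'I_3 -> R) (ks : forall i j, k i j = k j i) (b : R)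
    (gr gs dr ds d1r d1s : 'I_3 -> R) :
  \sum_i \sum_j k i j * ((1 * dr i) * gs j + gr i * ((-1) * ds j)
     + b * ((1 * d1r i) * gs j + dr i * ((-1) * ds j)
       + ((1 * dr i) * ds j + gr i * ((-1) * d1s j)))) =
  \sum_j \sum_l k j l * gs l * (dr j + b * d1r j) -
  \sum_j \sum_l k j l * gr l * (ds j + b * d1s j).
Proof.
rewrite (sum_kswap gr (fun j => ds j + b * d1s j) ks) -sumB2.
by apply: eq_bigr => i _; apply: eq_bigr => j _; ring.
Qed.

Lemma relaxation_algebra (vr vs wr ws : R) :
  (1 * wr) * vs + vr * ((-1) * ws) = wr * vs - vr * ws.
Proof. ring. Qed.

End EnergyAlgebra.

Lemma vint_comb0 (R : realType) (B : set (E3 R)) (a b c d : E3 R -> R) :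
  open B -> bounded_set B ->
  bounded_continuous B a -> bounded_continuous B b -> bounded_continuous B c ->
  bounded_continuous B d -> vint B a = 0 -> vint B b = 0 -> vint B c = 0 -> vint B d = 0 ->
  vint B (fun x => a x - b x - c x + d x) = 0.
Proof.
move=> oB bB ba bb bc bd va vb vc vd; have bab := bc_sub oB ba bb; have babc := bc_sub oB bab bc.
by rewrite (vintD oB bB babc bd) (vint_sub oB bB bab bc) (vint_sub oB bB ba bb) va vb vc vd !subr0 addr0.
Qed.

Lemma energy_split (R : realType) (k g d : 'I_3 -> 'I_3 -> R) (rho u b z : R) :
  rho * u + b * (\sum_i \sum_j k i j * d i j) + (\sum_i \sum_j k i j * g i j + z) =
  rho * u + \sum_i \sum_j k i j * (g i j + b * d i j) + z.
Proof.
have -> : \sum_i \sum_j k i j * (g i j + b * d i j) =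
    \sum_i \sum_j k i j * g i j + b * (\sum_i \sum_j k i j * d i j).
  rewrite mulr_sumr -big_split; apply: eq_bigr => i _.
  rewrite /= mulr_sumr -big_split; apply: eq_bigr => j _; rewrite /=; ring.
ring.
Qed.

(** * The problem with zero data *)

Section Homogeneous.
Variables (R : realType) (B : set (E3 R)) (n : E3 R -> E3 R) (m : material R).
Variables (S Sigma : nat -> set (E3 R)) (p : process_array R).
Hypotheses (hB : smooth_bounded_region B) (hn : outward_unit_normal B n).
Hypotheses (hm : material_axioms m) (hS : boundary_partition B S Sigma).
Hypotheses (hbeta : 0 < m_beta m) (hgamma : 0 < m_gamma m).
Hypothesis sol : solution_Pi B n m S Sigma (zero_data R) p.

Let oB : open B. Proof. by case: hB. Qed.
Let bB : bounded_set B. Proof. by case: hB. Qed.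
Let BD : B `<=` closure B. Proof. exact: subset_closure. Qed.
Let DB : closure B `<=` closure B. Proof. by []. Qed.
Let adm : admissible B p. Proof. by case: sol => -[]. Qed.
Let bal : balance B m (zero_data R) p. Proof. by case: sol => -[]. Qed.
Let geo : geometry B p. Proof. by case: sol. Qed.
Let con : constitutive B m p. Proof. by case: sol. Qed.
Let ini : initial_conditions B (zero_data R) p. Proof. by case: sol. Qed.
Let bdc : boundary_conditions B n S Sigma (zero_data R) p. Proof. by case: sol. Qed.
Local Notation C := (Ck B (closure B)).
Local Notation bc := (bounded_continuous B).

Lemma bdry_split k x : (1 <= k <= 5)%N -> bdry B x -> closure (S k) x \/ Sigma k x.
Proof. by move=> /hS[_ _ <- _]. Qed.

Lemma S_bdry k : (1 <= k <= 5)%N -> S k `<=` bdry B.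
Proof. by move=> /hS[]. Qed.

(** The boundary is the union of Sigma and of the closure of S, so conditions imposed on S must
    first be extended by continuity. *)
Lemma closure_S_zero k f : (1 <= k <= 5)%N -> C 0 f -> (forall x, S k x -> f x = 0) ->
  forall x, closure (S k) x -> f x = 0.
Proof.
move=> hk Cf f0; apply: (@zero_on_closure R (closure B)) => //.
- by move=> x /(S_bdry hk); exact: bdry_closure.
- exact: closed_closure.
- exact: Ck_continuous Cf.
Qed.

Lemma closure_S_normal_zero k f : (1 <= k <= 5)%N -> C 1 f ->
  (forall x, S k x -> \sum_j n x 0 j * pd B j f x = 0) ->
  forall x, closure (S k) x -> \sum_j n x 0 j * pd B j f x = 0.
Proof.
move=> hk Cf f0.
have [N [CN Nn]] := normal_extension hB hn.
have E x : bdry B x -> \sum_j n x 0 j * pd B j f x = \sum_j N j x * pd B j f x.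
  move=> bx; have Nx := nbhs_singleton (Nn x bx).
  by apply: eq_bigr => j _; rewrite Nx.
have CS : C 0 (fun x => \sum_j N j x * pd B j f x).
  apply: (Ck_sum oB BD DB) => j.
  exact: (CkM oB BD DB (CkW (CkW (CN j))) (Ck_pd j Cf)).
have Z := closure_S_zero hk CS.
have bS x : closure (S k) x -> bdry B x.
  have cb : closed (bdry B).
    rewrite /bdry setDE; apply: closedI; first exact: closed_closure.
    by apply: open_closedC; exact: open_interior.
  by rewrite [X in _ -> X x](iffLR (closure_id _) cb); apply: closureS; exact: S_bdry.
move=> x Sx; rewrite E; last exact: bS.
apply: Z Sx => y Sy; rewrite -E; last exact: S_bdry Sy.
exact: f0.
Qed.

Let Cu i t : 0 <= t -> C 4 ((p_u p i)^~ t).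
Proof. by move=> t0; exact: (classC_Ck (k := 0) (u_reg adm i) isT t0). Qed.

Lemma momentum_pairing i (r s : R) : 0 <= r -> 0 <= s ->
  vint B (fun x => m_rho m * dt (dt (p_u p i)) x r * p_u p i x s
    + \sum_j p_tau p j i x r * dx B j (p_u p i) x s
    + \sum_j \sum_k p_mu p j k i x r * dx B j (dx B k (p_u p i)) x s) = 0.
Proof.
move=> r0 s0.
have Ct j : C 1 ((p_tau p j i)^~ r) := classC_Ck (k := 0) (tau_reg adm j i) isT r0.
have Cm k j : C 2 ((p_mu p k j i)^~ r) := classC_Ck (k := 0) (mu_reg adm k j i) isT r0.
have Cv : C 2 ((p_u p i)^~ s) by exact: CkW (CkW (Cu i s0)).
have H := second_order_pairing hB hn Ct Cm Cv _.
rewrite -[RHS]H.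
  apply: vint_ext => x Bx; congr (_ + _ + _); congr (_ * _).
  have := momentum bal i Bx r0; rewrite /= mulr0 addr0 => <-; reflexivity.
(* The two boundary products vanish separately: one by the conditions on u and P, the other by those
   on the normal derivative of u and on R. *)
move=> y by_; have dz : forall P Q : R, P = 0 -> Q = 0 -> P + Q = 0 by move=> P Q -> ->; rewrite addr0.
apply: dz.
  have [Sy|Ty] := bdry_split (k := 1) isT by_.
    have -> : p_u p i y s = 0.
      apply: (closure_S_zero (k := 1) isT (CkW (CkW Cv)) _ Sy) => x Sx.
      exact: (u_bc bdc i Sx s0).
    by rewrite mulr0.
  by rewrite [X in X * _](P_bc bdc i Ty r0) mul0r.
have [Sy|Ty] := bdry_split (k := 2) isT by_.
  rewrite [X in _ * X](closure_S_normal_zero (k := 2) isT (CkW Cv) _ Sy) ?mulr0// => x Sx.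
  exact: (du_bc bdc i Sx s0).
by rewrite [X in X * _](R_bc bdc i Ty r0) mul0r.
Qed.

Lemma charge_pairing (r s : R) : 0 <= r -> 0 <= s ->
  vint B (fun x => \sum_j p_sigma p j x r * dx B j (p_phi p) x s
    + \sum_j \sum_k p_Q p j k x r * dx B j (dx B k (p_phi p)) x s) = 0.
Proof.
move=> r0 s0.
have Ct j : C 1 ((p_sigma p j)^~ r) := classC_Ck (k := 0) (sigma_reg adm j) isT r0.
have Cm k j : C 2 ((p_Q p k j)^~ r) := classC_Ck (k := 0) (Q_reg adm k j) isT r0.
have Cv : C 2 ((p_phi p)^~ s).
  exact: CkW (CkW (classC_Ck (k := 0) (phi_reg adm) isT s0)).
have H := second_order_pairing hB hn Ct Cm Cv _.
rewrite -[RHS]H.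
  apply: vint_ext => x Bx.
  by rewrite [X in _ = X * _ + _ + _](Defs.charge bal Bx r0) mul0r add0r.
move=> y by_; have dz : forall P Q : R, P = 0 -> Q = 0 -> P + Q = 0 by move=> P Q -> ->; rewrite addr0.
apply: dz.
  have [Sy|Ty] := bdry_split (k := 4) isT by_.
    have -> : p_phi p y s = 0.
      apply: (closure_S_zero (k := 4) isT (CkW (CkW Cv)) _ Sy) => x Sx.
      exact: (phi_bc bdc Sx s0).
    by rewrite mulr0.
  by rewrite [X in X * _](Lambda_bc bdc Ty r0) mul0r.
have [Sy|Ty] := bdry_split (k := 5) isT by_.
  rewrite [X in _ * X](closure_S_normal_zero (k := 5) isT (CkW Cv) _ Sy) ?mulr0// => x Sx.
  exact: (dphi_bc bdc Sx s0).
by rewrite [X in X * _](H_bc bdc Ty r0) mul0r.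
Qed.

Let Th t x := p_theta p x t + m_beta m * dt (p_theta p) x t.
Let dTh j t x := dx B j (p_theta p) x t + m_beta m * dx B j (dt (p_theta p)) x t.

Lemma heat_pairing (r s : R) : 0 <= r -> 0 <= s ->
  vint B (fun x => m_rho m * dt (p_eta p) x r * Th s x
    + \sum_j \sum_k m_k m j k * dx B k (p_theta p) x r * dTh j s x) = 0.
Proof.
move=> r0 s0; have T0 := T0_gt0 hm.
have Cq j : C 1 ((p_q p j)^~ r) := classC_Ck (k := 0) (q_reg adm j) isT r0.
have C1 : C 1 ((p_theta p)^~ s) := CkW (classC_Ck (k := 0) (theta_reg adm) isT s0).
have C2 : C 1 ((dt (p_theta p))^~ s) := CkW (classC_Ck (k := 1) (theta_reg adm) isT s0).
have C3 := CkZ oB BD DB (m_beta m) C2.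
have Cw : C 1 (Th s) by exact: (CkD oB BD DB C1 C3).
(* The condition holds at all times, so the time derivative of theta vanishes there too. *)
have Th0 y : closure (S 3%N) y -> Th s y = 0.
  move=> Sy; have Z t : 0 <= t -> p_theta p y t = 0.
    move=> t0; have Ct : C 0 ((p_theta p)^~ t).
      exact: CkW (CkW (classC_Ck (k := 0) (theta_reg adm) isT t0)).
    by apply: (closure_S_zero (k := 3) isT Ct _ Sy) => x Sx; exact: (theta_bc bdc Sx t0).
  rewrite /Th (Z s s0); have -> : dt (p_theta p) y s = 0.
    by rewrite -(dtv_cst (0 : R) s0); exact: dtv_ext.
  by rewrite mulr0 addr0.
have H := divergence_pairing hB hn Cq Cw _.
transitivity ((- (m_T0 m)^-1) * vint B (fun x =>
   (\sum_j pd B j ((p_q p j)^~ r) x) * Th s x + \sum_j p_q p j x r * pd B j (Th s) x)).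
  rewrite -vintZ //; last first.
    apply: (C_bc hB (k := 0)); apply: (CkD oB BD DB).
      apply: (CkM oB BD DB) (CkW Cw); apply: (Ck_sum oB BD DB) => j; exact: Ck_pd (Cq j).
    apply: (Ck_sum oB BD DB) => j; exact: (CkM oB BD DB (CkW (Cq j)) (Ck_pd j Cw)).
  apply: vint_ext => x Bx.
  have E1 : \sum_j pd B j ((p_q p j)^~ r) x = - (m_rho m * m_T0 m * dt (p_eta p) x r).
    by have := energy bal Bx r0; rewrite /= mulr0 subr0 addrC => /eqP; rewrite addr_eq0 => /eqP.
  have E2 j : pd B j (Th s) x = dTh j s x.
    rewrite [LHS](pdD oB BD DB j C1 C3 (BD Bx)); congr (_ + _).
    exact: (pdZ oB BD DB (m_beta m) j C2 (BD Bx)).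
  have E3 j : p_q p j x r = - m_T0 m * \sum_k m_k m j k * dx B k (p_theta p) x r.
    have := q_law con j Bx r0 => h.
    rewrite -(eq_bigr _ (fun k _ => congr1 (fun z => m_k m j k * z) (beta_def geo k Bx r0))) -h.
    by field; rewrite gt_eqF.
  rewrite E1 [RHS]mulrDr; congr (_ + _); first by field; rewrite gt_eqF.
  rewrite mulr_sumr; apply: eq_bigr => j _; rewrite E2 E3 -mulr_suml.
  by field; rewrite gt_eqF.
rewrite H ?mulr0// => y by_.
have [Sy|Ty] := bdry_split (k := 3) isT by_; first by rewrite Th0// mulr0.
by rewrite [X in X * _](q_bc bdc Ty r0) mul0r.
Qed.

Let W r s x := stress_work m (fun i j => p_e p i j x r) (fun i j => p_V p i j x r)
  (fun i j k => p_kappa p i j k x r) (fun i => p_E p i x r) (Th r x)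
  (fun i j => p_e p i j x s) (fun i j => p_V p i j x s)
  (fun i j k => p_kappa p i j k x s) (fun i => p_E p i x s).

(** Sum of the three momentum pairings and the charge pairing: together their stress terms form
    [stress_work], to which reciprocity applies. *)
Lemma work_pairing (r s : R) : 0 <= r -> 0 <= s ->
  bc (fun x => \sum_i m_rho m * dt (dt (p_u p i)) x r * p_u p i x s + W r s x) /\
  vint B (fun x => \sum_i m_rho m * dt (dt (p_u p i)) x r * p_u p i x s + W r s x) = 0.
Proof.
move=> r0 s0.
pose P i x := m_rho m * dt (dt (p_u p i)) x r * p_u p i x s
    + \sum_j p_tau p j i x r * dx B j (p_u p i) x s
    + \sum_j \sum_k p_mu p j k i x r * dx B j (dx B k (p_u p i)) x s.
pose Q x := \sum_j p_sigma p j x r * dx B j (p_phi p) x s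
    + \sum_j \sum_k p_Q p j k x r * dx B j (dx B k (p_phi p)) x s.
have bP i : bc (P i).
  apply: bc_add; [apply: bc_add|].
  - apply: bc_mul; last exact: (bc_dxs hB (k := 0) (s := [::]) (u_reg adm i) isT isT s0).
    apply: bc_mul; first exact: bc_cst.
    exact: (bc_dxs hB (k := 2) (s := [::]) (u_reg adm i) isT isT r0).
  - apply: (bc_sum oB) => j; apply: bc_mul.
      exact: (bc_dxs hB (k := 0) (s := [::]) (tau_reg adm j i) isT isT r0).
    exact: (bc_dxs hB (k := 0) (s := [:: j]) (u_reg adm i) isT isT s0).
  - apply: (bc_sum oB) => j; apply: (bc_sum oB) => k; apply: bc_mul.
      exact: (bc_dxs hB (k := 0) (s := [::]) (mu_reg adm j k i) isT isT r0).
    exact: (bc_dxs hB (k := 0) (s := [:: j; k]) (u_reg adm i) isT isT s0).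
have bQ : bc Q.
  apply: bc_add.
  - apply: (bc_sum oB) => j; apply: bc_mul.
      exact: (bc_dxs hB (k := 0) (s := [::]) (sigma_reg adm j) isT isT r0).
    exact: (bc_dxs hB (k := 0) (s := [:: j]) (phi_reg adm) isT isT s0).
  - apply: (bc_sum oB) => j; apply: (bc_sum oB) => k; apply: bc_mul.
      exact: (bc_dxs hB (k := 0) (s := [::]) (Q_reg adm j k) isT isT r0).
    exact: (bc_dxs hB (k := 0) (s := [:: j; k]) (phi_reg adm) isT isT s0).
have E x : B x -> \sum_i P i x + Q x =
    \sum_i m_rho m * dt (dt (p_u p i)) x r * p_u p i x s + W r s x.
  move=> Bx; rewrite /W /stress_work.
  have D2 f (j k : 'I_3) M N : classC B M.+2 N f -> dx B j (dx B k f) x s = dx B k (dx B j f) x s.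
    move=> Cf; apply: (pd_swap oB BD j k _ Bx).
    exact: (classC_Ck_dxs (k := 0) (s := [::]) Cf isT s0).
  have E1 : \sum_i \sum_j (\sum_k \sum_l a11 m i j k l * p_e p k l x r +
      \sum_k \sum_l a17 m i j k l * p_V p k l x r + a14 m i j * Th r x) * p_e p i j x s =
      \sum_i \sum_j p_tau p j i x r * dx B j (p_u p i) x s.
    rewrite (sum_sym_strain (t := fun i j => p_tau p i j x r)
      (fun i j => dx B j (p_u p i) x s)); last by move=> i j; exact: (tau_sym adm i j (BD Bx) r0).
    apply: eq_bigr => i _; apply: eq_bigr => j _.
    by rewrite (tau_law con i j Bx r0) (e_def geo i j Bx s0).
  have E2 : \sum_i \sum_j \sum_k (\sum_l \sum_h \sum_r0 a22 m i j k l h r0 * p_kappa p l h r0 x r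
      + \sum_l a23 m i j k l * p_E p l x r) * p_kappa p i j k x s =
      \sum_i \sum_j \sum_k p_mu p j k i x r * dx B j (dx B k (p_u p i)) x s.
    rewrite (sum3_rot (fun j k i => p_mu p j k i x r * dx B j (dx B k (p_u p i)) x s)).
    apply: eq_bigr => i _; apply: eq_bigr => j _; apply: eq_bigr => k _.
    by rewrite (mu_law con i j k Bx r0) (kappa_def geo i j k Bx s0) (D2 _ _ _ _ _ (u_reg adm k)).
  have E3 : \sum_i (\sum_j \sum_k \sum_l a23 m j k l i * p_kappa p j k l x r +
      \sum_j a33 m i j * p_E p j x r) * p_E p i x s =
      \sum_j p_sigma p j x r * dx B j (p_phi p) x s.
    apply: eq_bigr => i _.
    by rewrite -(sigma_law con i Bx r0) (E_def geo i Bx s0) mulrNN.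
  have E4 : \sum_i \sum_j (\sum_k \sum_l a17 m k l i j * p_e p k l x r +
      \sum_k \sum_l a77 m i j k l * p_V p k l x r + a47 m i j * Th r x) * p_V p i j x s =
      \sum_j \sum_k p_Q p j k x r * dx B j (dx B k (p_phi p)) x s.
    apply: eq_bigr => i _; apply: eq_bigr => j _.
    by rewrite -(Q_law con i j Bx r0) (V_def geo i j Bx s0) mulrNN (D2 _ _ _ _ _ (phi_reg adm)).
  by rewrite E1 E2 E3 E4 /P /Q !big_split /= !addrA.
split; first exact: (bc_ext oB E (bc_add (bc_sum oB bP) bQ)).
rewrite -(vint_ext E) (vintD oB bB (bc_sum oB bP) bQ) (vint_sum oB bB bP).
rewrite [X in _ + X](charge_pairing r0 s0) addr0 big1// => i _.
exact: (momentum_pairing i r0 s0).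
Qed.

Section Primitive.
Variable g : 'I_3 -> R -> E3 R -> R.
Hypotheses (g0 : forall k x, g k 0 x = 0)
  (gd : forall k T, 0 < T -> tder B 0 T (g k) (fun t x => dx B k (p_theta p) x t)).

Let bcTh s : 0 <= s -> bc (Th s).
Proof.
move=> s0; apply: bc_add; first exact: (bc_dxs hB (k := 0) (s := [::]) (theta_reg adm) isT isT s0).
apply: bc_mul; first exact: bc_cst.
exact: (bc_dxs hB (k := 1) (s := [::]) (theta_reg adm) isT isT s0).
Qed.

Let bcdTh j s : 0 <= s -> bc (dTh j s).
Proof.
move=> s0; apply: bc_add; first exact: (bc_dxs hB (k := 0) (s := [:: j]) (theta_reg adm) isT isT s0).
apply: bc_mul; first exact: bc_cst.
exact: (bc_dxs hB (k := 1) (s := [:: j]) (theta_reg adm) isT isT s0).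
Qed.

(** The heat pairing integrated over [0, r] with s fixed; both eta and g vanish at time 0. The
    integration is a mean value argument: the increment is r times a derivative that is zero at
    every positive time, by [heat_pairing]. *)
Lemma heat_primitive_pairing (r s : R) : 0 <= r -> 0 <= s ->
  bc (fun x => m_rho m * p_eta p x r * Th s x
    + \sum_j \sum_k m_k m j k * g k r x * dTh j s x) /\
  vint B (fun x => m_rho m * p_eta p x r * Th s x
    + \sum_j \sum_k m_k m j k * g k r x * dTh j s x) = 0.
Proof.
move=> r0 s0.
pose F t x := m_rho m * p_eta p x t * Th s x + \sum_j \sum_k m_k m j k * g k t x * dTh j s x.
pose dF t x := (m_rho m * dt (p_eta p) x t) * Th s x + m_rho m * p_eta p x t * 0
  + \sum_j \sum_k ((m_k m j k * dx B k (p_theta p) x t) * dTh j s x + m_k m j k * g k t x * 0).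
have FdF T : 0 < T -> tder B 0 T F dF.
  move=> T0; apply: tderD.
    apply: tderM; last exact: (tder_cst 0 T (bcTh s0)).
    by apply: tderZ; exact: (classC_tder hB (k := 0) T (eta_reg adm)).
  apply: tder_sum => j; apply: tder_sum => k.
  apply: tderM; last exact: (tder_cst 0 T (bcdTh j s0)).
  by apply: tderZ; exact: gd.
have F0 : vint B (F 0) = 0.
  rewrite -[RHS](vint0 oB bB); apply: vint_ext => x Bx; rewrite /F.
  rewrite (eta_init ini (BD Bx)) mulr0 mul0r add0r big1// => j _.
  by rewrite big1// => k _; rewrite g0 mulr0 mul0r.
have [r00|rpos] := eqVneq r 0.
  subst r; split; last exact: F0.
  have [[bF _ _] _ _] := FdF 1 ltr01; apply: bF; by rewrite lexx ler01.
have {rpos} r1 : 0 < r by rewrite lt_neqAle eq_sym rpos.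
have [[bF _ _] _ _] := FdF r r1.
split; first by apply: bF; rewrite r0 lexx.
have [c /andP[c0 _]] := tder_mean oB bB r1 (FdF r r1).
rewrite F0 subr0 => ->.
have -> : vint B (dF c) = 0.
  rewrite -[RHS](heat_pairing (ltW c0) s0); apply: vint_ext => x Bx.
  rewrite /dF mulr0 addr0; congr (_ + _); apply: eq_bigr => j _; apply: eq_bigr => k _.
  by rewrite mulr0 addr0.
by rewrite mul0r.
Qed.

Let en t x := m_rho m * (\sum_i (dt (p_u p i) x t * p_u p i x t + p_u p i x t * dt (p_u p i) x t))
  + \sum_i \sum_j m_k m i j * (g i t x * g j t x
     + m_beta m * (dx B i (p_theta p) x t * g j t x + g i t x * dx B j (p_theta p) x t))
  + m_gamma m / m_beta m * (p_theta p x t * p_theta p x t).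

(* The integrand F interpolates between the times t + z and t - z: it vanishes for z = t by the
   initial conditions, and reciprocity makes its integral independent of z. *)
Lemma energy_identity t : 0 < t -> vint B (en t) = 0.
Proof.
move=> t0.
pose P (F : R -> E3 R -> R) z := F (t + 1 * z).
pose N (F : R -> E3 R -> R) z := F (t + (-1) * z).
have tderP F dF : tder B 0 (t + t) F dF -> tder B 0 t (P F) (fun z x => 1 * P dF z x).
  move=> FdF; apply: (tder_affine (ltW t0) FdF) => z /andP[z0 zt]; apply/andP; split; lra.
have tderN F dF : tder B 0 (t + t) F dF -> tder B 0 t (N F) (fun z x => (-1) * N dF z x).
  move=> FdF; apply: (tder_affine (ltW t0) FdF) => z /andP[z0 zt]; apply/andP; split; lra.
have tt0 : 0 < t + t by rewrite addr_gt0.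
pose u i s x := p_u p i x s; pose u1 i s x := dt (p_u p i) x s.
pose u2 i s x := dt (dt (p_u p i)) x s.
pose th s x := p_theta p x s; pose th1 s x := dt (p_theta p) x s.
pose d i s x := dx B i (p_theta p) x s; pose d1 i s x := dx B i (dt (p_theta p)) x s.
have ud i : tder B 0 (t + t) (u i) (u1 i) := classC_tder hB (k := 0) _ (u_reg adm i) isT.
have u1d i : tder B 0 (t + t) (u1 i) (u2 i) := classC_tder hB (k := 1) _ (u_reg adm i) isT.
have thd : tder B 0 (t + t) th th1 := classC_tder hB (k := 0) _ (theta_reg adm) isT.
have dd i : tder B 0 (t + t) (d i) (d1 i) := dx_tder hB i _ (theta_reg adm).
have ggd i : tder B 0 (t + t) (g i) (d i) := gd i tt0.
pose F z x := m_rho m * (\sum_i (P (u1 i) z x * N (u i) z x + P (u i) z x * N (u1 i) z x))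
  + \sum_i \sum_j m_k m i j * (P (g i) z x * N (g j) z x
     + m_beta m * (P (d i) z x * N (g j) z x + P (g i) z x * N (d j) z x))
  + m_gamma m / m_beta m * (P th z x * N th z x).
pose dF z x := m_rho m * (\sum_i ((1 * P (u2 i) z x) * N (u i) z x + P (u1 i) z x * ((-1) * N (u1 i) z x)
       + ((1 * P (u1 i) z x) * N (u1 i) z x + P (u i) z x * ((-1) * N (u2 i) z x))))
  + \sum_i \sum_j m_k m i j * ((1 * P (d i) z x) * N (g j) z x + P (g i) z x * ((-1) * N (d j) z x)
     + m_beta m * ((1 * P (d1 i) z x) * N (g j) z x + P (d i) z x * ((-1) * N (d j) z x)
       + ((1 * P (d i) z x) * N (d j) z x + P (g i) z x * ((-1) * N (d1 j) z x))))
  + m_gamma m / m_beta m * ((1 * P th1 z x) * N th z x + P th z x * ((-1) * N th1 z x)).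
have FdF : tder B 0 t F dF.
  apply: tderD; first apply: tderD.
  - apply: tderZ; apply: tder_sum => i.
    by apply: tderD; apply: tderM; [exact: tderP|exact: tderN|exact: tderP|exact: tderN].
  - apply: tder_sum => i; apply: tder_sum => j; apply: tderZ; apply: tderD.
      by apply: tderM; [exact: tderP|exact: tderN].
    apply: tderZ.
    by apply: tderD; apply: tderM; [exact: tderP|exact: tderN|exact: tderP|exact: tderN].
  - by apply: tderZ; apply: tderM; [exact: tderP|exact: tderN].
have [c /andP[c0 ct]] := tder_mean oB bB t0 FdF.
have Ft : vint B (F t) = 0.
  rewrite -[RHS](vint0 oB bB); apply: vint_ext => x Bx; have Dx := BD Bx.
  have e : t + (-1) * t = 0 by ring.
  have N0 i : N (u i) t x = 0 by rewrite /N e; exact: (u_init ini i Dx).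
  have N1 i : N (u1 i) t x = 0 by rewrite /N e; exact: (v_init ini i Dx).
  have N2 i : N (g i) t x = 0 by rewrite /N e.
  have N3 : N th t x = 0 by rewrite /N e; exact: (theta_init ini Dx).
  have N4 i : N (d i) t x = 0.
    by rewrite /N e; apply: (dx_zero hB i _ Dx) => y By; exact: (theta_init ini (BD By)).
  rewrite /F N3 mulr0 mulr0 addr0 big1 => [|i _]; last by rewrite N0 N1 !mulr0 addr0.
  rewrite mulr0 add0r big1// => i _; rewrite big1// => j _.
  by rewrite N2 N4 !mulr0 addr0 mulr0 addr0 mulr0.
have F0 : F 0 = en t.
  have e1 : t + 1 * 0 = t by ring.
  have e2 : t + (-1) * 0 = t by ring.
  by apply/funext => x; rewrite /F /P /N e1 e2.
suff -> : vint B (dF c) = 0 by rewrite Ft F0 sub0r mul0r => /eqP; rewrite oppr_eq0 => /eqP.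
pose r := t + 1 * c; pose s := t + (-1) * c.
have r0 : 0 <= r by rewrite /r; lra.
have s0 : 0 <= s by rewrite /s; lra.
have [b1 v1] := work_pairing r0 s0; have [b2 v2] := work_pairing s0 r0.
have [b3 v3] := heat_primitive_pairing r0 s0; have [b4 v4] := heat_primitive_pairing s0 r0.
(* Work at (r, s) minus work at (s, r), minus heat at (r, s) plus heat at (s, r): with these signs
   [heat_algebra] eliminates eta. *)
have V := vint_comb0 oB bB b1 b2 b3 b4 v1 v2 v3 v4.
rewrite -[RHS]V; apply: vint_ext => x Bx; have Dx := BD Bx.
have K3 : W r s x - W s r x - m_rho m * p_eta p x r * Th s x + m_rho m * p_eta p x s * Th r x =
    m_gamma m / m_beta m * (th1 r x * th s x - th r x * th1 s x).
  rewrite (stress_work_swap hm).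
  exact: (heat_algebra (c_neq0 hm) (beta_neq0 hm) (erefl _) (erefl _)
    (eta_law con Bx r0) (eta_law con Bx s0)).
have K1 := inertia_algebra (m_rho m) (fun i => u i r x) (fun i => u i s x)
  (fun i => u1 i r x) (fun i => u1 i s x) (fun i => u2 i r x) (fun i => u2 i s x).
have K2 := conduction_algebra (k_sym hm) (m_beta m) (fun i => g i r x) (fun i => g i s x)
  (fun i => d i r x) (fun i => d i s x) (fun i => d1 i r x) (fun i => d1 i s x).
have K4 := relaxation_algebra (th r x) (th s x) (th1 r x) (th1 s x).
apply: (etrans (congr2 (fun y z => y + z) (congr2 (fun y z => y + z) K1 K2)
  (congr1 (fun z => m_gamma m / m_beta m * z) K4))).
exact: (energy_algebra _ _ _ _ K3).
Qed.

Let kq t x := \sum_i \sum_j m_k m i j * (g i t x * g j t x).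
Let dkq t x := \sum_i \sum_j m_k m i j *
  (dx B i (p_theta p) x t * g j t x + g i t x * dx B j (p_theta p) x t).

Let kqd T : 0 < T -> tder B 0 T kq dkq.
Proof.
move=> T0; apply: tder_sum => i; apply: tder_sum => j; apply: tderZ.
by apply: tderM; exact: gd.
Qed.

Let kq_ge0 t x : 0 <= kq t x.
Proof.
rewrite (_ : kq t x = \sum_i \sum_j m_k m i j * g i t x * g j t x); first exact: (k_ge0 hm).
by apply: eq_bigr => i _; apply: eq_bigr => j _; rewrite mulrA.
Qed.

Let psi t x := m_rho m * (\sum_i p_u p i x t * p_u p i x t) + m_beta m * kq t x.

(** The integral of [psi] at time t is t times its derivative at an intermediate time, which
    [energy_identity] shows to be at most 0, while [psi] is nonnegative. *)
Let kinetic_zero t x : 0 <= t -> B x -> psi t x = 0.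
Proof.
move=> t0 Bx.
pose dpsi t x := m_rho m * (\sum_i (dt (p_u p i) x t * p_u p i x t + p_u p i x t * dt (p_u p i) x t))
  + m_beta m * dkq t x.
have pd T : 0 < T -> tder B 0 T psi dpsi.
  move=> T0; apply: tderD; last by apply: tderZ; exact: kqd.
  apply: tderZ; apply: tder_sum => i.
  by apply: tderM; exact: (classC_tder hB (k := 0) T (u_reg adm i) isT).
have p0 y : B y -> psi 0 y = 0.
  move=> By; rewrite /psi /kq !big1 ?mulr0 ?addr0// => i _.
    by rewrite big1// => j _; rewrite g0 mul0r mulr0.
  by rewrite (u_init ini i (BD By)) mulr0.
move: t0; rewrite le_eqVlt => /predU1P[<-|t0]; first exact: p0.
have psi_ge0 y : 0 <= psi t y.
  apply: addr_ge0; last by apply: mulr_ge0; [exact: ltW|exact: kq_ge0].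
  apply: mulr_ge0; first exact: ltW (rho_gt0 hm).
  by apply: sumr_ge0 => i _; rewrite -expr2 sqr_ge0.
have [[bF _ _] _ _] := pd t t0.
have bpsi : bounded_continuous B (psi t) by apply: bF; rewrite lexx ltW.
have [c /andP[c0 ct]] := tder_mean oB bB t0 (pd t t0).
have -> : vint B (psi 0) = 0 by rewrite -[RHS](vint0 oB bB); exact: vint_ext.
rewrite !subr0 => E.
suff Ilt : vint B (dpsi c) <= 0.
  apply: (vint_eq0 oB bB bpsi (fun y _ => psi_ge0 y) _ Bx); apply/eqP; rewrite eq_le.
  rewrite (vint_ge0 (fun y _ => psi_ge0 y)) andbT E mulr_le0_ge0//; exact: ltW.
have c1 : 0 <= c <= c by rewrite lexx ltW.
have bd : bounded_continuous B (dpsi c) by have [_ [h _ _] _] := pd c c0; exact: h.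
have bk : bounded_continuous B (kq c) by have [[h _ _] _ _] := kqd c0; exact: h.
have bt : bounded_continuous B (fun y => p_theta p y c).
  exact: (bc_dxs hB (k := 0) (s := [::]) (theta_reg adm) isT isT (ltW c0)).
have bres : bounded_continuous B
    (fun y => kq c y + m_gamma m / m_beta m * (p_theta p y c * p_theta p y c)).
  by apply: bc_add => //; apply: bc_mul; [exact: bc_cst|exact: bc_mul].
have H := energy_identity c0.
have {}H : vint B (dpsi c) +
    vint B (fun y => kq c y + m_gamma m / m_beta m * (p_theta p y c * p_theta p y c)) = 0.
  rewrite -(vintD oB bB bd bres) -[RHS]H; apply: vint_ext => y By.
  exact: energy_split.
rewrite -[leRHS]H lerDl; apply: vint_ge0 => y By; apply: addr_ge0; first exact: kq_ge0.
apply: mulr_ge0; first by rewrite divr_ge0// ltW.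
by rewrite -expr2 sqr_ge0.
Qed.

Let energy_zero t x : 0 <= t -> B x -> (forall i, p_u p i x t = 0) /\ kq t x = 0.
Proof.
move=> t0 Bx; have := kinetic_zero t0 Bx; rewrite /psi => /eqP.
have s0 : 0 <= \sum_i p_u p i x t * p_u p i x t.
  by apply: sumr_ge0 => i _; rewrite -expr2 sqr_ge0.
rewrite paddr_eq0; last 2 first.
- by apply: mulr_ge0 s0; exact: ltW (rho_gt0 hm).
- by apply: mulr_ge0; [exact: ltW|exact: kq_ge0].
rewrite !mulf_eq0 (gt_eqF (rho_gt0 hm)) (gt_eqF hbeta)/= => /andP[/eqP su /eqP ->].
have sq j : true -> 0 <= p_u p j x t * p_u p j x t by rewrite -expr2 sqr_ge0.
split=> // i; have /eqP := psumr_eq0P sq su (i := i) isT.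
by rewrite mulf_eq0 orbb => /eqP.
Qed.

(** The conductivity is only semidefinite, so [kq] = 0 gives no information on theta by itself. With
    u, [kq] and its time derivative equal to zero, [energy_identity] reduces to the term gamma /
    beta theta^2. *)
Lemma motion_temperature_zero t x : 0 <= t -> B x ->
  (forall i, p_u p i x t = 0) /\ p_theta p x t = 0.
Proof.
move=> t0 Bx; split; first exact: (energy_zero t0 Bx).1.
move: t0; rewrite le_eqVlt => /predU1P[<-|t0]; first exact: (theta_init ini (BD Bx)).
(* [kq] vanishes at all times, and t > 0 leaves room on both sides for its derivative. *)
have dk0 y : B y -> dkq t y = 0.
  move=> By; have [_ _ h] := kqd (addr_gt0 t0 ltr01).
  have [_ <-] : is_derive t (1:R) (kq^~ y) (dkq t y) by apply: h => //; rewrite t0 ltrDl ltr01.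
  rewrite (near_eq_derive (g := cst 0)) ?derive_cst//.
  have tp : \forall s \near t, 0 < s by exact: lt_nbhsr.
  by apply: filterS tp => s s0; exact: (energy_zero (ltW s0) By).2.
have bt : bounded_continuous B (fun y => p_theta p y t).
  exact: (bc_dxs hB (k := 0) (s := [::]) (theta_reg adm) isT isT (ltW t0)).
have gb : 0 < m_gamma m / m_beta m by rewrite divr_gt0.
have bz : bounded_continuous B (fun y => m_gamma m / m_beta m * (p_theta p y t * p_theta p y t)).
  by apply: bc_mul; [exact: bc_cst|exact: bc_mul].
have z0 y : B y -> 0 <= m_gamma m / m_beta m * (p_theta p y t * p_theta p y t).
  by move=> _; rewrite mulr_ge0 ?(ltW gb)// -expr2 sqr_ge0.
have H := energy_identity t0.
have {}H : vint B (fun y => m_gamma m / m_beta m * (p_theta p y t * p_theta p y t)) = 0.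
  rewrite -[RHS]H; apply: vint_ext => y By; rewrite /en -energy_split.
  have [u0 k0] := energy_zero (ltW t0) By; have d0 := dk0 _ By.
  rewrite [X in _ + _ * X + _]d0 [X in _ + (X + _)]k0 mulr0 addr0 add0r.
  by rewrite big1 ?mulr0 ?add0r// => i _; rewrite u0 mulr0 mul0r addr0.
have := vint_eq0 oB bB bz z0 H Bx => /eqP.
by rewrite mulf_eq0 (gt_eqF gb)/= mulf_eq0 orbb => /eqP.
Qed.

End Primitive.

Lemma motion_zero t x : 0 <= t -> B x -> (forall i, p_u p i x t = 0) /\ p_theta p x t = 0.
Proof.
have /choice[g gP] : forall k, exists G : R -> E3 R -> R, (forall x, G 0 x = 0) /\
    forall T, 0 < T -> tder B 0 T G (fun t x => dx B k (p_theta p) x t).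
  by move=> k; have [G G0 GT] := dx_primitive hB k (theta_reg adm); exists G.
exact: (motion_temperature_zero (fun k => (gP k).1) (fun k => (gP k).2)).
Qed.

(** * The electric potential and the remaining fields *)

Hypothesis hF : electric_form_definite m.

Let u0 i t x : 0 <= t -> B x -> p_u p i x t = 0.
Proof. by move=> t0 Bx; have [h _] := motion_zero t0 Bx. Qed.

Let th0 t x : 0 <= t -> B x -> p_theta p x t = 0.
Proof. by move=> t0 Bx; have [_] := motion_zero t0 Bx. Qed.

Let dth0 t x : 0 <= t -> B x -> dt (p_theta p) x t = 0.
Proof. by move=> t0 Bx; apply: dt_zero => // s s0; exact: th0. Qed.

Let du0 i j t x : 0 <= t -> closure B x -> dx B j (p_u p i) x t = 0.
Proof. by move=> t0 Dx; apply: (dx_zero hB) => // y By; exact: u0. Qed.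

Let e0 i j t x : 0 <= t -> B x -> p_e p i j x t = 0.
Proof. by move=> t0 Bx; rewrite (e_def geo i j Bx t0) !du0 ?addr0 ?mulr0//; exact: BD. Qed.

Let kap0 i j k t x : 0 <= t -> B x -> p_kappa p i j k x t = 0.
Proof.
move=> t0 Bx; rewrite (kappa_def geo i j k Bx t0); apply: (dx_zero hB); last exact: BD.
by move=> y /BD Dy; exact: du0.
Qed.

Let beta0 i t x : 0 <= t -> B x -> p_beta p i x t = 0.
Proof.
move=> t0 Bx; rewrite (beta_def geo i Bx t0); apply: (dx_zero hB); last exact: BD.
by move=> y By; exact: th0.
Qed.

Let sigmaE i t x : 0 <= t -> B x -> - p_sigma p i x t = \sum_j a33 m i j * p_E p j x t.
Proof.
move=> t0 Bx; rewrite (sigma_law con i Bx t0) big1 ?add0r// => j _.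
by rewrite big1// => k _; rewrite big1// => l _; rewrite kap0// mulr0.
Qed.

Let QE i j t x : 0 <= t -> B x ->
  - p_Q p i j x t = \sum_k \sum_l a77 m i j k l * p_V p k l x t.
Proof.
move=> t0 Bx; rewrite (Q_law con i j Bx t0) th0// dth0// mulr0 addr0 mulr0 addr0.
by rewrite big1 ?add0r// => k _; rewrite big1// => l _; rewrite e0// mulr0.
Qed.

Let elec t x : R := electric_form m (\row_i p_E p i x t) (\matrix_(i, j) p_V p i j x t).

Let elecE t x : elec t x = \sum_i (\sum_j a33 m i j * p_E p j x t) * p_E p i x t
  + \sum_i \sum_j (\sum_k \sum_l a77 m i j k l * p_V p k l x t) * p_V p i j x t.
Proof.
rewrite /elec /electric_form; congr (_ + _).
  rewrite exchange_big; apply: eq_bigr => i _; rewrite mulr_suml; apply: eq_bigr => j _.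
  by rewrite !mxE (a33_sym hm).
apply: eq_bigr => i _; apply: eq_bigr => j _; rewrite mulr_suml; apply: eq_bigr => k _.
by rewrite mulr_suml; apply: eq_bigr => l _; rewrite !mxE.
Qed.

Let elec_integral t : 0 <= t -> bounded_continuous B (elec t) /\ vint B (elec t) = 0.
Proof.
move=> t0.
have bE i : bounded_continuous B (fun x => p_E p i x t).
  exact: (bc_dxs hB (k := 0) (s := [::]) (E_reg adm i) isT isT t0).
have bV i j : bounded_continuous B (fun x => p_V p i j x t).
  exact: (bc_dxs hB (k := 0) (s := [::]) (V_reg adm i j) isT isT t0).
split.
  apply: (bc_ext oB (fun x _ => esym (elecE t x))); apply: bc_add.
    apply: (bc_sum oB) => i; apply: bc_mul => //; apply: (bc_sum oB) => j.
    by apply: bc_mul => //; exact: bc_cst.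
  apply: (bc_sum oB) => i; apply: (bc_sum oB) => j; apply: bc_mul => //.
  apply: (bc_sum oB) => k; apply: (bc_sum oB) => l.
  by apply: bc_mul => //; exact: bc_cst.
rewrite -[RHS](charge_pairing t0 t0); apply: vint_ext => x Bx.
rewrite elecE; congr (_ + _); apply: eq_bigr => i _.
  by rewrite -(sigmaE i t0 Bx) (E_def geo i Bx t0) mulrNN.
apply: eq_bigr => j _.
have D2 : dx B j (dx B i (p_phi p)) x t = dx B i (dx B j (p_phi p)) x t.
  apply: (pd_swap oB BD j i _ Bx).
  exact: (classC_Ck_dxs (k := 0) (s := [::]) (phi_reg adm) isT t0).
by rewrite -(QE i j t0 Bx) (V_def geo i j Bx t0) mulrNN D2.
Qed.

Let electric_zero t x : 0 <= t -> B x ->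
  (forall i, p_E p i x t = 0) /\ forall i j, p_V p i j x t = 0.
Proof.
move=> t0 Bx; have [bel vel] := elec_integral t0.
pose E y := \row_i p_E p i y t; pose V y := \matrix_(i, j) p_V p i j y t.
(* Definiteness is assumed on symmetric matrices only. *)
have Vs y : B y -> (V y)^T = V y.
  by move=> By; apply/matrixP => i j; rewrite !mxE (V_sym adm j i (BD By) t0).
have zero y : ~~ ((E y != 0) || (V y != 0)) -> elec t y = 0.
  rewrite negb_or !negbK => /andP[/eqP Ey /eqP Vy].
  rewrite /elec -/(E y) -/(V y) Ey Vy /electric_form !big1 ?addr0// => i _.
    by rewrite !big1// => j _; rewrite big1// => k _; rewrite big1// => l _; rewrite !mxE mulr0.
  by rewrite big1// => j _; rewrite !mxE mulr0.
have EV : ~~ ((E x != 0) || (V x != 0)).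
  case: hF => hF'.
    have ge0 y : B y -> 0 <= elec t y.
      move=> By; have [nz|/zero ->//] := boolP ((E y != 0) || (V y != 0)).
      by apply: ltW; exact: hF' (Vs _ By) nz.
    apply/negP => nz; have := hF' _ _ (Vs _ Bx) nz.
    by rewrite [X in 0 < X](vint_eq0 oB bB bel ge0 vel Bx) ltxx.
  have ge0 y : B y -> 0 <= - elec t y.
    move=> By; have [nz|/zero ->] := boolP ((E y != 0) || (V y != 0)); last by rewrite oppr0.
    by rewrite oppr_ge0; apply: ltW; exact: hF' (Vs _ By) nz.
  apply/negP => nz; have := hF' _ _ (Vs _ Bx) nz.
  have vel' : vint B (fun y => - elec t y) = 0 by rewrite (vint_opp oB bB bel) vel oppr0.
  have /eqP := vint_eq0 oB bB (bc_opp oB bel) ge0 vel' Bx; rewrite oppr_eq0 => /eqP h.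
  by rewrite [X in X < 0]h ltxx.
move: EV; rewrite negb_or !negbK => /andP[/eqP Ex /eqP Vx]; split.
  by move=> i; move/rowP : Ex => /(_ i); rewrite !mxE.
by move=> i j; move/matrixP : Vx => /(_ i j); rewrite !mxE.
Qed.

Hypothesis hS4 : S 4%N !=set0.

(** Connectedness of B enters here: the set where phi has the same value as at x is open and closed
    in B. The points of S_4 are reached from B by continuity. *)
Let phi0 t x : 0 <= t -> B x -> p_phi p x t = 0.
Proof.
move=> t0 Bx; have [_ cB _ _] := hB.
have Cphi : C 1 ((p_phi p)^~ t).
  exact: (classC_Ck_dxs (k := 0) (s := [::]) (phi_reg adm) isT t0).
have loc y : B y -> \forall z \near y, p_phi p z t = p_phi p y t.
  move=> By; have /nbhs_ballP[r /= r0 rB] := near_body oB By.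
  apply/nbhs_ballP; exists r => // z yz.
  have dphi j w : ball y r w -> derivable ((p_phi p)^~ t) w (axis R j).
    by move=> /rB Bw; exact: Ck_derivable Cphi Bw.
  have [xi xiP h] := MVT_space r0 dphi (ballxx y r0) yz.
  apply/eqP; rewrite -subr_eq0 h big1// => j _; rewrite -(pd_in j _ (rB _ (xiP j))).
  have dz : - dx B j (p_phi p) (xi j) t = 0.
    by rewrite -(E_def geo j (rB _ (xiP j)) t0) (electric_zero t0 (rB _ (xiP j))).1.
  by rewrite [X in X * _](oppr_inj (etrans dz (esym (oppr0 R)))) mul0r.
have const y : B y -> p_phi p y t = p_phi p x t.
  pose A := [set z | B z /\ p_phi p z t = p_phi p x t].
  have -> : B = A; last by case.
  apply/esym; apply: cB.
  - by exists x.
  - exists A; last by apply/seteqP; split => z; [case|case].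
    rewrite openE => z [Bz zx]; apply: filterS2 (near_body oB Bz) (loc z Bz) => w Bw wz.
    by split; [exact: Bw|exact: etrans wz zx].
  - exists (closure A); first exact: closed_closure.
    apply/seteqP; split => z; first by move=> Az; split; [case: Az|exact: subset_closure].
    move=> [Bz Az]; split => //; have [w [[Bw wx] zw]] := Az _ (loc z Bz).
    by rewrite -zw.
have [q Sq] := hS4.
have Dq : closure B q by apply: bdry_closure; have [s _ _ _] := @hS 4%N isT; exact: s.
have Z : p_phi p q t - p_phi p x t = 0.
  apply: (@zero_on_closure R (closure B) B (fun y => p_phi p y t - p_phi p x t)) => //.
  - exact: closed_closure.
  - have := Ck_continuous (CkB oB BD DB Cphi (Ck_cst oB BD DB 1 (p_phi p x t))); exact.
  - by move=> y By; rewrite const// subrr.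
have := phi_bc bdc Sq t0; rewrite /= => q0.
by move: Z; rewrite q0 sub0r => /eqP; rewrite oppr_eq0 => /eqP.
Qed.

Let z2 (c f : 'I_3 -> 'I_3 -> R) : (forall i j, f i j = 0) -> \sum_i \sum_j c i j * f i j = 0.
Proof. by move=> f0; rewrite big1// => i _; rewrite big1// => j _; rewrite f0 mulr0. Qed.

(** The field equations hold in B only; [field_zero] carries each conclusion to the closure by
    continuity. *)
Lemma homogeneous_solution_zero : process_eq B p (Process (fun _ _ _ => 0) (fun _ _ => 0)
  (fun _ _ => 0) (fun _ _ _ _ => 0) (fun _ _ _ _ _ => 0) (fun _ _ _ => 0) (fun _ _ _ => 0)
  (fun _ _ _ _ => 0) (fun _ _ _ _ => 0) (fun _ _ _ _ _ => 0) (fun _ _ _ => 0)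
  (fun _ _ _ _ => 0) (fun _ _ => 0) (fun _ _ _ => 0)).
Proof.
have E0 i x t (t0 : 0 <= t) (Bx : B x) := (electric_zero t0 Bx).1 i.
have V0 i j x t (t0 : 0 <= t) (Bx : B x) := (electric_zero t0 Bx).2 i j.
split; first by move=> i; apply: field_zero (u_reg adm i) _ => x t; exact: u0.
split; first by apply: field_zero (theta_reg adm) _ => x t; exact: th0.
split; first by apply: field_zero (phi_reg adm) _ => x t; exact: phi0.
split; first by move=> i j; apply: field_zero (e_reg adm i j) _ => x t; exact: e0.
split; first by move=> i j k; apply: field_zero (kappa_reg adm i j k) _ => x t; exact: kap0.
split; first by move=> i; apply: field_zero (beta_reg adm i) _ => x t; exact: beta0.
split; first by move=> i; apply: field_zero (E_reg adm i) _ => x t; exact: E0.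
split; first by move=> i j; apply: field_zero (V_reg adm i j) _ => x t; exact: V0.
split.
  move=> i j; apply: field_zero (tau_reg adm i j) _ => x t t0 Bx.
  rewrite (tau_law con i j Bx t0) th0// dth0// mulr0 addr0 mulr0 addr0 !z2 ?addr0// => k l.
    exact: V0.
  exact: e0.
split.
  move=> i j k; apply: field_zero (mu_reg adm i j k) _ => x t t0 Bx.
  rewrite (mu_law con i j k Bx t0) [X in _ + X]big1 ?addr0 => [|l _]; last by rewrite E0// mulr0.
  by rewrite big1// => l _; apply: z2 => h r; exact: kap0.
split.
  move=> i; apply: field_zero (sigma_reg adm i) _ => x t t0 Bx.
  apply: oppr_inj; rewrite oppr0 (sigmaE i t0 Bx) big1// => j _; by rewrite E0// mulr0.
split.
  move=> i j; apply: field_zero (Q_reg adm i j) _ => x t t0 Bx.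
  by apply: oppr_inj; rewrite oppr0 (QE i j t0 Bx); apply: z2 => k l; exact: V0.
split.
  apply: field_zero (eta_reg adm) _ => x t t0 Bx.
  have := eta_law con Bx t0; rewrite th0// dth0// mulr0 addr0 mulr0 addr0 !z2 => [|k l|k l].
  - by rewrite addr0 => /eqP; rewrite oppr_eq0 mulf_eq0 (gt_eqF (rho_gt0 hm)) => /eqP.
  - exact: V0.
  - exact: e0.
move=> i; apply: field_zero (q_reg adm i) _ => x t t0 Bx.
have := q_law con i Bx t0; rewrite big1 => [|j _]; last by rewrite beta0// mulr0.
by move=> /eqP; rewrite oppr_eq0 mulf_eq0 invr_eq0 (gt_eqF (T0_gt0 hm)) => /eqP.
Qed.

End Homogeneous.

Lemma process_eq_sub (R : realType) (B : set (E3 R)) (p p' : process_array R) :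
  process_eq B (psub p p') (Process (fun _ _ _ => 0) (fun _ _ => 0)
  (fun _ _ => 0) (fun _ _ _ _ => 0) (fun _ _ _ _ _ => 0) (fun _ _ _ => 0) (fun _ _ _ => 0)
  (fun _ _ _ _ => 0) (fun _ _ _ _ => 0) (fun _ _ _ _ _ => 0) (fun _ _ _ => 0)
  (fun _ _ _ _ => 0) (fun _ _ => 0) (fun _ _ _ => 0)) -> process_eq B p p'.
Proof.
have H f f' : eq_on_closure B (fsub f f') (fun _ _ => 0) -> eq_on_closure B f f'.
  by move=> h x t Dx t0; apply/eqP; rewrite -subr_eq0; apply/eqP; exact: h.
move=> [h1 [h2 [h3 [h4 [h5 [h6 [h7 [h8 [h9 [h10 [h11 [h12 [h13 h14]]]]]]]]]]]]].
split; first by move=> i; exact: H (h1 i).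
split; first exact: H h2.
split; first exact: H h3.
split; first by move=> i j; exact: H (h4 i j).
split; first by move=> i j k; exact: H (h5 i j k).
split; first by move=> i; exact: H (h6 i).
split; first by move=> i; exact: H (h7 i).
split; first by move=> i j; exact: H (h8 i j).
split; first by move=> i j; exact: H (h9 i j).
split; first by move=> i j k; exact: H (h10 i j k).
split; first by move=> i; exact: H (h11 i).
split; first by move=> i j; exact: H (h12 i j).
split; first exact: H h13.
by move=> i; exact: H (h14 i).
Qed.

Theorem theorem4 (R : realType) (B : set (E3 R)) (n : E3 R -> E3 R)
    (m : material R) (S Sigma : nat -> set (E3 R)) (d : prescribed_data R)
    (hB : smooth_bounded_region B) (hn : outward_unit_normal B n)
    (hm : material_axioms m) (hS : boundary_partition B S Sigma)
    (hd : continuous_data B S Sigma d)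
    (hbeta : 0 < m_beta m) (hgamma : 0 < m_gamma m)
    (hF : electric_form_definite m) (hS4 : S 4%N !=set0)
    (p p' : process_array R) :
  solution_Pi B n m S Sigma d p -> solution_Pi B n m S Sigma d p' ->
  process_eq B p p'.
Proof.
move=> sp sp'; apply: process_eq_sub.
have sol := psub_solution hB hn hS sp sp'.
exact: (homogeneous_solution_zero hB hn hm hS hbeta hgamma sol hF hS4).
Qed.
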